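(* Let $F$ be a field, let $A$ be a central simple $F$-algebra of degree $n$, let $K/F$ be a splitting field for $A$, let $1\le d\le n$, and let $\lambda=[\lambda_1,\dots,\lambda_d]$ be a partition with $n-d\ge\lambda_1\ge\cdots\ge\lambda_d\ge 0$. Then the generalized Severi-Brauer variety $\mathrm{SB}(d,A)$ has a closed subvariety $P$ defined over $F$ such that $P\otimes_F K\simeq X_\lambda$ if and only if $\mathrm{ind}(A)\mid\gcd(\overline{E_\lambda})$. Moreover, in this case, for such a $P$, $A$ contains a flag of right ideals $I_{a_1}\subset\cdots\subset I_{a_r}$, where $\overline{E_\lambda}=\{a_1<\dots<a_r\}$ and $\mathrm{rrank}(I_{a_i})=a_i$, such that for any finite field extension $L/F$, $$P(L)=\{J\in \mathrm{SB}(d,A)(L) \;:\; \mathrm{rrank}(J\cap (I_a\otimes_F L))\ge j \text{ for all } (j,a)\in E_\lambda\}.$$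
   Context: For a central simple $F$-algebra $A$, $\deg(A)=\sqrt{\dim_F A}$, and $\mathrm{ind}(A)$ is the degree of the division algebra Brauer equivalent to $A$. The reduced rank of a right ideal $I$ of $A$ is $\mathrm{rrank}(I)=\dim_F(I)/\deg(A)$. For a field extension $L/F$ put $A_L=A\otimes_F L$. The generalized Severi-Brauer variety $\mathrm{SB}(d,A)$ is the $F$-variety with $\mathrm{SB}(d,A)(L)=\{I\subseteq A_L \text{ right ideal}: \mathrm{rrank}(I)=d\}$; it is a twisted form of the Grassmannian $\mathrm{Gr}(d,n)$. Schubert varieties: if $A_K\simeq\mathrm{End}_K(V)$ is split of degree $n$, and $I_1\subset I_2\subset\cdots\subset I_n=A_K$ is a full chain of right ideals with $\mathrm{rrank}(I_j)=j$, the Schubert variety $X_\lambda\subseteq\mathrm{SB}(d,A_K)$ is $X_\lambda=\{J : \mathrm{rrank}(J\cap I_{n-d+j-\lambda_j})\ge j \text{ for } j=1,\dots,d\}$. The notation $P\otimes_F K\simeq X_\lambda$ means that, under an identification $A_K\simeq \mathrm{End}_K(V)$, the closed subvariety $P_K\subseteq\mathrm{SB}(d,A_K)$ is identified with the Schubert variety $X_\lambda$ for some full chain of right ideals of $A_K$. Essential set: $E_\lambda=\{(j,\,n-d+j-\lambda_j) : 1\le j\le d,\ \lambda_j>\lambda_{j+1}\}$ with the convention $\lambda_{d+1}=0$, and $\overline{E_\lambda}=\{a : (j,a)\in E_\lambda\}$ is its projection to the second coordinate. (The gcd of the empty set is $0$.) *)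

(* Defs.v *)
From HB Require Import structures.
From Stdlib Require Import ClassicalEpsilon.
From mathcomp Require Import all_boot all_order all_algebra all_field.
From mathcomp Require Import mpoly.

Set Implicit Arguments.
Unset Strict Implicit.
Unset Printing Implicit Defensive.

Import GRing.Theory.

Local Open Scope ring_scope.

(* Scalar extension A_L = A ⊗_F L along an arbitrary field morphism
   phi : F -> L. An element is the row of its L-coordinates in the basis
   b_i ⊗ 1, with b = vbasis {:A}, and the multiplication is the L-bilinear
   extension of that of A. *)
Definition scext (F : fieldType) (A : falgType F) (L : fieldType)
  (phi : {rmorphism F -> L}) : Type := 'rV[L]_(\dim {:A}).

Section ScalarExtension.
Variables (F : fieldType) (A : falgType F) (L : fieldType).
Variable phi : {rmorphism F -> L}.

Local Notation m := (\dim {:A}).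
Local Notation AL := (scext A phi).

#[warnings="-redundant-canonical-projection"]
HB.instance Definition _ := Vector.copy AL 'rV[L]_m.

Let e (i : 'I_m) : A := tnth (vbasis {:A}) i.

(* a |-> a ⊗ 1 *)
Definition scemb (a : A) : AL := \row_i phi (coord (vbasis {:A}) i a).

Definition scmul (u v : AL) : AL :=
  \sum_i \sum_j ((u : 'rV[L]_m) 0 i * (v : 'rV[L]_m) 0 j) *: scemb (e i * e j).

Fact scemb_sumZ (I : finType) (c : I -> F) (a : I -> A) :
  scemb (\sum_i c i *: a i) = \sum_i phi (c i) *: scemb (a i).
Proof.
apply/rowP=> k; rewrite mxE linear_sum rmorph_sum summxE.
by apply: eq_bigr => i _; rewrite linearZ rmorphM !mxE.
Qed.

Fact scextE (u : AL) : u = \sum_i (u : 'rV[L]_m) 0 i *: scemb (e i).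
Proof.
apply/rowP=> k; rewrite summxE (bigD1 k) //= big1 => [|i ik].
  by rewrite addr0 !mxE /e (tnth_nth 0) coord_free ?(basis_free (vbasisP _)) //
    eqxx rmorph1 mulr1.
by rewrite !mxE /e (tnth_nth 0) coord_free ?(basis_free (vbasisP _)) //
  (negPf ik) rmorph0 mulr0.
Qed.

Fact scmulDl : left_distributive scmul +%R.
Proof.
move=> u v w; rewrite /scmul -big_split; apply: eq_bigr => i _.
by rewrite -big_split; apply: eq_bigr => j _; rewrite mxE mulrDl scalerDl.
Qed.

Fact scmulDr : right_distributive scmul +%R.
Proof.
move=> u v w; rewrite /scmul -big_split; apply: eq_bigr => i _.
by rewrite -big_split; apply: eq_bigr => j _; rewrite mxE mulrDr scalerDl.
Qed.

Fact scmulZl c (u v : AL) : c *: scmul u v = scmul (c *: u) v.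
Proof.
rewrite /scmul scaler_sumr; apply: eq_bigr => i _; rewrite scaler_sumr.
by apply: eq_bigr => j _; rewrite scalerA mxE mulrA.
Qed.

Fact scmulZr c (u v : AL) : c *: scmul u v = scmul u (c *: v).
Proof.
rewrite /scmul scaler_sumr; apply: eq_bigr => i _; rewrite scaler_sumr.
by apply: eq_bigr => j _; rewrite scalerA mxE mulrCA.
Qed.

Fact scmul_suml (I : finType) (u : I -> AL) v :
  scmul (\sum_i u i) v = \sum_i scmul (u i) v.
Proof.
apply: (big_morph (scmul^~ v)) => [x y|]; first exact: scmulDl.
by have := scmulZl 0 0 v; rewrite !scale0r.
Qed.

Fact scmul_sumr (I : finType) u (v : I -> AL) :
  scmul u (\sum_i v i) = \sum_i scmul u (v i).
Proof.
apply: (big_morph (scmul u)) => [x y|]; first exact: scmulDr.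
by have := scmulZr 0 u 0; rewrite !scale0r.
Qed.

Fact scembM a b : scemb (a * b) = scmul (scemb a) (scemb b).
Proof.
have -> : a * b = \sum_i coord (vbasis {:A}) i a *:
                    \sum_j coord (vbasis {:A}) j b *: (e i * e j).
  rewrite {1}(coord_vbasis (memvf a)) mulr_suml; apply: eq_bigr => i _.
  rewrite {1}(coord_vbasis (memvf b)) -scalerAl mulr_sumr; congr (_ *: _).
  by apply: eq_bigr => j _; rewrite -scalerAr /e !(tnth_nth 0).
rewrite scemb_sumZ; apply: eq_bigr => i _; rewrite scemb_sumZ scaler_sumr.
by apply: eq_bigr => j _; rewrite scalerA !mxE.
Qed.

Fact scmulA : associative scmul.
Proof.
have A3 a b w : scmul (scemb a) (scmul (scemb b) w)
              = scmul (scmul (scemb a) (scemb b)) w.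
  rewrite (scextE w) (scmul_sumr (scemb b)) (scmul_sumr (scemb a)).
  rewrite (scmul_sumr (scmul _ _)); apply: eq_bigr => k _.
  by rewrite -!scmulZr -!scembM mulrA.
have A2 a v w : scmul (scemb a) (scmul v w) = scmul (scmul (scemb a) v) w.
  rewrite (scextE v) scmul_suml !(scmul_sumr (scemb a)) scmul_suml.
  by apply: eq_bigr => j _; rewrite -scmulZl -!scmulZr A3 scmulZl.
move=> u v w; rewrite (scextE u) (scmul_suml _ (scmul v w)).
rewrite (scmul_suml _ v) (scmul_suml _ w); apply: eq_bigr => i _.
by rewrite -!scmulZl A2.
Qed.

Fact scmul1l : left_id (scemb 1) scmul.
Proof.
move=> u; rewrite {1}(scextE u) scmul_sumr [RHS]scextE; apply: eq_bigr => i _.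
by rewrite -scmulZr -scembM mul1r.
Qed.

Fact scmul1r : right_id (scemb 1) scmul.
Proof.
move=> u; rewrite {1}(scextE u) scmul_suml [RHS]scextE; apply: eq_bigr => i _.
by rewrite -scmulZl -scembM mulr1.
Qed.

Fact scext_oner_neq0 : scemb 1 != 0.
Proof.
apply: contra_neq (oner_neq0 A) => /rowP e0.
rewrite (coord_vbasis (memvf 1)) big1 // => i _.
by have /eqP := e0 i; rewrite !mxE fmorph_eq0 => /eqP->; rewrite scale0r.
Qed.

HB.instance Definition _ := GRing.Zmodule_isNzRing.Build AL
  scmulA scmul1l scmul1r scmulDl scmulDr scext_oner_neq0.
HB.instance Definition _ := GRing.Lmodule_isLalgebra.Build L AL scmulZl.
HB.instance Definition _ := GRing.Lalgebra_isAlgebra.Build L AL scmulZr.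
HB.instance Definition _ := Algebra_isFalgebra.Build L AL.

End ScalarExtension.

(* I ⊗_F L, for a subspace I of A *)
Definition extend_vs (F : fieldType) (A : falgType F) (L : fieldType)
    (phi : {rmorphism F -> L}) (I : {vspace A}) : {vspace scext A phi} :=
  <<[seq scemb phi a | a <- vbasis I]>>%VS.

(* I ⊗_K L, for a subspace I of A_K, under the identification of (A_K)_L
   with A_L *)
Definition extend_vs2 (F : fieldType) (A : falgType F) (K L : fieldType)
    (phi : {rmorphism F -> K}) (tau : {rmorphism K -> L})
    (I : {vspace scext A phi}) : {vspace scext A (tau \o phi)} :=
  <<[seq (map_mx tau (v : 'rV[K]_(\dim {:A})) : scext A (tau \o phi))
       | v <- vbasis I]>>%VS.

Definition central_algebra (F : fieldType) (A : falgType F) : Prop :=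
  ('Z({:A}) = 1)%VS.

Definition simple_algebra (F : fieldType) (A : falgType F) : Prop :=
  forall I : {vspace A}, ({:A} * I <= I)%VS -> (I * {:A} <= I)%VS ->
    I = 0%VS \/ I = fullv.

Definition division_algebra (F : fieldType) (D : falgType F) : Prop :=
  forall x : D, x != 0 -> x \is a GRing.unit.

(* M_p(A) and M_q(B) are isomorphic F-algebras for some p, q > 0. The scalar
   c of F acts on matrices over A through c%:A. *)
Definition brauer_equivalent (F : fieldType) (A B : falgType F) : Prop :=
  exists (p q : nat) (f : {rmorphism 'M[A]_p.+1 -> 'M[B]_q.+1}),
    bijective f /\
    forall (c : F) (X : 'M[A]_p.+1), f ((c%:A : A) *: X) = (c%:A : B) *: f X.

Definition is_index (F : fieldType) (A : falgType F) (i : nat) : Prop :=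
  exists D : falgType F,
    [/\ central_algebra D, division_algebra D, brauer_equivalent A D
      & \dim {:D} = (i ^ 2)%N].

Definition ind (F : fieldType) (A : falgType F) : nat :=
  epsilon (inhabits 0%N) (is_index A).

Definition splits (F : fieldType) (A : falgType F) (n : nat) (K : fieldType)
    (phi : {rmorphism F -> K}) : Prop :=
  exists f : {linear scext A phi -> 'M[K]_n}, monoid_morphism f /\ bijective f.

Definition right_ideal (F : fieldType) (B : falgType F) (I : {vspace B}) :=
  (I * {:B} <= I)%VS.

(* n is the degree of the ambient algebra *)
Definition rrank (F : fieldType) (B : falgType F) (n : nat) (I : {vspace B}) :=
  (\dim I %/ n)%N.

(* J is an L-point of SB(d, A) *)
Definition SB (F : fieldType) (A : falgType F) (n d : nat) (L : fieldType)
    (phi : {rmorphism F -> L}) (J : {vspace scext A phi}) : Prop :=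
  right_ideal J /\ rrank n J = d.

(* SB(d, A) is a closed subvariety of the Grassmannian of (d * n)-dimensional
   subspaces of A, itself embedded in a projective space by its Plücker
   coordinates: the k-minors of a basis of the subspace, for k = d * n. All
   the k-tuples s of columns are allowed as indices; the coordinates at
   permuted s, or s with repetitions, are redundant: they amount to linear
   equations, which are part of the ideal of SB(d, A). *)
Definition pluecker_index (k m : nat) := {ffun 'I_k -> 'I_m}.

Definition pluecker (F : fieldType) (A : falgType F) (L : fieldType)
    (phi : {rmorphism F -> L}) (k : nat) (b : k.-tuple (scext A phi))
    (x : 'I_#|{: pluecker_index k (\dim {:A})}|) : L :=
  \det (\matrix_(i < k, j < k)
          (tnth b i : 'rV[L]_(\dim {:A})) 0 (enum_val x j)).

(* homogeneous coordinate ring of the ambient projective space of SB(d, A),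
   with coefficients in R *)
Notation "'pcoord' [ R , A , n , d ]" :=
  {mpoly R[#|{: pluecker_index (d * n)%N (\dim {:A})}|]}
  (at level 0, R at level 99, A at level 99, n at level 99, d at level 99).

(* f vanishes on the line of the affine cone lying over J *)
Definition vanishes_at (F : fieldType) (A : falgType F) (n d : nat)
    (L : fieldType) (phi : {rmorphism F -> L}) (f : pcoord[L, A, n, d])
    (J : {vspace scext A phi}) : Prop :=
  forall b : (d * n)%N.-tuple (scext A phi), basis_of J b ->
    f.@[pluecker b] = 0.

(* A closed (reduced) subvariety of SB(d, A) over F, given by its homogeneous
   radical ideal, which contains the ideal of SB(d, A). *)
Record closed_subvariety (F : fieldType) (A : falgType F) (n d : nat) := {
  csv_ideal :> pcoord[F, A, n, d] -> Prop;
  csv_ideal0 : csv_ideal 0;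
  csv_idealD : forall f g, csv_ideal f -> csv_ideal g -> csv_ideal (f + g);
  csv_idealM : forall f g, csv_ideal g -> csv_ideal (f * g);
  csv_homog : forall f e, csv_ideal f -> csv_ideal (pihomog mdeg e f);
  csv_radical : forall f e, csv_ideal (f ^+ e.+1) -> csv_ideal f;
  csv_sub_SB : forall f,
    (forall (L : fieldType) (phi : {rmorphism F -> L})
            (J : {vspace scext A phi}),
       SB n d J -> vanishes_at (map_mpoly phi f) J) ->
    csv_ideal f
}.

Definition points (F : fieldType) (A : falgType F) (n d : nat)
    (P : closed_subvariety A n d) (L : fieldType) (phi : {rmorphism F -> L})
    (J : {vspace scext A phi}) : Prop :=
  SB n d J /\ forall f, P f -> vanishes_at (map_mpoly phi f) J.

(* the ideal of P_K: the ideal generated by that of P over K *)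
Definition ext_ideal (F : fieldType) (A : falgType F) (n d : nat)
    (P : closed_subvariety A n d) (K : fieldType) (phi : {rmorphism F -> K})
    (g : pcoord[K, A, n, d]) : Prop :=
  exists (r : nat) (h : 'I_r -> pcoord[K, A, n, d])
         (f : 'I_r -> pcoord[F, A, n, d]),
    (forall i, P (f i)) /\ g = \sum_i h i * map_mpoly phi (f i).

(* lambda_j for j >= 1; it is 0 for j > size lam *)
Definition part (lam : seq nat) (j : nat) : nat := nth 0%N lam j.-1.

Definition schubert_idx (n d : nat) (lam : seq nat) (j : nat) : nat :=
  (n - d + j - part lam j)%N.

Definition essential_set (n d : nat) (lam : seq nat) : seq (nat * nat) :=
  [seq (j, schubert_idx n d lam j)
     | j <- iota 1 d & (part lam j.+1 < part lam j)%N].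

Definition essential_proj (n d : nat) (lam : seq nat) : seq nat :=
  [seq p.2 | p <- essential_set n d lam].

(* C 1, ..., C n is a full chain of right ideals of B, of degree n; the other
   values of C are irrelevant. *)
Definition full_chain (F : fieldType) (B : falgType F) (n : nat)
    (C : nat -> {vspace B}) : Prop :=
  [/\ forall j, (1 <= j <= n)%N -> right_ideal (C j) /\ rrank n (C j) = j,
      forall j, (1 <= j < n)%N -> (C j <= C j.+1)%VS
    & C n = fullv].

(* the L-points of X_lambda, a subvariety of SB(d, A_K), for L an extension
   of K *)
Definition schubert (F : fieldType) (A : falgType F) (n d : nat)
    (lam : seq nat) (K : fieldType) (phi : {rmorphism F -> K})
    (C : nat -> {vspace scext A phi}) (L : fieldType)
    (tau : {rmorphism K -> L}) (J : {vspace scext A (tau \o phi)}) : Prop :=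
  SB n d J /\
  forall j, (1 <= j <= d)%N ->
    (j <= rrank n (J :&: extend_vs2 tau (C (schubert_idx n d lam j))))%N.

(* Points over all extensions L of K are needed, K being possibly finite. *)
Definition schubert_ideal (F : fieldType) (A : falgType F) (n d : nat)
    (lam : seq nat) (K : fieldType) (phi : {rmorphism F -> K})
    (C : nat -> {vspace scext A phi}) (g : pcoord[K, A, n, d]) : Prop :=
  forall (L : fieldType) (tau : {rmorphism K -> L})
         (J : {vspace scext A (tau \o phi)}),
    schubert n d lam C J -> vanishes_at (map_mpoly tau g) J.

(* P_K = X_lambda for some full chain. This is an equality of subschemes, hence
   stated on ideals: for an inseparable K/F it is stronger than an equality
   of geometric points. *)
Definition extends_to_schubert (F : fieldType) (A : falgType F) (n d : nat)
    (lam : seq nat) (K : fieldType) (phi : {rmorphism F -> K})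
    (P : closed_subvariety A n d) : Prop :=
  exists C : nat -> {vspace scext A phi},
    full_chain n C /\
    forall g, ext_ideal P phi g <-> schubert_ideal lam C g.

(* Main.v *)
From HB Require Import structures.
Require Import Defs.
From Stdlib Require Import Classical ClassicalEpsilon.
From mathcomp Require Import all_boot all_order all_algebra all_field.
From mathcomp Require Import all_fingroup.
From mathcomp Require Import mpoly.
From mathcomp Require Import zify.

(* The essential conditions alone define X_lambda, so the theorem is about the
   descent to F of the ideals C_a, a essential, of the chain that defines X_lambda;
   K/F being arbitrary, Galois descent is not available.

   If ind(A) divides every essential a, then A has a flag of right ideals I_a of
   reduced rank a, and P is defined by the ideal of all polynomials over F that
   vanish at the subspaces meeting the flag as required, over all extensions of F.
   That this ideal generates the one of X_lambda over K is clear if A is split over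
   F, because a generic point of the variety is then parametrized by an affine
   space. In general A is split by a tower of simple separable extensions, by the
   Jacobson-Noether theorem, and the ideal descends along each of them because a
   polynomial is determined by its conjugates.

   Conversely, the x in A_K whose left multiplication, seen as a derivation of the
   Plücker algebra, preserves the ideal of P_K = X_lambda form a subspace that is
   defined over F. It consists of the x with x C_a <= C_a for all essential a: if
   C_a is moved by x, then 1 + t x moves some J of X_lambda, to first order, out of
   the zero locus of a determinant that expresses the condition on J and C_a. Each
   C_a is then recovered, by linear equations over F, from this subspace and the
   smaller members of the flag. Finally n ind(A) divides the dimension n a of an
   F-rational C_a. The same determinants cut out the L-points of P. *)

Set Implicit Arguments.
Unset Strict Implicit.
Unset Printing Implicit Defensive.

Import GRing.Theory.

Local Open Scope ring_scope.

(** * Linear algebra along a field extension *)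

(** Descent is linear algebra throughout: an element is written on scalars that are independent over
    [F], and coordinates are compared. This works along any extension but yields only linear
    subspaces. That is why the stabilizer of [X_lambda] is taken at the level of Lie algebras: the
    condition on [x] is linear in [x] with coefficients in [F], whereas a group may have too few
    points over a finite field. Separability is needed for the tower that splits [A], never for [K]:
    [K] and the tower are compared inside a common overfield, from which statements about spans come
    back to [K] for free. Over a split algebra with an idempotent [e] of reduced rank 1, [J |-> J e]
    turns right ideals of reduced rank [j] into subspaces of dimension [j], and the conditions on
    [J] into conditions on an adapted basis; this makes the parametrization by an affine space
    linear. Since fields may be finite, vanishing is tested over all extensions, and generic points
    live in fraction fields of polynomial rings. *)

Section IndepOver.
Variables (F K : fieldType) (phi : {rmorphism F -> K}).

(** [K] is only a field receiving [F] along [phi], so independence over [F] is spelled out on lists.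
    Only the values of [a] below [size cs] matter. *)
Definition indep_over (cs : seq K) := forall a : nat -> F,
  \sum_(i < size cs) cs`_i * phi (a i) = 0 -> forall i, (i < size cs)%N -> a i = 0.

Definition in_Fspan (cs : seq K) (x : K) :=
  exists a : nat -> F, x = \sum_(i < size cs) cs`_i * phi (a i).

Lemma in_Fspan_cat cs es x : in_Fspan cs x -> in_Fspan (cs ++ es) x.
Proof.
case=> a ->; exists (fun i => if (i < size cs)%N then a i else 0).
rewrite size_cat big_split_ord /= [X in _ + X]big1 ?addr0 => [|i _].
  by apply: eq_bigr => i _; rewrite nth_cat ltn_ord.
by rewrite ltnNge leq_addr rmorph0 mulr0.
Qed.

Lemma indep_over_extend (cs ds : seq K) : indep_over cs ->
  exists es, indep_over (cs ++ es) /\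
             forall x, x \in ds -> in_Fspan (cs ++ es) x.
Proof.
elim: ds cs => [|d ds IH] cs ics; first by exists [::]; rewrite cats0; split.
have [dcs|ndcs] := classic (in_Fspan cs d).
  have [es [ies des]] := IH cs ics; exists es; split=> // x.
  by rewrite inE => /predU1P[->|/des//]; apply: in_Fspan_cat.
have ids : indep_over (cs ++ [:: d]).
  move=> a; rewrite size_cat addn1 big_ord_recr /=.
  rewrite nth_cat ltnn subnn /=.
  under eq_bigr => i _ do rewrite nth_cat ltn_ord.
  move=> s0; have ad0 : a (size cs) = 0.
    apply/eqP/negPn/negP => adN0; apply: ndcs.
    exists (fun i => - (a i / a (size cs))).
    have pN0 : phi (a (size cs)) != 0 by rewrite fmorph_eq0.
    apply: (mulIf pN0); move/eqP: s0; rewrite addrC addr_eq0 => /eqP->.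
    rewrite mulr_suml -sumrN; apply: eq_bigr => i _.
    by rewrite rmorphN fmorph_div mulrN mulNr -mulrA divfK.
  move: s0; rewrite ad0 rmorph0 mulr0 addr0 => /ics a0 i.
  by rewrite ltnS leq_eqVlt => /predU1P[->|/a0].
have [es [ies des]] := IH _ ids; exists (d :: es).
rewrite -cat1s catA; split=> // x; rewrite inE => /predU1P[->|/des//].
apply: in_Fspan_cat; exists (fun i => (i == size cs)%:R).
rewrite size_cat addn1 big_ord_recr /= nth_cat ltnn subnn /= eqxx rmorph1.
by rewrite mulr1 big1 ?add0r // => i _; rewrite ltn_eqF // rmorph0 mulr0.
Qed.

Lemma indep_over_nil : indep_over [::]. Proof. by []. Qed.

Lemma indep_over1 : indep_over [:: 1].
Proof.
move=> a; rewrite big_ord1 mul1r => /eqP; rewrite fmorph_eq0 => /eqP a0 [|i] //.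
Qed.

(** In an independent list [cs ++ es] that spans [ds], [a j i] is the coordinate of the [j]-th
    member of [ds] on the [i]-th of [cs]. That [a] is chosen before [v] and [s] matters: one family
    serves all the coefficients of a polynomial at once. *)
Lemma indep_coords cs ds : indep_over cs ->
  exists a : nat -> nat -> F, forall v s : nat -> F,
    \sum_(i < size cs) cs`_i * phi (v i) =
    \sum_(j < size ds) ds`_j * phi (s j) ->
  forall i, (i < size cs)%N -> v i = \sum_(j < size ds) s j * a j i.
Proof.
move=> /(indep_over_extend ds)[es [ies des]].
have [a ha] : exists a : 'I_(size ds) -> nat -> F, forall j : 'I_(size ds),
    ds`_j = \sum_(i < size (cs ++ es)) (cs ++ es)`_i * phi (a j i).
  apply: (fin_all_exists (U := fun=> nat -> F) (P := fun (j : 'I_(size ds)) a =>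
    ds`_j = \sum_(i < size (cs ++ es)) (cs ++ es)`_i * phi (a i))) => j.
  exact/des/mem_nth.
exists (fun j => if @insub _ _ 'I_(size ds) j is Some j' then a j' else fun=> 0) => v s e i ltic.
apply/eqP; rewrite -subr_eq0; apply/eqP.
pose b i := (if (i < size cs)%N then v i else 0) -
  \sum_(j < size ds) s j * a j i.
have : b i = 0.
  apply: (ies b); last by rewrite size_cat ltn_addr.
  under eq_bigr => k _ do rewrite rmorphB mulrBr.
  rewrite sumrB; apply/eqP; rewrite subr_eq0; apply/eqP.
  transitivity (\sum_(i < size cs) cs`_i * phi (v i)).
    rewrite size_cat big_split_ord /= [X in _ + X]big1 ?addr0 => [|k _].
      by apply: eq_bigr => k _; rewrite nth_cat ltn_ord.
    by rewrite ltnNge leq_addr rmorph0 mulr0.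
  rewrite e; under eq_bigr => j _ do rewrite ha mulr_suml.
  rewrite exchange_big /=; apply: eq_bigr => k _.
  rewrite rmorph_sum mulr_sumr; apply: eq_bigr => j _.
  by rewrite rmorphM mulrAC -mulrA.
rewrite /b ltic => b0; rewrite -[RHS]b0; congr (_ - _).
by apply: eq_bigr => j _; rewrite valK.
Qed.

Lemma Fspan_decomp (ds : seq K) : exists2 cs, indep_over cs &
  forall x, x \in ds -> in_Fspan cs x.
Proof. by have [es [? ?]] := indep_over_extend ds indep_over_nil; exists es. Qed.

Lemma mpoly_decomp N (g : {mpoly K[N]}) : exists2 cs, indep_over cs &
  exists gs : nat -> {mpoly F[N]},
    g = \sum_(i < size cs) cs`_i *: map_mpoly phi (gs i).
Proof.
have [cs ics hcs] := Fspan_decomp [seq g@_m | m <- msupp g].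
exists cs => //.
have [a ha] : exists a : 'I_(size (msupp g)) -> nat -> F, forall j,
    g@_(tnth (in_tuple (msupp g)) j) = \sum_(i < size cs) cs`_i * phi (a j i).
  apply: (fin_all_exists (U := fun=> nat -> F) (P := fun (j : 'I_(size (msupp g))) a =>
    g@_(tnth (in_tuple (msupp g)) j)
      = \sum_(i < size cs) cs`_i * phi (a i))) => j.
  by apply: hcs; apply: map_f; apply: mem_tnth.
exists (fun i => \sum_j a j i *: 'X_[tnth (in_tuple (msupp g)) j]).
rewrite {1}(mpolyE g) big_tnth.
under [RHS]eq_bigr => i _ do rewrite rmorph_sum scaler_sumr.
rewrite exchange_big /=; apply: eq_bigr => j _; rewrite ha scaler_suml.
by apply: eq_bigr => i _; rewrite map_mpolyZ map_mpolyX scalerA.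
Qed.

End IndepOver.

(** * Extension of scalars *)

Section SemilinearSpan.
Variables (K L : fieldType) (V : vectType K) (W : vectType L) (h : V -> W).

(** Both extensions of scalars, [extend_vs] and [extend_vs2], unfold to this, so the theory of
    semilinear maps along [sigma] is done once. *)
Definition semispan (U : {vspace V}) : {vspace W} := <<map h (vbasis U)>>%VS.

Variables (sigma : {rmorphism K -> L}) (e : seq V).
Hypothesis hD : forall u v, h (u + v) = h u + h v.
Hypothesis hZ : forall c u, h (c *: u) = sigma c *: h u.
Hypothesis e_basis : basis_of fullv e.
Hypothesis he_free : free (map h e).

Lemma semi0 : h 0 = 0.
Proof. by rewrite -(scale0r (0 : V)) hZ rmorph0 scale0r. Qed.

Lemma semi_sum (I : Type) (r : seq I) (P : pred I) (f : I -> V) :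
  h (\sum_(i <- r | P i) f i) = \sum_(i <- r | P i) h (f i).
Proof. exact: (big_morph h hD semi0). Qed.

Lemma semi_span s u : u \in <<s>>%VS -> h u \in <<map h s>>%VS.
Proof.
move=> us; rewrite (coord_span (X := in_tuple s) us) semi_sum.
apply: memv_suml => i _; rewrite hZ memvZ //.
by apply/memv_span/map_f/mem_nth.
Qed.

(** The coordinates of [s] in [e] form a matrix [C] with independent rows. The rank of a matrix is
    insensitive to field extension, so its image under [sigma], which gives the coordinates of
    [map h s] in the free family [map h e], has independent rows too. *)
Lemma semi_free s : free s -> free (map h s).
Proof.
move=> fs; have fE : free (in_tuple e) := basis_free e_basis.
have sE i : (in_tuple s)`_i = \sum_j coord (in_tuple e) j s`_i *: e`_j.
  exact: (coord_basis (X := in_tuple e) e_basis (memvf _)).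
pose C := \matrix_(i < size s, j < size e) coord (in_tuple e) j s`_i.
have fC : row_free C.
  rewrite -kermx_eq0; apply/eqP/row_matrixP => i; rewrite row0.
  set u := row i _; have uC : u *m C = 0.
    by apply/sub_kermxP; rewrite row_sub.
  clearbody u.
  have /freeP/(_ (u 0)) u0 : free (in_tuple s) := fs.
  apply/rowP => k; rewrite [RHS]mxE u0 //.
  under eq_bigr => j _ do rewrite sE scaler_sumr.
  rewrite exchange_big big1 //= => j _.
  under eq_bigr => l _ do rewrite scalerA.
  rewrite -scaler_suml; move/rowP/(_ j): uC; rewrite !mxE.
  under eq_bigr => l _ do rewrite mxE.
  by move=> ->; rewrite scale0r.
have hsE (i : 'I_(size s)) : (map_tuple h (in_tuple s))`_i = h s`_i.
  by rewrite (nth_map 0).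
change (free (map_tuple h (in_tuple s))).
apply/freeP => k k0 i.
have kC : (\row_i k i) *m map_mx sigma C = 0.
  apply/rowP => j; rewrite !mxE.
  have := he_free; rewrite -(in_tupleE (map h e)) => /freeP.
  have szE : size (map h e) = size e by rewrite size_map.
  pose f j := \sum_i k i * sigma (coord (in_tuple e) (cast_ord szE j) s`_i).
  move=> fh; transitivity (f (cast_ord (esym szE) j)).
    by rewrite /f cast_ordKV; apply: eq_bigr => l _; rewrite !mxE.
  apply: fh.
  rewrite -[RHS]k0; transitivity (\sum_(i < size e) (\sum_l k l *
      sigma (coord (in_tuple e) i s`_l)) *: h e`_i).
    rewrite (reindex (cast_ord szE)) /=; last first.
      by exists (cast_ord (esym szE)) => ? _; rewrite ?cast_ordK ?cast_ordKV.
    apply: eq_bigr => l _; rewrite (nth_map 0) //.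
    by rewrite -szE.
  under eq_bigr => l _ do rewrite scaler_suml.
  rewrite exchange_big; apply: eq_bigr => l _.
  rewrite hsE [in RHS](sE l) semi_sum scaler_sumr.
  by apply: eq_bigr => q _; rewrite hZ scalerA.
have: \row_i k i = 0.
  by apply/(row_free_inj (A := map_mx sigma C)); rewrite ?row_free_map ?mul0mx.
by move=> /rowP/(_ i); rewrite !mxE.
Qed.

Lemma semispan_span s : semispan <<s>> = <<map h s>>%VS.
Proof.
apply: subv_anti; apply/andP; split; apply/span_subvP => w /mapP[v vs ->].
  by apply: semi_span; apply: vbasis_mem.
by apply: semi_span; rewrite (span_basis (vbasisP _)) memv_span.
Qed.

Lemma mem_semispan u (U : {vspace V}) : u \in U -> h u \in semispan U.
Proof. by move=> uU; apply: semi_span; rewrite (span_basis (vbasisP U)). Qed.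

Lemma dim_semispan U : \dim (semispan U) = \dim U.
Proof.
have /eqP-> := semi_free (basis_free (vbasisP U)).
by rewrite size_map size_tuple.
Qed.

Lemma semispanS U1 U2 : (U1 <= U2)%VS -> (semispan U1 <= semispan U2)%VS.
Proof.
move=> /subvP s12; apply/span_subvP => w /mapP[v vU ->].
by apply/mem_semispan/s12/vbasis_mem.
Qed.

Lemma semispanD U1 U2 : semispan (U1 + U2) = (semispan U1 + semispan U2)%VS.
Proof.
rewrite -{1}(span_basis (vbasisP U1)) -{1}(span_basis (vbasisP U2)) -span_cat.
by rewrite semispan_span map_cat span_cat.
Qed.

(** One inclusion is monotonicity; as sums and dimensions are preserved, the formula for the
    dimension of a sum gives equality of dimensions. *)
Lemma semispan_cap U1 U2 :
  semispan (U1 :&: U2) = (semispan U1 :&: semispan U2)%VS.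
Proof.
apply/eqP; rewrite eqEdim subv_cap !semispanS ?capvSl ?capvSr //=.
rewrite -(leq_add2l (\dim (semispan U1 + semispan U2))) dimv_sum_cap.
by rewrite -semispanD !dim_semispan dimv_sum_cap.
Qed.

Lemma mem_semispanE u (U : {vspace V}) : (h u \in semispan U) = (u \in U).
Proof.
apply/idP/idP => [huU|]; last exact: mem_semispan.
have: (U + <[u]> <= U)%VS; last by rewrite subv_add -memvE => /andP[].
have : (semispan (U + <[u]>) <= semispan U)%VS.
  by rewrite semispanD subv_add subvv /= -span_seq1 semispan_span span_seq1 -memvE.
move=> /dimvS; rewrite !dim_semispan => dU.
have /eqP <- : U == (U + <[u]>)%VS by rewrite eqEdim addvSl.
exact: subvv.
Qed.

Lemma semispanSE U1 U2 : (semispan U1 <= semispan U2)%VS = (U1 <= U2)%VS.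
Proof.
apply/idP/idP => [s12|]; last exact: semispanS.
apply/subvP => u uU; rewrite -mem_semispanE.
by apply: (subvP s12); apply: mem_semispan.
Qed.

Lemma semispan_inj U1 U2 : semispan U1 = semispan U2 -> U1 = U2.
Proof.
by move=> e12; apply: subv_anti; rewrite -!semispanSE e12 subvv.
Qed.

Lemma semispan_full : \dim {:V} = \dim {:W} -> semispan fullv = fullv.
Proof.
by move=> dVW; apply/eqP; rewrite eqEdim subvf dim_semispan dVW leqnn.
Qed.

End SemilinearSpan.

Lemma prodv_span (K : fieldType) (B : falgType K) (U V : {vspace B}) :
  (U * V)%VS = <<allpairs *%R (vbasis U) (vbasis V)>>%VS.
Proof. by rewrite unlock. Qed.

Lemma semispan_prod (K L : fieldType) (B : falgType K) (C : falgType L)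
    (h : B -> C) (sigma : {rmorphism K -> L})
    (hD : forall u v, h (u + v) = h u + h v)
    (hZ : forall c u, h (c *: u) = sigma c *: h u)
    (hM : forall u v, h (u * v) = h u * h v) (U V : {vspace B}) :
  semispan h (U * V) = (semispan h U * semispan h V)%VS.
Proof.
rewrite [(U * V)%VS]prodv_span (semispan_span hD hZ).
apply: subv_anti; apply/andP; split.
  apply/span_subvP => w /mapP[v /allpairsP[[a b] /= [aU bV ->]] ->].
  by rewrite hM memv_mul // (mem_semispan hD hZ) // vbasis_mem.
rewrite /semispan; set X := <<_>>%VS.
apply/prodvP => u v uU vV.
rewrite (coord_span (X := in_tuple _) uU) (coord_span (X := in_tuple _) vV).
rewrite mulr_suml; apply: memv_suml => i _; rewrite mulr_sumr.
apply: memv_suml => j _; rewrite -scalerAl -scalerAr !memvZ //.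
have /mapP[a aU ->] : (in_tuple (map h (vbasis U)))`_i \in map h (vbasis U).
  exact: mem_nth.
have /mapP[b bV ->] : (in_tuple (map h (vbasis V)))`_j \in map h (vbasis V).
  exact: mem_nth.
by rewrite -hM; apply/memv_span/map_f/allpairs_f.
Qed.

Section ScalarExtensionMaps.
Variables (F : fieldType) (A : falgType F).
Local Notation m := (\dim {:A}).

Lemma dim_scext (L : fieldType) (phi : {rmorphism F -> L}) :
  \dim {:scext A phi} = m.
Proof. by rewrite dimvf; apply: etrans (dim_matrix _ 1 m) (mul1n _). Qed.

Lemma scemb_basis (L : fieldType) (phi : {rmorphism F -> L}) :
  basis_of fullv [seq scemb phi a | a <- vbasis {:A}].
Proof.
rewrite basisEdim size_map size_tuple dim_scext leqnn andbT.
apply/subvP => u _; rewrite (scextE u); apply: memv_suml => i _.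
by apply/memvZ/memv_span/map_f/mem_tnth.
Qed.

Lemma scembD (L : fieldType) (phi : {rmorphism F -> L}) (a b : A) :
  scemb phi (a + b) = scemb phi a + scemb phi b.
Proof. by apply/rowP => i; rewrite !mxE linearD rmorphD. Qed.

Lemma scembZ (L : fieldType) (phi : {rmorphism F -> L}) c (a : A) :
  scemb phi (c *: a) = phi c *: scemb phi a.
Proof. by apply/rowP => i; rewrite !mxE linearZ rmorphM. Qed.

Lemma scemb_free (L : fieldType) (phi : {rmorphism F -> L}) :
  free (map (scemb phi) (vbasis {:A})).
Proof. exact: basis_free (scemb_basis phi). Qed.

Section ExtendVs.
Variables (L : fieldType) (phi : {rmorphism F -> L}).
Local Notation ext := (extend_vs phi : {vspace A} -> _).

Let hD := scembD phi.
Let hZ := scembZ phi.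
Let hB := vbasisP {:A}.
Let hF := scemb_free phi.

Lemma dim_extend_vs U : \dim (ext U) = \dim U.
Proof. exact: dim_semispan hD hZ hB hF U. Qed.

Lemma extend_vsS U V : (U <= V)%VS -> (ext U <= ext V)%VS.
Proof. exact: semispanS hD hZ U V. Qed.

Lemma extend_vsSE U V : (ext U <= ext V)%VS = (U <= V)%VS.
Proof. exact: semispanSE hD hZ hB hF U V. Qed.

Lemma mem_extend_vsE u U : (scemb phi u \in ext U) = (u \in U).
Proof. exact: mem_semispanE hD hZ hB hF u U. Qed.

Lemma extend_vs_prod U V : ext (U * V)%VS = (ext U * ext V)%VS.
Proof. exact: (semispan_prod (scembD phi) (scembZ phi) (scembM phi)). Qed.

Lemma extend_vs_full : ext fullv = fullv.
Proof.
by apply: (semispan_full hD hZ hB hF); rewrite dim_scext.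
Qed.

Lemma extend_vs_right_ideal U : right_ideal U -> right_ideal (ext U).
Proof.
by rewrite /right_ideal => rU; rewrite -extend_vs_full -extend_vs_prod extend_vsS.
Qed.

End ExtendVs.

Variables (K L : fieldType) (phi : {rmorphism F -> K}) (psi : {rmorphism F -> L}).
Variable tau : {rmorphism K -> L}.

(** [psi] is kept apart from [tau \o phi], to which it is equal only pointwise ([psiE]): the type
    [scext A psi] depends on [psi], and one field will receive [F] along morphisms that agree
    without being convertible. *)
Definition scmap (u : scext A phi) : scext A psi := map_mx tau (u : 'rV_m).

Lemma scmapD u v : scmap (u + v) = scmap u + scmap v.
Proof. exact: map_mxD. Qed.

Lemma scmapZ c u : scmap (c *: u) = tau c *: scmap u.
Proof. exact: map_mxZ. Qed.

Lemma scmap_inj : injective scmap.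
Proof. exact: map_mx_inj. Qed.

Hypothesis psiE : forall x, psi x = tau (phi x).

Lemma scmap_scemb a : scmap (scemb phi a) = scemb psi a.
Proof. by apply/rowP => i; rewrite !mxE psiE. Qed.

Lemma scmap_basis_free : free (map scmap [seq scemb phi a | a <- vbasis {:A}]).
Proof.
rewrite -map_comp (eq_map (g := scemb psi)) => [|a]; last exact: scmap_scemb.
exact: basis_free (scemb_basis psi).
Qed.

Lemma scmap_sum (I : Type) (r : seq I) (P : pred I) f :
  scmap (\sum_(i <- r | P i) f i) = \sum_(i <- r | P i) scmap (f i).
Proof. exact: (semi_sum scmapD scmapZ). Qed.

Lemma scmapM u v : scmap (u * v) = scmap u * scmap v.
Proof.
change (scmap (scmul u v) = scmul (scmap u) (scmap v)).
rewrite /scmul scmap_sum; apply: eq_bigr => i _.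
rewrite scmap_sum; apply: eq_bigr => j _.
by rewrite scmapZ scmap_scemb !mxE rmorphM.
Qed.

Lemma scmap1 : scmap 1 = 1.
Proof. exact: scmap_scemb. Qed.

Definition scspan (U : {vspace scext A phi}) : {vspace scext A psi} :=
  semispan scmap U.

Let hD := scmapD.
Let hZ := scmapZ.
Let hB := scemb_basis phi.
Let hF := scmap_basis_free.

Lemma scspan_span s : scspan <<s>> = <<map scmap s>>%VS.
Proof. exact: semispan_span hD hZ s. Qed.

Lemma mem_scspan u (U : {vspace scext A phi}) : u \in U -> scmap u \in scspan U.
Proof. exact: mem_semispan hD hZ u U. Qed.

Lemma scspanS U V : (U <= V)%VS -> (scspan U <= scspan V)%VS.
Proof. exact: semispanS hD hZ U V. Qed.

Lemma dim_scspan U : \dim (scspan U) = \dim U.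
Proof. exact: dim_semispan hD hZ hB hF U. Qed.

Lemma scspan_cap U V : scspan (U :&: V) = (scspan U :&: scspan V)%VS.
Proof. exact: semispan_cap hD hZ hB hF U V. Qed.

Lemma mem_scspanE u U : (scmap u \in scspan U) = (u \in U).
Proof. exact: mem_semispanE hD hZ hB hF u U. Qed.

Lemma scspanSE U V : (scspan U <= scspan V)%VS = (U <= V)%VS.
Proof. exact: semispanSE hD hZ hB hF U V. Qed.

Lemma scspan_inj U V : scspan U = scspan V -> U = V.
Proof. exact: semispan_inj hD hZ hB hF U V. Qed.

Lemma scmap_free s : free s -> free (map scmap s).
Proof. exact: semi_free hD hZ hB hF s. Qed.

Lemma scspan_full : scspan fullv = fullv.
Proof.
by apply: (semispan_full hD hZ hB hF); rewrite !dim_scext.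
Qed.

Lemma scspan_prod U V : scspan (U * V) = (scspan U * scspan V)%VS.
Proof. exact: (semispan_prod scmapD scmapZ scmapM). Qed.

Lemma scspan_line u : scspan <[u]> = <[scmap u]>%VS.
Proof. by rewrite -!span_seq1 scspan_span. Qed.

Lemma scspan_right_ideal U : right_ideal U -> right_ideal (scspan U).
Proof.
by rewrite /right_ideal => rU; rewrite -scspan_full -scspan_prod; apply: scspanS.
Qed.

Lemma scspan_extend_vs (I : {vspace A}) :
  scspan (extend_vs phi I) = extend_vs psi I.
Proof.
rewrite scspan_span /extend_vs -map_comp; congr <<_>>%VS.
by apply: eq_map => a; apply: scmap_scemb.
Qed.

End ScalarExtensionMaps.

(** * Plücker coordinates *)

Section Pluecker.

Lemma map_mpoly_sum (R S : comNzRingType) (f : {rmorphism R -> S}) N (I : Type)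
    (r : seq I) (P : pred I) (g : I -> {mpoly R[N]}) :
  map_mpoly f (\sum_(i <- r | P i) g i) = \sum_(i <- r | P i) map_mpoly f (g i).
Proof. exact: (raddf_sum (map_mpoly f)). Qed.

Lemma meval_sum (R : comNzRingType) N (v : 'I_N -> R) (I : Type)
    (r : seq I) (P : pred I) (g : I -> {mpoly R[N]}) :
  (\sum_(i <- r | P i) g i).@[v] = \sum_(i <- r | P i) (g i).@[v].
Proof. exact: (raddf_sum (meval v)). Qed.

Lemma comp_mpoly_sum (R : comNzRingType) N M (q : N.-tuple {mpoly R[M]}) (I : Type)
    (r : seq I) (P : pred I) (g : I -> {mpoly R[N]}) :
  (\sum_(i <- r | P i) g i) \mPo q = \sum_(i <- r | P i) (g i \mPo q).
Proof. exact: (raddf_sum (comp_mpoly q)). Qed.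

Lemma map_meval (R S : comNzRingType) (f : {rmorphism R -> S}) N
    (p : {mpoly R[N]}) (v : 'I_N -> R) :
  (map_mpoly f p).@[fun i => f (v i)] = f p.@[v].
Proof.
rewrite {1}(mpolyE p) (mevalE v) [RHS]rmorph_sum map_mpoly_sum meval_sum.
apply: eq_bigr => m _.
rewrite map_mpolyZ map_mpolyX mevalZ mevalX rmorphM rmorph_prod; congr (_ * _).
by apply: eq_bigr => i _; rewrite rmorphXn.
Qed.

Lemma map_comp_meval (R S : comNzRingType) (f : {rmorphism R -> S}) N M
    (p : {mpoly R[N]}) (q : N.-tuple {mpoly R[M]}) (v : 'I_M -> S) :
  (map_mpoly f (p \mPo q)).@[v] =
  (map_mpoly f p).@[fun i => (map_mpoly f (tnth q i)).@[v]].
Proof.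
rewrite {1 2}(mpolyE p) comp_mpoly_sum !map_mpoly_sum !meval_sum; apply: eq_bigr => m _.
rewrite comp_mpolyZ !map_mpolyZ !mevalZ map_mpolyX mevalX comp_mpolyX.
rewrite !rmorph_prod /=; congr (_ * _).
by apply: eq_bigr => i _; rewrite !rmorphXn.
Qed.

Lemma map_mpoly_mpoly (R S U : comNzRingType) (f : {rmorphism R -> S})
    (g : {rmorphism S -> U}) N (p : {mpoly R[N]}) :
  map_mpoly g (map_mpoly f p) = map_mpoly (g \o f) p.
Proof. by apply/mpolyP => mn; rewrite !mcoeff_map_mpoly. Qed.

(** The fraction field of the polynomial ring, at the point given by the variables. It replaces a
    choice of enough points, which a finite field does not offer. *)
Lemma generic_point (R : fieldType) N :
  exists (S : fieldType) (f : {rmorphism R -> S}) (v : 'I_N -> S),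
    forall p : {mpoly R[N]}, (map_mpoly f p).@[v] = 0 -> p = 0.
Proof.
pose frac : {rmorphism {mpoly R[N]} -> {fraction {mpoly R[N]}}} := @tofrac _.
pose f : {rmorphism R -> {fraction {mpoly R[N]}}} := frac \o @mpolyC N R.
exists {fraction {mpoly R[N]}}, f, (fun j => frac 'X_j) => p.
suff -> : (map_mpoly f p).@[fun j => frac 'X_j] = frac p.
  by move=> /eqP; rewrite tofrac_eq0 => /eqP.
rewrite {1}(mpolyE p) map_mpoly_sum meval_sum [in RHS](mpolyE p) rmorph_sum.
apply: eq_bigr => mn _; rewrite map_mpolyZ map_mpolyX mevalZ mevalX.
rewrite -mul_mpolyC rmorphM; congr (_ * _).
rewrite mpolyXE_id rmorph_prod; apply: eq_bigr => j _.
by rewrite rmorphXn.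
Qed.

(** Expansion by multilinearity in the columns of the product. The sum runs over all functions [s],
    as the Plücker indices do, which is why [C] contributes a plain product and not a minor. *)
Lemma det_mulmx_ffun (R : comNzRingType) k m (B : 'M[R]_(k, m)) (C : 'M_(m, k)) :
  \det (B *m C) = \sum_(s : {ffun 'I_k -> 'I_m})
    (\prod_j C (s j) j) * \det (\matrix_(i, j) B i (s j)).
Proof.
rewrite /determinant.
under eq_bigr => s _ do
  (under eq_bigr => i _ do rewrite mxE; rewrite bigA_distr_bigA /= mulr_sumr).
rewrite exchange_big /=.
under [RHS]eq_bigr => s _ do rewrite mulr_sumr.
rewrite [RHS]exchange_big /= [LHS]exchange_big /=; apply: eq_bigr => s _.
pose h (f : {ffun 'I_k -> 'I_m}) := [ffun i : 'I_k => f (s i)].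
rewrite (reindex h) /=; last first.
  exists (fun f : {ffun 'I_k -> 'I_m} => [ffun i : 'I_k => f ((s^-1)%g i)]) => f _;
    apply/ffunP => i;
    by rewrite !ffunE ?permK ?permKV.
apply: eq_bigr => f _; rewrite mulrCA; congr (_ * _).
rewrite big_split /= mulrC; congr (_ * _).
  rewrite [RHS](reindex_inj (perm_inj (s := s))) /=.
  by apply: eq_bigr => i _; rewrite ffunE.
by apply: eq_bigr => i _; rewrite !mxE ffunE.
Qed.

Variables (k m : nat).
Local Notation N := #|{: pluecker_index k m}|.

Definition plmx (R : comNzRingType) (B : 'M[R]_(k, m)) (x : 'I_N) : R :=
  \det (\matrix_(i < k, j < k) B i (enum_val x j)).

Lemma plmx_mul (R : comNzRingType) (G : 'M[R]_k) (B : 'M_(k, m)) x :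
  plmx (G *m B) x = \det G * plmx B x.
Proof.
rewrite /plmx -det_mulmx; congr (\det _); apply/matrixP => i j.
by rewrite !mxE; apply: eq_bigr => l _; rewrite !mxE.
Qed.

Lemma plmx_map (R S : comNzRingType) (f : {rmorphism R -> S}) (B : 'M_(k, m)) x :
  plmx (map_mx f B) x = f (plmx B x).
Proof.
rewrite /plmx -det_map_mx; congr (\det _); apply/matrixP => i j.
by rewrite !mxE.
Qed.

Definition linform (R : comNzRingType) (l : 'I_N -> R) : {mpoly R[N]} :=
  \sum_x l x *: 'X_x.

Lemma meval_linform (R : comNzRingType) (l v : 'I_N -> R) :
  (linform l).@[v] = \sum_x l x * v x.
Proof. by rewrite meval_sum; apply: eq_bigr => x _ /=; rewrite mevalZ mevalXU. Qed.

(** Coefficients of the linear form in the Plücker coordinates with value [\det (B *m C)] at [B]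
    ([detformE]). Every explicit equation of a Schubert variety below has this form. *)
Definition detform (R : comNzRingType) (C : 'M[R]_(m, k)) (x : 'I_N) : R :=
  \prod_j C (enum_val x j) j.

Lemma detformE (R : comNzRingType) (C : 'M[R]_(m, k)) (B : 'M_(k, m)) :
  \sum_x detform C x * plmx B x = \det (B *m C).
Proof.
rewrite det_mulmx_ffun (reindex (enum_rank : pluecker_index k m -> 'I_N)) /=.
  by apply: eq_bigr => s _; rewrite /detform /plmx enum_rankK.
by apply: onW_bij; apply: enum_rank_bij.
Qed.

Lemma plmx_row_free (R : fieldType) (B : 'M[R]_(k, m)) :
  row_free B <-> exists x, plmx B x != 0.
Proof.
split=> [/row_freeP[C BC] | [x]].
  apply: NNPP => np; have := oner_neq0 R; rewrite -(det1 R k) -BC -detformE.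
  rewrite big1 ?eqxx // => x _.
  have [->|px] := eqVneq (plmx B x) 0; first by rewrite mulr0.
  by case: np; exists x.
rewrite -unitfE -[\det _ \is a _]unitmxE => uB.
apply/row_freeP.
pose S : 'M[R]_(m, k) := \matrix_(i, j) (i == enum_val x j)%:R.
exists (S *m invmx (B *m S)); rewrite mulmxA mulmxV //.
congr (_ \in unitmx): uB; apply/matrixP => i j; rewrite !mxE.
rewrite (bigD1 (enum_val x j)) //= mxE eqxx mulr1 big1 ?addr0 // => l lj.
by rewrite mxE (negPf lj) mulr0.
Qed.

End Pluecker.

Section PlueckerScext.
Variables (F : fieldType) (A : falgType F).
Local Notation m := (\dim {:A}).

Section OneField.
Variables (L : fieldType) (phi : {rmorphism F -> L}).

Definition rowsmx k (b : k.-tuple (scext A phi)) : 'M[L]_(k, m) :=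
  \matrix_(i, j) (tnth b i : 'rV_m) 0 j.

Lemma pluecker_rowsmx k (b : k.-tuple (scext A phi)) : pluecker b =1 plmx (rowsmx b).
Proof. by move=> x; congr (\det _); apply/matrixP => i j; rewrite !mxE. Qed.

Lemma rowsmx_lin k (b : k.-tuple (scext A phi)) k' (c : k'.-tuple (scext A phi))
    (G : 'M_(k, k')) :
  (forall i, tnth b i = \sum_j G i j *: tnth c j) -> rowsmx b = G *m rowsmx c.
Proof.
move=> bE; apply/matrixP => i j; rewrite !mxE bE summxE.
by apply: eq_bigr => l _; rewrite !mxE.
Qed.

Lemma free_rowsmx k (b : k.-tuple (scext A phi)) : free b = row_free (rowsmx b).
Proof.
apply/freeP/idP => [fb|fb a sa i].
  rewrite -kermx_eq0; apply/eqP/row_matrixP => i; rewrite row0.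
  have /sub_kermxP : (row i (kermx (rowsmx b)) <= kermx (rowsmx b))%MS.
    exact: row_sub.
  move: (row i _) => u uB; apply/rowP => j; rewrite [RHS]mxE.
  apply: (fb (u 0)); apply/rowP => l; rewrite summxE [RHS]mxE.
  move/rowP/(_ l): uB; rewrite !mxE => uB. rewrite -[RHS]uB; apply: eq_bigr => q _.
  by rewrite !mxE (tnth_nth 0).
have: \row_i a i = 0.
  apply/(row_free_inj fb); rewrite mul0mx; apply/rowP => l; rewrite !mxE.
  move/rowP/(_ l): sa; rewrite summxE !mxE => sa; rewrite -[RHS]sa; apply: eq_bigr => q _.
  by rewrite !mxE (tnth_nth 0).
by move=> /rowP/(_ i); rewrite !mxE.
Qed.

Lemma pluecker_free k (b : k.-tuple (scext A phi)) :
  free b <-> exists x, pluecker b x != 0.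
Proof.
rewrite free_rowsmx plmx_row_free.
by split=> -[x px]; exists x; rewrite ?pluecker_rowsmx // -pluecker_rowsmx.
Qed.

Lemma basis_pluecker k (U : {vspace scext A phi}) (b c : k.-tuple (scext A phi)) :
  basis_of U b -> basis_of U c ->
  exists2 g : L, g != 0 & forall x, pluecker c x = g * pluecker b x.
Proof.
move=> bU cU; pose G := \matrix_(i, j) coord b j (tnth c i).
have e : rowsmx c = G *m rowsmx b.
  apply: rowsmx_lin => i; rewrite {1}(coord_basis bU (v := tnth c i)).
    by apply: eq_bigr => j _; rewrite mxE (tnth_nth 0 b).
  by rewrite -(span_basis cU) memv_span ?mem_tnth.
have pE x : pluecker c x = \det G * pluecker b x.
  by rewrite !pluecker_rowsmx e plmx_mul.
exists (\det G) => //; apply/eqP => g0.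
have [x] : exists x, pluecker c x != 0 by apply/pluecker_free/(basis_free cU).
by rewrite pE g0 mul0r eqxx.
Qed.

(** Polynomials are not assumed homogeneous, so a zero at [J] means a zero on the whole punctured
    line of Plücker vectors. Every scalar [c] is reached by rescaling one vector of the basis, which
    has to be nonempty. *)
Lemma vanishes_atP n d (f : pcoord[L, A, n, d]) (J : {vspace scext A phi})
    (b : (d * n).-tuple (scext A phi)) : (0 < d * n)%N -> basis_of J b ->
  vanishes_at f J <->
  forall c, c != 0 -> f.@[fun x => c * pluecker b x] = 0.
Proof.
move=> k_gt0 bJ; split=> [vf c cN0|vf b' b'J]; last first.
  have [g gN0 gE] := basis_pluecker bJ b'J.
  by rewrite (meval_eq _ gE); apply: vf.
pose r (i : 'I_(d * n)) := if val i == 0%N then c else 1.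
pose b' := [tuple r i *: tnth b i | i < (d * n)%N].
have rN0 i : r i != 0 by rewrite /r; case: ifP; rewrite ?oner_neq0.
have sb' : (J <= <<b'>>)%VS.
  rewrite -(span_basis bJ); apply/span_subvP => u /tnthP[i ->].
  rewrite -[tnth b i]scale1r -(mulVf (rN0 i)) -scalerA memvZ // memv_span //.
  by apply/tnthP; exists i; rewrite tnth_mktuple.
have b'J : basis_of J b'.
  by rewrite basisEdim sb' size_tuple (vector.size_basis bJ) leqnn.
rewrite -(vf b' b'J); apply: meval_eq => x; rewrite !pluecker_rowsmx.
rewrite (rowsmx_lin (b := b') (c := b) (G := diag_mx (\row_i r i))) => [|i]; last first.
  rewrite tnth_mktuple (bigD1 i) //= !mxE eqxx mulr1n big1 ?addr0 // => j ji.
  by rewrite !mxE eq_sym (negPf ji) mulr0n scale0r.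
rewrite plmx_mul det_diag; congr (_ * _).
rewrite (bigD1 (Ordinal k_gt0)) //= mxE /r /= big1 ?mulr1 // => i.
by rewrite mxE -val_eqE /= => /negPf->.
Qed.

End OneField.

Variables (K L : fieldType) (phi : {rmorphism F -> K}) (psi : {rmorphism F -> L}).
Variable tau : {rmorphism K -> L}.
Hypothesis psiE : forall x, psi x = tau (phi x).

Lemma scmap_basis k (U : {vspace scext A phi}) (b : k.-tuple (scext A phi)) :
  basis_of U b -> basis_of (scspan psi tau U) (map_tuple (scmap psi tau) b).
Proof.
move=> bU; apply/andP; split.
  by rewrite -(span_basis bU) scspan_span.
exact/(scmap_free psiE)/(basis_free bU).
Qed.

Lemma pluecker_scmap k (b : k.-tuple (scext A phi)) x :
  pluecker (map_tuple (scmap psi tau) b) x = tau (pluecker b x).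
Proof.
rewrite !pluecker_rowsmx -plmx_map; congr (plmx _ x); apply/matrixP => i j.
by rewrite !mxE tnth_map !mxE.
Qed.

Lemma vanishes_at_descent n d (f : pcoord[K, A, n, d]) (J : {vspace scext A phi}) :
  vanishes_at (map_mpoly tau f) (scspan psi tau J) -> vanishes_at f J.
Proof.
move=> vf b bJ; apply: (fmorph_inj tau).
rewrite rmorph0 -(vf _ (scmap_basis bJ)) -map_meval.
by apply: meval_eq => x; rewrite pluecker_scmap.
Qed.

End PlueckerScext.

(** * Right ideals of simple algebras *)

Lemma exists_minimal (P : nat -> Prop) n : P n ->
  exists2 k, P k & forall l, P l -> (k <= l)%N.
Proof.
elim/ltn_ind: n => n IH Pn.
have [[l ltln Pl]|nex] := classic (exists2 l, (l < n)%N & P l); first exact: IH Pl.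
exists n => // l Pl; rewrite leqNgt; apply/negP => ltln; apply: nex.
by exists l.
Qed.

(** The [b k] embed [s] copies of [U'] as direct summands of [U], with the [a k] as projections. The
    dimension formulas below that come from matrix units are instances. *)
Lemma dim_pieces (E : fieldType) (V V' : vectType E) (s : nat)
    (a : 'I_s -> 'Hom(V, V')) (b : 'I_s -> 'Hom(V', V))
    (U : {vspace V}) (U' : {vspace V'}) :
    (forall k u, u \in U -> a k u \in U') ->
    (forall k w, w \in U' -> b k w \in U) ->
    (forall u, u \in U -> u = \sum_k b k (a k u)) ->
    (forall k l w, w \in U' -> a k (b l w) = if k == l then w else 0) ->
  \dim U = (s * \dim U')%N.
Proof.
move=> aU bU abU baU.
have UE : U = (\sum_k (b k @: U'))%VS.
  apply: subv_anti; apply/andP; split; last first.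
    apply/subv_sumP => k _; apply/subvP => w /memv_imgP[u uU' ->].
    exact: bU.
  apply/subvP => u uU; rewrite (abU u uU); apply: memv_sumr => k _.
  by apply/memv_img/aU.
have dUE : directv (\sum_k (b k @: U')).
  apply/directv_sum_independent => us usU us0 k _.
  have [w wU' usE] : exists2 w : 'I_s -> V', (forall k, w k \in U') &
      forall k, us k = b k (w k).
    have [w wE] : exists w : 'I_s -> V', forall k, w k \in U' /\ us k = b k (w k).
      apply: (fin_all_exists (U := fun=> V')
        (P := fun k w => w \in U' /\ us k = b k w)) => l.
      by have /memv_imgP[w wU' ->] := usU l isT; exists w.
    by exists w => l; case: (wE l).
  have := congr1 (a k) us0; rewrite linear0 linear_sum (bigD1 k) //=.
  rewrite usE baU // eqxx big1 ?addr0 => [->|l lk]; first by rewrite linear0.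
  by rewrite usE baU // eq_sym (negPf lk).
rewrite {1}UE (directvP dUE) /=.
rewrite (eq_bigr (fun=> \dim U')) ?sum_nat_const ?card_ord // => k _.
apply: limg_dim_eq; apply/eqP; rewrite -subv0; apply/subvP => w.
rewrite memv_cap memv_ker memv0 => /andP[wU' /eqP bw0].
by have := baU k k w wU'; rewrite bw0 linear0 eqxx => <-.
Qed.

Section RightIdeals.
Variables (E : fieldType) (B : falgType E).
Implicit Types (U W : {vspace B}) (e z b c : B).

Lemma right_idealP U :
  right_ideal U <-> forall u b, u \in U -> u * b \in U.
Proof.
split=> [/prodvP rU u b uU|rU]; first by rewrite rU ?memvf.
by apply/prodvP => u b uU _; apply: rU.
Qed.

Lemma memv_linel z U w :
  reflect (exists2 b, b \in U & w = z * b) (w \in <[z]> * U)%VS.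
Proof.
have -> : (<[z]> * U = amull z @: U)%VS.
  apply: subv_anti; apply/andP; split.
    apply/prodvP => _ b /vlineP[c ->] bU; rewrite -scalerAl memvZ //.
    by rewrite -[z * b](lfunE (z \*o idfun)) memv_img.
  apply/subvP => _ /memv_imgP[b bU ->]; rewrite lfunE /=.
  by rewrite memv_mul ?memv_line.
apply: (iffP memv_imgP) => -[b bU ->]; exists b => //; by rewrite lfunE.
Qed.

Lemma memv_liner z U w :
  reflect (exists2 b, b \in U & w = b * z) (w \in U * <[z]>)%VS.
Proof.
rewrite -limg_amulr.
apply: (iffP memv_imgP) => -[b bU ->]; exists b => //; by rewrite lfunE.
Qed.

Lemma right_ideal_mulf W : right_ideal (W * fullv)%VS.
Proof. by rewrite /right_ideal -prodvA prodvS ?subvf ?subvv. Qed.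

Lemma right_idealD U W : right_ideal U -> right_ideal W -> right_ideal (U + W)%VS.
Proof.
by rewrite /right_ideal prodvDl => rU rW; apply: addvS.
Qed.

Lemma right_ideal_cap U W :
  right_ideal U -> right_ideal W -> right_ideal (U :&: W)%VS.
Proof.
move=> /right_idealP rU /right_idealP rW; apply/right_idealP => u b.
by rewrite !memv_cap => /andP[uU uW]; rewrite rU ?rW.
Qed.

Lemma right_ideal0 : right_ideal (0 : {vspace B}).
Proof. by rewrite /right_ideal prod0v subvv. Qed.

Lemma right_idealf : right_ideal (fullv : {vspace B}).
Proof. exact: subvf. Qed.

Lemma right_ideal_mull W U : right_ideal U -> right_ideal (W * U)%VS.
Proof. by rewrite /right_ideal -prodvA => rU; apply: prodvSr. Qed.

Lemma amulrE z b : amulr z b = b * z. Proof. by rewrite lfunE. Qed.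
Lemma amullE z b : amull z b = z * b. Proof. by rewrite lfunE. Qed.

(* [x k * y l] are matrix units, and [B] is the algebra of matrices of size [s]
   over [e B e]. *)
Record wdata (s : nat) (e : B) (x y : 'I_s -> B) : Prop := WData {
  wd_idem : e * e = e;
  wd_neq0 : e != 0;
  wd_xe : forall k, x k * e = x k;
  wd_ey : forall k, e * y k = y k;
  wd_xy : \sum_k x k * y k = 1;
  wd_yx : forall k l, y k * x l = if k == l then e else 0
}.

Definition minimal_idem e := forall U, right_ideal U ->
  (U <= <[e]> * fullv)%VS -> U = 0%VS \/ U = (<[e]> * fullv)%VS.

Section Wdata.
Variables (s : nat) (e : B) (x y : 'I_s -> B).
Hypothesis wd : wdata e x y.

(** Since [u = \sum_k (u * x k) * y k], [U] is the sum of [s] copies of [U e]. In a split algebra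
    this makes the reduced rank of [U] the dimension of [U e]. *)
Lemma wd_dim_right U : right_ideal U -> \dim U = (s * \dim (U * <[e]>))%N.
Proof.
move=> rU; have /right_idealP rU' := rU.
have eU w : w \in (U * <[e]>)%VS -> w \in U /\ w * e = w.
  move=> /memv_liner[u uU ->]; rewrite rU' //.
  by rewrite -mulrA (wd_idem wd).
apply: (dim_pieces (a := fun k => amulr (x k)) (b := fun k => amulr (y k)))
  => [k u uU|k w /eU[wU _]|u uU|k l w /eU[wU we]]; rewrite ?amulrE ?rU' //.
- by apply/memv_liner; exists (u * x k); rewrite ?rU' // -mulrA (wd_xe wd).
- rewrite -{1}[u]mulr1 -(wd_xy wd) mulr_sumr; apply: eq_bigr => k _.
  by rewrite !amulrE mulrA.
rewrite ?amulrE -mulrA (wd_yx wd) eq_sym; by case: eqP; rewrite ?mulr0.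
Qed.

Lemma wd_dim_left : \dim {:B} = (s * \dim (<[e]> * {:B}))%N.
Proof.
have eU w : w \in (<[e]> * fullv)%VS -> e * w = w.
  by move=> /memv_linel[u uU ->]; rewrite mulrA (wd_idem wd).
apply: (dim_pieces (a := fun k => amull (y k)) (b := fun k => amull (x k)))
  => [k u uU|k w wU|u uU|k l w /eU ew]; rewrite ?amullE ?memvf //.
- by apply/memv_linel; exists (y k * u); rewrite ?memvf // mulrA (wd_ey wd).
- rewrite -{1}[u]mul1r -(wd_xy wd) mulr_suml; apply: eq_bigr => k _.
  by rewrite !amullE mulrA.
rewrite ?amullE mulrA (wd_yx wd); by case: eqP; rewrite ?mul0r.
Qed.

Lemma wd_dim_corner :
  \dim (<[e]> * {:B}) = (s * \dim (<[e]> * {:B} * <[e]>))%N.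
Proof. by apply: wd_dim_right; apply: right_ideal_mulf. Qed.

Lemma wd_gen : (fullv * <[e]> * fullv = fullv)%VS.
Proof.
apply/eqP; rewrite eqEsubv subvf /=; apply/subvP => b _.
rewrite -[b]mulr1 -(wd_xy wd) mulr_sumr; apply: memv_suml => k _.
rewrite -(wd_xe wd) !mulrA memv_mul ?memvf //.
by rewrite memv_mul ?memvf ?memv_line.
Qed.

End Wdata.

Section MinimalIdem.
Variable e : B.
Hypotheses (ee : e * e = e) (e_neq0 : e != 0) (e_min : minimal_idem e).
Hypothesis e_gen : (fullv * <[e]> * fullv = fullv :> {vspace B})%VS.

(** As [e] generates [B] as a two-sided ideal, [W e] is not in [U] either, and [z] is taken in [W e]
    outside [U]. The [c] in [e B] with [z c] in [U] form a right ideal without [e], which is 0 by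
    minimality of [e B]. *)
Lemma minimal_step U W : right_ideal U -> right_ideal W -> ~~ (W <= U)%VS ->
  exists z, [/\ z \in W, z * e = z &
    forall c, e * c = c -> z * c \in U -> c = 0].
Proof.
move=> rU rW nWU.
have nsWU : ~~ (W * <[e]> <= U)%VS.
  apply: contra nWU => sWU; rewrite -[W]prodv1.
  apply: (subv_trans (prodvSr _ (subvf _))).
  rewrite -e_gen !prodvA; apply: (subv_trans _ (rU : (U * fullv <= U)%VS)).
  apply: prodvSl; apply: subv_trans _ sWU; exact: prodvSl.
have /subvPn[z /memv_liner[w wW zE] nzU] := nsWU.
have ze : z * e = z by rewrite zE -mulrA ee.
have zW : z \in W by rewrite zE; move/right_idealP: rW; apply.
exists z; split=> // c ec zcU; apply/eqP/negPn/negP => cN0.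
have rI : right_ideal (<[e]> * fullv :&: (amull z @^-1: U))%VS.
  apply: right_ideal_cap; first exact: right_ideal_mulf.
  apply/right_idealP => u b; rewrite -!memv_preim !amullE mulrA.
  by move/right_idealP: rU; apply.
have [I0|IE] := e_min rI (capvSl _ _).
  case/negP: cN0; rewrite -memv0 -I0 memv_cap -memv_preim amullE zcU andbT.
  by apply/memv_linel; exists c; rewrite ?memvf.
case/negP: nzU; rewrite -ze -amullE memv_preim.
have : e \in (<[e]> * fullv)%VS.
  by apply/memv_linel; exists 1; rewrite ?memvf ?mulr1.
by rewrite -IE memv_cap => /andP[].
Qed.

Lemma minimal_step_dim U z : z * e = z ->
    (forall c, e * c = c -> z * c \in U -> c = 0) ->
  \dim (U + <[z]> * fullv) = (\dim U + \dim (<[e]> * {:B}))%N.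
Proof.
move=> ze zU.
have zBE : (<[z]> * fullv = amull z @: (<[e]> * fullv))%VS.
  apply: subv_anti; apply/andP; split; apply/subvP => w.
    move=> /memv_linel[b _ ->]; have -> : z * b = amull z (e * b).
      by rewrite amullE mulrA ze.
    apply: memv_img; by apply/memv_mul; rewrite ?memv_line ?memvf.
  move=> /memv_imgP[b _ ->]; rewrite amullE.
  by rewrite memv_mul ?memv_line ?memvf.
have eB c : c \in (<[e]> * fullv)%VS -> e * c = c.
  by move=> /memv_linel[u uU ->]; rewrite mulrA ee.
rewrite zBE dimv_disjoint_sum; last first.
  apply/eqP; rewrite -subv0; apply/subvP => w; rewrite memv_cap memv0.
  move=> /andP[wU /memv_imgP[c /eB ec wE]]; move: wU; rewrite wE amullE.
  by move=> /(zU _ ec)->; rewrite mulr0.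
congr (_ + _)%N; apply: limg_dim_eq; apply/eqP; rewrite -subv0; apply/subvP => c.
rewrite memv_cap memv_ker memv0 amullE => /andP[/eB ec /eqP zc0].
by apply/eqP/(zU _ ec); rewrite zc0 mem0v.
Qed.

Lemma right_ideal_between U W : right_ideal U -> right_ideal W ->
    (U <= W)%VS -> U != W ->
  exists U', [/\ right_ideal U', (U <= U' <= W)%VS &
    \dim U' = (\dim U + \dim (<[e]> * {:B}))%N].
Proof.
move=> rU rW sUW nUW.
have nWU : ~~ (W <= U)%VS by apply: contra nUW => sWU; rewrite eqEsubv sUW.
have [z [zW ze zU]] := minimal_step rU rW nWU.
exists (U + <[z]> * fullv)%VS; split; last exact: minimal_step_dim.
  by apply: right_idealD => //; apply: right_ideal_mulf.
rewrite addvSl subv_add sUW /=; apply: (subv_trans _ (rW : (W * fullv <= W)%VS)).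
by apply: prodvSl; rewrite -memvE.
Qed.

(** A right ideal [W] of largest dimension among those that meet [U] trivially is a complement:
    otherwise [minimal_step] gives a copy [z B] of [e B] independent of [U + W], which could be
    added to [W]. *)
Lemma right_ideal_compl U : right_ideal U ->
  exists2 W, right_ideal W & (U + W = fullv)%VS /\ (U :&: W = 0)%VS.
Proof.
move=> rU.
pose P k := exists W,
  [/\ right_ideal W, (U :&: W = 0)%VS & k = (\dim {:B} - \dim W)%N].
have P0 : P (\dim {:B} - \dim (0%VS : {vspace B}))%N.
  exists 0%VS; split=> //.
    exact: right_ideal0.
  by rewrite capv0.
have [l [W [rW UW lE]] lmin] := exists_minimal P0.
exists W => //; split=> //; apply/eqP; rewrite eqEsubv subvf /=; apply/negPn/negP => nf.
have [z [_ ze zU]] := minimal_step (right_idealD rU rW) right_idealf nf.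
have rW' : right_ideal (W + <[z]> * fullv)%VS.
  by apply: right_idealD => //; apply: right_ideal_mulf.
have dW' : \dim (W + <[z]> * fullv) = (\dim W + \dim (<[e]> * {:B}))%N.
  apply: minimal_step_dim => // c ec zcW; apply: zU => //.
  by apply: subvP zcW; apply: addvSr.
have deB : (0 < \dim (<[e]> * {:B}))%N.
  rewrite lt0n dimv_eq0; apply: contra e_neq0 => /eqP eB0; rewrite -memv0 -eB0.
  by apply/memv_linel; exists 1; rewrite ?memvf ?mulr1.
have W'U : (U :&: (W + <[z]> * fullv) = 0)%VS.
  apply/eqP; rewrite -subv0; apply/subvP => w; rewrite memv_cap.
  move=> /andP[wU /memv_addP[w1 w1W [_ /memv_linel[b _ ->] wE]]].
  have eb0 : e * b = 0.
    apply: zU; rewrite ?mulrA ?ee // ze.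
    have -> : z * b = w - w1 by rewrite wE addrC addrA addNr add0r.
    by apply: memvB; [apply: subvP wU; apply: addvSl
                     |apply: subvP w1W; apply: addvSr].
  have wE1 : w = w1 by rewrite wE -ze -mulrA eb0 mulr0 addr0.
  by rewrite -UW memv_cap wU wE1.
have := lmin (\dim {:B} - \dim (W + <[z]> * fullv))%N
  (ex_intro _ _ (And3 rW' W'U (erefl _))).
have : (\dim (W + <[z]> * fullv) <= \dim {:B})%N by apply/dimvS/subvf.
rewrite lE dW' => le1; rewrite leqNgt ltn_sub2l //.
  by apply: leq_trans le1; rewrite -{1}[\dim W]addn0 ltn_add2l.
by rewrite -{1}[\dim W]addn0 ltn_add2l.
Qed.

End MinimalIdem.

End RightIdeals.

Section SimpleAlgebra.
Variables (E : fieldType) (B : falgType E).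
Implicit Types (U W : {vspace B}) (e z b c : B).

Lemma simple_gen e : simple_algebra B -> e != 0 ->
  (fullv * <[e]> * fullv = fullv :> {vspace B})%VS.
Proof.
move=> simpB eN0; have [||I0|//] := simpB (fullv * <[e]> * fullv)%VS.
- by rewrite !prodvA; apply/prodvSl/prodvSl/subvf.
- by rewrite -!prodvA; apply/prodvSr/prodvSr/subvf.
have : 1 * e * 1 \in (fullv * <[e]> * fullv)%VS.
  by rewrite !memv_mul ?memvf ?memv_line.
by rewrite I0 memv0 mul1r mulr1 (negPf eN0).
Qed.

(* Brauer's lemma: a right ideal of minimal dimension is generated by an
   idempotent. *)
Lemma simple_minimal_idem : simple_algebra B ->
  exists e, [/\ e * e = e, e != 0, minimal_idem e &
    forall U, right_ideal U -> U != 0%VS ->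
      (\dim (<[e]> * {:B}) <= \dim U)%N].
Proof.
move=> simpB.
pose P k := exists U, [/\ right_ideal U, U != 0%VS & k = \dim U].
have P1 : P (\dim {:B}).
  exists fullv; split=> //; first exact: right_idealf.
  by rewrite -dimv_eq0 -lt0n dimvf FalgType_proper.
have [k [I [rI IN0 ->]] Imin] := exists_minimal P1.
have {}Imin U : right_ideal U -> U != 0%VS -> (\dim I <= \dim U)%N.
  by move=> rU UN0; apply: Imin; exists U.
have eqI U : right_ideal U -> U != 0%VS -> (U <= I)%VS -> U = I.
  by move=> rU UN0 sUI; apply/eqP; rewrite eqEdim sUI Imin.
have fI : (fullv * I = fullv)%VS.
  have [||I0|//] := simpB (fullv * I)%VS.
  - by rewrite prodvA; apply/prodvSl/subvf.
  - exact: right_ideal_mull.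
  case/negP: IN0; rewrite -subv0 -I0 -{1}[I]prod1v.
  exact/prodvSl/subvf.
(* Otherwise [I * I = 0], whereas [I <= I B = I (B I) <= I I]. *)
have [a aI [c cI acN0]] : exists2 a, a \in I & exists2 c, c \in I & a * c != 0.
  apply: NNPP => np; case/negP: IN0.
  have II0 : (I * I <= 0)%VS.
    apply/prodvP => a c aI cI; rewrite memv0; apply/negPn/negP => acN0.
    by apply: np; exists a => //; exists c.
  rewrite -subv0 -{1}[I]prodv1; apply: subv_trans (prodvSr _ (subvf _)) _.
  rewrite -fI prodvA; apply: subv_trans II0; apply: prodvSl; exact: rI.
have rI' := proj1 (right_idealP I) rI.
(* By minimality left multiplication by [a] maps [I] onto itself, hence bijectively; the [e] in [I]
   with [a = a e] satisfies [a (e e - e) = 0], so it is idempotent. *)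
have aIE : (amull a @: I = I)%VS.
  apply: eqI.
  - apply/right_idealP => _ b /memv_imgP[u uI ->].
    by rewrite amullE -mulrA -amullE memv_img // rI'.
  - rewrite -subv0; apply/subvPn; exists (a * c); last by rewrite memv0.
    by rewrite -amullE memv_img.
  by apply/subvP => _ /memv_imgP[u uI ->]; rewrite amullE rI'.
have [e eI ae] : exists2 e, e \in I & a = a * e.
  by move: aI; rewrite -{1}aIE => /memv_imgP[e eI]; rewrite amullE; exists e.
have kerI u : u \in I -> a * u = 0 -> u = 0.
  move=> uI au0; have := limg_ker_dim (amull a) I; rewrite aIE.
  rewrite -[RHS]add0n => /addIn /eqP; rewrite dimv_eq0 => /eqP K0.
  by apply/eqP; rewrite -memv0 -K0 memv_cap uI memv_ker amullE au0 eqxx.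
have eN0 : e != 0.
  by apply: contraNneq acN0 => e0; rewrite ae e0 mulr0 mul0r.
have ee : e * e = e.
  apply/eqP; rewrite -subr_eq0; apply/eqP/kerI; first by rewrite memvB ?rI'.
  by rewrite mulrBr mulrA -ae -ae subrr.
have eBI : (<[e]> * fullv = I)%VS.
  apply: eqI; first exact: right_ideal_mulf.
    rewrite -subv0; apply/subvPn; exists e; last by rewrite memv0.
    by rewrite -{1}[e]mulr1 memv_mul ?memv_line ?memvf.
  by apply/subvP => _ /memv_linel[b _ ->]; apply: rI'.
exists e; rewrite eBI; split=> // U rU; rewrite eBI => sUI.
by have [->|UN0] := eqVneq U 0%VS; [left|right; apply: eqI].
Qed.

(** A family [zs] with [z e = z], independent in the sense of [indep], is enlarged by [minimal_step]
    until the [z B] fill [B]. Writing 1 as a sum of [z_i b_i] gives [x := z] and [y := e b];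
    independence forces the values of [y k * x l]. *)
Lemma minimal_idem_wdata e : e * e = e -> e != 0 -> minimal_idem e ->
    (fullv * <[e]> * fullv = fullv :> {vspace B})%VS ->
  exists s (x y : 'I_s -> B), wdata e x y.
Proof.
move=> ee eN0 emin egen.
pose U (zs : seq B) := (\sum_(i < size zs) <[zs`_i]> * {:B})%VS.
pose indep (zs : seq B) := forall c : nat -> B, (forall i, e * c i = c i) ->
  \sum_(i < size zs) zs`_i * c i = 0 -> forall i, (i < size zs)%N -> c i = 0.
have rU zs : right_ideal (U zs).
  rewrite /U /right_ideal; elim/big_ind: _ => [|V W rV rW|i _].
  - exact: right_ideal0.
  - exact: right_idealD.
  exact: right_ideal_mulf.
have ext n : exists zs, [/\ forall z, z \in zs -> z * e = z, indep zs &
    U zs = fullv \/ (n <= \dim (U zs))%N].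
  elim: n => [|n [zs [zse izs dU]]]; first by exists [::]; split=> //; right.
  have [UE|UN] := eqVneq (U zs) fullv; first by exists zs; split=> //; left.
  have nf : ~~ (fullv <= U zs)%VS.
    by apply: contra UN => fU; rewrite eqEsubv subvf.
  have [z [_ ze zU]] := minimal_step ee emin egen (rU zs) (right_idealf B) nf.
  case: dU => [UE|dU]; first by rewrite UE eqxx in UN.
  exists (z :: zs); split.
  - by move=> w; rewrite inE => /predU1P[->|/zse].
  - move=> c ec; rewrite /= big_ord_recl /= => sc.
    have c0 : c 0%N = 0.
      apply: zU => //; move/eqP: sc; rewrite addr_eq0 => /eqP->.
      rewrite memvN; apply: memv_sumr => i _.
      by rewrite memv_mul ?memv_line ?memvf.
    move: sc; rewrite c0 mulr0 add0r => sc [|i] // lti.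
    by apply: (izs (c \o S)) => //= j; apply: ec.
  right; rewrite /U /= big_ord_recl /= addvC.
  rewrite (minimal_step_dim ee ze zU); rewrite -addn1 leq_add // lt0n dimv_eq0.
  by apply: contra eN0 => /eqP eB0; rewrite -memv0 -eB0; apply/memv_linel;
    exists 1; rewrite ?memvf ?mulr1.
have [zs [zse izs dU]] := ext (\dim {:B}).+1.
have {dU} UE : U zs = fullv.
  case: dU => // dU; have := leq_trans dU (dimvS (subvf _)).
  by rewrite ltnn.
have : 1 \in U zs by rewrite UE memvf.
rewrite /U => /memv_sumP[us usU us1].
have [b bE] : exists b : 'I_(size zs) -> B, forall i, us i = zs`_i * b i.
  apply: (fin_all_exists (U := fun=> B) (P := fun i b => us i = zs`_i * b)) => i.
  by have /memv_linel[b _ ->] := usU i isT; exists b.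
have zse' (i : 'I_(size zs)) : zs`_i * e = zs`_i by apply/zse/mem_nth.
have xy1 : \sum_(k < size zs) zs`_k * (e * b k) = 1.
  by rewrite us1; apply: eq_bigr => k _; rewrite mulrA zse' -bE.
exists (size zs), (fun k => zs`_k), (fun k => e * b k); split=> // [k|k l].
  by rewrite mulrA ee.
(* These are the errors [y i * x l - (if i == l then e else 0)]. Multiplied on the left by the [z_i]
   they add up to [z_l - z_l], so independence kills them. *)
pose c i := if insub i is Some i' then
  e * b i' * zs`_l - (if i' == l then e else 0) else 0.
have cE (i : 'I_(size zs)) : c i = e * b i * zs`_l - (if i == l then e else 0).
  by rewrite /c valK.
apply/eqP; rewrite -subr_eq0 -cE; apply/eqP/izs => //.
  move=> i; rewrite /c; case: insub => [i'|]; last by rewrite mulr0.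
  by rewrite mulrBr !mulrA ee; case: ifP => _; rewrite ?ee ?mulr0.
under eq_bigr => i _ do rewrite cE mulrBr mulrA.
rewrite sumrB -mulr_suml xy1 mul1r (bigD1 l) //= eqxx zse' big1 ?addr0 ?subrr //.
by move=> i /negPf->; rewrite mulr0.
Qed.

Lemma simple_wdata : simple_algebra B ->
  exists e s (x y : 'I_s -> B), [/\ wdata e x y, minimal_idem e &
    forall U, right_ideal U -> U != 0%VS ->
      (\dim (<[e]> * {:B}) <= \dim U)%N].
Proof.
move=> simpB; have [e [ee eN0 emin edim]] := simple_minimal_idem simpB.
have [s [x [y wd]]] := minimal_idem_wdata ee eN0 emin (simple_gen simpB eN0).
by exists e, s, x, y.
Qed.

Section Corner.
Variables (s : nat) (e : B) (x y : 'I_s -> B).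
Hypotheses (wd : wdata e x y).

Let ee := wd_idem wd.

Lemma corner_memP b : b \in (<[e]> * fullv * <[e]>)%VS = (e * b * e == b).
Proof.
apply/idP/eqP => [/memv_liner[_ /memv_linel[c _ ->] ->]|<-].
  by rewrite !mulrA ee -!mulrA ee.
by rewrite !memv_mul ?memv_line ?memvf.
Qed.

Fact corner_is_aspace : is_aspace (<[e]> * fullv * <[e]>)%VS.
Proof.
apply/andP; split.
  apply/has_algidP; exists e; split; first by rewrite corner_memP !ee.
  - exact: wd_neq0 wd.
  - by move=> b; rewrite corner_memP => /eqP <-; rewrite !mulrA ee -!mulrA ee.
apply/prodvP => b c; rewrite !corner_memP => /eqP <- /eqP <-.
by rewrite !mulrA ee -!mulrA ee.
Qed.

Definition corner : {aspace B} := ASpace corner_is_aspace.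
End Corner.

End SimpleAlgebra.

(** * Adjoining a root *)

Lemma irreducible_factor (M : fieldType) (p : {poly M}) : (1 < size p)%N ->
  exists2 q, monic_irreducible_poly q & q %| p.
Proof.
move=> sp; pose P k := exists2 q : {poly M}, q %| p & size q = k.+2.
have P0 : P (size p).-2 by exists p => //; case: (size p) sp => [|[|k]].
have [k [q qp sq] kmin] := exists_minimal P0.
have qN0 : q != 0 by rewrite -size_poly_gt0 sq.
exists ((lead_coef q)^-1 *: q); last by rewrite dvdpZl ?invr_eq0 ?lead_coef_eq0.
split; last by apply/monicP; rewrite lead_coefZ mulVf ?lead_coef_eq0.
split; first by rewrite size_scale ?invr_eq0 ?lead_coef_eq0 // sq.
move=> r sr; rewrite dvdpZr ?invr_eq0 ?lead_coef_eq0 // => rq.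
have/eqp_trans : r %= q.
  rewrite -dvdp_size_eqp // eqn_leq dvdp_leq //= sq.
  have rN0 : r != 0 by apply: contraTneq rq => ->; rewrite dvd0p.
  have sr2 : size r = (size r).-2.+2.
    by move: sr rN0; rewrite -size_poly_eq0; case: (size r) => [|[|]].
  rewrite sr2 !ltnS; apply: kmin; exists r => //; exact: dvdp_trans qp.
by apply; rewrite eqp_sym eqp_scale // invr_eq0 lead_coef_eq0.
Qed.

Section QuotientField.
Variables (L : fieldType) (h : {poly L}) (hI : monic_irreducible_poly h).

Local Notation Lh := {poly %/ h with hI}.

Definition qf_const : {rmorphism L -> Lh} := qpolyC h.

Lemma qf_constE c : (qf_const c : {poly L}) = c%:P.
Proof. exact: qpolyCE. Qed.

Lemma horner_qf (p : {poly L}) : (map_poly qf_const p).[in_qpoly h 'X : Lh] = in_qpoly h p.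
Proof.
elim/poly_ind: p => [|p c IH]; first by rewrite rmorph0 horner0 in_qpoly0.
rewrite rmorphD rmorphM /= map_polyX map_polyC hornerMXaddC IH.
rewrite in_qpolyD in_qpolyM; congr (_ + _).
apply/val_inj; rewrite [LHS](qf_constE c) /=.
by rewrite Pdiv.Ring.rmodp_small // size_polyC; case: eqP => // _;
  apply: leq_ltn_trans (size_mk_monic_gt1 h).
Qed.

Lemma root_qf : root (map_poly qf_const h) (in_qpoly h 'X : Lh).
Proof.
rewrite /root horner_qf; apply/eqP/val_inj => /=.
rewrite mk_monicE // Pdiv.RingMonic.rmodpp //; exact: hI.2.
Qed.

Variables (M : fieldType) (t : {rmorphism L -> M}) (z : M).
Hypothesis hz : root (map_poly t h) z.

Definition qf_eval (x : Lh) : M := (map_poly t (x : {poly L})).[z].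

Fact qf_eval_zmod : zmod_morphism qf_eval.
Proof.
by move=> u v; rewrite /qf_eval -hornerN -hornerD -rmorphN -rmorphD.
Qed.

Fact qf_eval_monoid : monoid_morphism qf_eval.
Proof.
split.
  rewrite /qf_eval [X in map_poly t X](qf_constE 1) map_polyC hornerC.
  exact: (rmorph1 t).
move=> u v; rewrite /qf_eval poly_of_qpolyM -hornerM -rmorphM.
move: (_ * _) => p; rewrite mk_monicE // [in RHS](Pdiv.RingMonic.rdivp_eq hI.2 p).
by rewrite rmorphD rmorphM hornerD hornerM (rootP hz) mulr0 add0r.
Qed.

HB.instance Definition _ := GRing.isZmodMorphism.Build Lh M qf_eval qf_eval_zmod.
HB.instance Definition _ := GRing.isMonoidMorphism.Build Lh M qf_eval qf_eval_monoid.

Definition qf_rmorph : {rmorphism Lh -> M} := qf_eval.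

Lemma qf_rmorph_const c : qf_rmorph (qf_const c) = t c.
Proof. rewrite /= ; by rewrite /qf_eval qf_constE map_polyC hornerC. Qed.

End QuotientField.

Lemma adjoin_root (M : fieldType) (p : {poly M}) : (1 < size p)%N ->
  exists (M' : fieldType) (t : {rmorphism M -> M'}) (z : M'),
    root (map_poly t p) z.
Proof.
move=> /irreducible_factor[q qI qp].
exists {poly %/ q with qI}, (qf_const qI), (in_qpoly q 'X).
have := root_qf qI; rewrite -!dvdp_XsubCl => /dvdp_trans; apply.
by rewrite dvdp_map.
Qed.

Lemma splitting_ext (M : fieldType) (p : {poly M}) : p != 0 ->
  exists (M' : fieldType) (t : {rmorphism M -> M'}) (rs : seq M'),
    map_poly t p %= \prod_(z <- rs) ('X - z%:P).
Proof.
have [n] := ubnP (size p); elim: n => // n IH in M p * => sp pN0.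
have [sp1|sp1] := leqP (size p) 1.
  exists M, idfun, [::]; rewrite big_nil map_poly_id //.
  by rewrite -size_poly_eq1 eqn_leq sp1 size_poly_gt0.
have [M1 [t1 [z pz]]] := adjoin_root sp1.
have /dvdpP[q qE] : 'X - z%:P %| map_poly t1 p by rewrite dvdp_XsubCl.
have qN0 : q != 0.
  by apply: contra_neq pN0 => q0; apply/eqP; rewrite -(map_poly_eq0 t1) qE q0 mul0r.
have [|M2 [t2 [rs qrs]]] := IH M1 q _ qN0.
  move: sp; rewrite -(size_map_poly t1) qE size_Mmonic ?monicXsubC //.
  by rewrite size_XsubC addn2.
exists M2, (t2 \o t1), (t2 z :: rs).
rewrite big_cons map_poly_comp_id0 ?rmorph0 // qE rmorphM /= map_polyXsubC mulrC.
exact: eqp_mull.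
Qed.

(** * Vanishing ideals and their descent *)

Definition tofracR (R : idomainType) : {rmorphism R -> {fraction R}} := @tofrac R.

Section LinearSpan.
Variables (K L : fieldType) (tau : {rmorphism K -> L}) (N : nat).
Implicit Types (S : {mpoly K[N]} -> Prop).

(** This is [S ⊗_K L] for a subspace [S]. Constant coefficients suffice for ideals too, since
    monomials can be absorbed in the members of [S] ([ext_ideal_in_ext]). *)
Definition in_ext (S : {mpoly K[N]} -> Prop) (g : {mpoly L[N]}) :=
  exists (r : nat) (c : nat -> L) (f : nat -> {mpoly K[N]}),
    (forall i, S (f i)) /\ g = \sum_(i < r) c i *: map_mpoly tau (f i).

Lemma in_ext0 S : S 0 -> in_ext S 0.
Proof.
by move=> S0; exists 0%N, (fun=> 0), (fun=> 0); rewrite big_ord0; split.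
Qed.

Lemma in_extD S f g : in_ext S f -> in_ext S g -> in_ext S (f + g).
Proof.
move=> [r [c [p [Sp ->]]]] [s [e [q [Sq ->]]]].
exists (r + s)%N, (fun i => if (i < r)%N then c i else e (i - r)%N),
  (fun i => if (i < r)%N then p i else q (i - r)%N); split.
  by move=> i; case: ifP.
rewrite big_split_ord; apply: (congr2 +%R); apply: eq_bigr => i _ /=.
  by rewrite ltn_ord.
by rewrite ltnNge leq_addr addKn.
Qed.

Lemma in_extZ S a f : in_ext S f -> in_ext S (a *: f).
Proof.
move=> [r [c [p [Sp ->]]]]; exists r, (fun i => a * c i), p; split=> //.
by rewrite scaler_sumr; apply: eq_bigr => i _; rewrite scalerA.
Qed.

Lemma in_ext_sum S (I : Type) (r : seq I) (P : pred I) (f : I -> _) : S 0 ->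
  (forall i, P i -> in_ext S (f i)) -> in_ext S (\sum_(i <- r | P i) f i).
Proof.
move=> S0 Sf; elim/big_ind: _ => //; first exact: in_ext0.
by move=> u v; apply: in_extD.
Qed.

Lemma in_ext_map S f : S f -> in_ext S (map_mpoly tau f).
Proof.
by move=> Sf; exists 1%N, (fun=> 1), (fun=> f); rewrite big_ord1 scale1r; split.
Qed.

(** The core of descent along an arbitrary extension: coordinates on an independent list are
    compared, coefficient by coefficient. With [cs = [:: 1]] it says that [S] is recovered from its
    span over [L] ([in_ext_map_inv]). *)
Lemma in_ext_coords S (cs : seq L) (g : nat -> {mpoly K[N]}) :
    S 0 -> (forall f h, S f -> S h -> S (f + h)) ->
    (forall a f, S f -> S (a *: f)) -> indep_over tau cs ->
    in_ext S (\sum_(i < size cs) cs`_i *: map_mpoly tau (g i)) ->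
  forall i, (i < size cs)%N -> S (g i).
Proof.
move=> S0 SD SZ ics [r [c [f [Sf e]]]] i lti.
have [a ha] := indep_coords (mkseq c r) ics.
suff -> : g i = \sum_(j < r) a j i *: f j.
  by elim/big_ind: _ => // j _; apply: SZ.
apply/mpolyP => mn; rewrite (ha (fun i => (g i)@_mn) (fun j => (f j)@_mn)) //.
  rewrite size_mkseq raddf_sum /=; apply: eq_bigr => j _.
  by rewrite mcoeffZ mulrC.
rewrite size_mkseq; have := congr1 (mcoeff mn) e; rewrite !raddf_sum /= => e'.
transitivity (\sum_(i < size cs) (cs`_i *: map_mpoly tau (g i))@_mn).
  by apply: eq_bigr => j _; rewrite mcoeffZ mcoeff_map_mpoly.
rewrite e'; apply: eq_bigr => j _.
by rewrite mcoeffZ mcoeff_map_mpoly nth_mkseq.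
Qed.

Lemma in_ext_map_inv S f : S 0 -> (forall f h, S f -> S h -> S (f + h)) ->
  (forall a f, S f -> S (a *: f)) -> in_ext S (map_mpoly tau f) -> S f.
Proof.
move=> S0 SD SZ Sf.
have Sf1 : in_ext S (\sum_(i < size [:: 1 : L]) [:: 1 : L]`_i *: map_mpoly tau f).
  by rewrite big_ord1 scale1r.
have := in_ext_coords (g := fun=> f) S0 SD SZ (@indep_over1 _ _ tau) Sf1.
by move=> /(_ 0%N isT).
Qed.

End LinearSpan.

Lemma in_ext_trans (K L M : fieldType) (tau : {rmorphism K -> L})
    (ups : {rmorphism L -> M}) (rho : {rmorphism K -> M}) N
    (S : {mpoly K[N]} -> Prop) (T : {mpoly L[N]} -> Prop) g :
    (forall x, rho x = ups (tau x)) -> S 0 ->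
    (forall f, T f -> in_ext tau S f) -> in_ext ups T g -> in_ext rho S g.
Proof.
move=> rhoE S0 ST [r [c [f [Tf ->]]]]; apply: in_ext_sum => // i _.
apply: in_extZ; have [s [e [h [Sh ->]]]] := ST _ (Tf i).
rewrite map_mpoly_sum; apply: in_ext_sum => // j _.
rewrite map_mpolyZ; apply: in_extZ.
suff -> : map_mpoly ups (map_mpoly tau (h j)) = map_mpoly rho (h j).
  exact: in_ext_map.
by apply/mpolyP => mn; rewrite !mcoeff_map_mpoly /= rhoE.
Qed.

Section VanishingIdeal.
Variables (F : fieldType) (A : falgType F) (n d : nat).
Local Notation m := (\dim {:A}).
Hypothesis dn_gt0 : (0 < d * n)%N.

Variable X : forall (L : fieldType) (psi : {rmorphism F -> L}),
  {vspace scext A psi} -> Prop.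
Hypothesis X_ext : forall (L M : fieldType) (psi : {rmorphism F -> L})
  (rho : {rmorphism F -> M}) (tau : {rmorphism L -> M}),
  (forall x, rho x = tau (psi x)) ->
  forall J : {vspace scext A psi}, X J -> X (scspan rho tau J).
Hypothesis X_dim : forall (L : fieldType) (psi : {rmorphism F -> L})
  (J : {vspace scext A psi}), X J -> \dim J = (d * n)%N.

(** Points over all extensions [M] of [L] are tested, because [L] may be finite. *)
Definition vanish_ideal (L : fieldType) (psi : {rmorphism F -> L})
    (g : pcoord[L, A, n, d]) :=
  forall (M : fieldType) (tau : {rmorphism L -> M}) (rho : {rmorphism F -> M}),
    (forall x, rho x = tau (psi x)) ->
  forall J : {vspace scext A rho}, X J -> vanishes_at (map_mpoly tau g) J.

Section OneField.
Variables (L : fieldType) (psi : {rmorphism F -> L}).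
Local Notation VI := (@vanish_ideal L psi).

Lemma vanish_ideal0 : VI 0.
Proof. by move=> M tau rho _ J _ b _; rewrite !raddf0. Qed.

Lemma vanish_idealD f g : VI f -> VI g -> VI (f + g).
Proof.
move=> vf vg M tau rho e J XJ b bJ; rewrite !raddfD /=.
by rewrite (vf _ _ _ e J XJ b bJ) (vg _ _ _ e J XJ b bJ) addr0.
Qed.

Lemma vanish_idealM f g : VI g -> VI (f * g).
Proof.
move=> vg M tau rho e J XJ b bJ; rewrite rmorphM mevalM.
by rewrite (vg _ _ _ e J XJ b bJ) mulr0.
Qed.

Lemma vanish_idealZ a f : VI f -> VI (a *: f).
Proof. by rewrite -mul_mpolyC; apply: vanish_idealM. Qed.

Lemma vanish_ideal_radical f k : VI (f ^+ k.+1) -> VI f.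
Proof.
move=> vg M tau rho e J XJ b bJ; apply/eqP.
have /eqP := vg _ _ _ e J XJ b bJ.
by rewrite rmorphXn [meval _ _]rmorphXn expf_eq0.
Qed.

(** Over the rational functions in one variable, the Plücker vector of [J] may be multiplied by that
    variable. The value of [f] there is a polynomial, whose coefficient of degree [k] is the value
    at [b] of the component of [f] of degree [k]. *)
Lemma vanish_ideal_homog f k : VI f -> VI (pihomog mdeg k f).
Proof.
move=> vf M tau rho e J XJ b bJ.
pose M' := {fraction {poly M}}.
pose io : {rmorphism M -> M'} := @tofracR {poly M} \o polyC.
pose rho' : {rmorphism F -> M'} := io \o rho.
have rho'E x : rho' x = io (rho x) by [].
have e' x : rho' x = (io \o tau) (psi x) by rewrite rho'E e.
have := vf _ _ _ e' _ (X_ext rho'E XJ).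
move/(vanishes_atP _ dn_gt0 (scmap_basis rho'E bJ))/(_ (tofrac 'X)) => /(_ _)/wrap[].
  by rewrite tofrac_eq0 polyX_eq0.
set p := pluecker b.
have gE (g : pcoord[L, A, n, d]) :
   (map_mpoly (io \o tau) g).@[fun x => tofrac 'X *
      pluecker (map_tuple (scmap rho' io) b) x] =
   tofrac (\sum_(mn <- msupp g)
      (tau g@_mn * \prod_i p i ^+ mn i)%:P * 'X^(mdeg mn)) :> M'.
  rewrite {1}(mpolyE g) map_mpoly_sum meval_sum rmorph_sum; apply: eq_bigr => mn _.
  rewrite map_mpolyZ map_mpolyX mevalZ mevalX /= tofracM polyCM tofracM -mulrA.
  congr (_ * _); rewrite rmorph_prod tofracXn.
  under eq_bigr => i _ do rewrite pluecker_scmap exprMn.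
  rewrite big_split /= mulrC rmorph_prod; congr (_ * _).
    by apply: eq_bigr => i _; rewrite !rmorphXn.
  by rewrite mdegE -prodrXr.
rewrite gE => /eqP; rewrite tofrac_eq0 => /eqP /(congr1 (fun q : {poly M} => q`_k)).
rewrite coef0 coef_sum => s0; rewrite -[RHS]s0 pihomogE map_mpoly_sum meval_sum.
rewrite big_mkcond; apply: eq_bigr => mn _; rewrite coefCM coefXn eq_sym.
case: eqP => _; last by rewrite mulr0.
by rewrite mulr1 map_mpolyZ map_mpolyX mevalZ mevalX.
Qed.

End OneField.

Lemma vanish_ideal_map (L M : fieldType) (psi : {rmorphism F -> L})
    (rho : {rmorphism F -> M}) (tau : {rmorphism L -> M}) g :
    (forall x, rho x = tau (psi x)) ->
  vanish_ideal psi g -> vanish_ideal rho (map_mpoly tau g).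
Proof.
move=> rhoE vg M' tau' rho' rho'E J XJ.
rewrite map_mpoly_mpoly.
by apply: vg XJ => x; rewrite rho'E rhoE.
Qed.

Lemma vanish_ideal_in_ext (L M : fieldType) (psi : {rmorphism F -> L})
    (rho : {rmorphism F -> M}) (tau : {rmorphism L -> M}) g :
    (forall x, rho x = tau (psi x)) ->
  in_ext tau (vanish_ideal psi) g -> vanish_ideal rho g.
Proof.
move=> rhoE [r [c [f [vf ->]]]]; elim/big_ind: _ => [|u v|i _].
- exact: vanish_ideal0.
- exact: vanish_idealD.
exact/vanish_idealZ/(vanish_ideal_map rhoE).
Qed.

End VanishingIdeal.

Section DescentSteps.
Variables (F : fieldType) (A : falgType F) (n d : nat).
Local Notation m := (\dim {:A}).
Hypothesis dn_gt0 : (0 < d * n)%N.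

Variable X : forall (L : fieldType) (psi : {rmorphism F -> L}),
  {vspace scext A psi} -> Prop.
Hypothesis X_ext : forall (L M : fieldType) (psi : {rmorphism F -> L})
  (rho : {rmorphism F -> M}) (tau : {rmorphism L -> M}),
  (forall x, rho x = tau (psi x)) ->
  forall J : {vspace scext A psi}, X J -> X (scspan rho tau J).

Local Notation VI := (vanish_ideal (n := n) (d := d) X).

(* The coefficients of [g] on the powers of the root vanish wherever all the
   conjugates of [g] do, since the roots of [h] are distinct. *)
Lemma vanish_ideal_quotient (L : fieldType) (psi : {rmorphism F -> L})
    (h : {poly L}) (hI : monic_irreducible_poly h) : separable_poly h ->
  forall g, VI (qf_const hI \o psi) g -> in_ext (qf_const hI) (VI psi) g.
Proof.
move=> hsep g vg; pose Lh := {poly %/ h with hI} : fieldType.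
pose z : Lh := in_qpoly h 'X.
pose gs j : pcoord[L, A, n, d] :=
  \sum_(mn <- msupp g) (g@_mn : {poly L})`_j *: 'X_[mn].
pose sz := (size h).-1.
have szP (x : Lh) : (size (x : {poly L}) <= sz)%N.
  have := size_mk_monic x; move: (size (x : {poly L})) => k.
  by rewrite mk_monicE // /sz; case: (size h).
have xE (x : Lh) : x = \sum_(j < sz) z ^+ j * qf_const hI (x : {poly L})`_j.
  transitivity (map_poly (qf_const hI) (x : {poly L})).[z].
    rewrite [RHS]horner_qf; apply/val_inj; rewrite /= Pdiv.CommonRing.rmodp_small //.
    exact: size_mk_monic.
  rewrite (horner_coef_wide _ (n := sz)) ?size_map_poly //.
  by apply: eq_bigr => j _; rewrite coef_map mulrC.
have gE : g = \sum_(j < sz) z ^+ j *: map_mpoly (qf_const hI) (gs j).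
  under eq_bigr => j _ do rewrite map_mpoly_sum scaler_sumr.
  rewrite exchange_big {1}(mpolyE g); apply: eq_bigr => mn _.
  rewrite {1}(xE g@_mn) scaler_suml; apply: eq_bigr => j _.
  by rewrite map_mpolyZ map_mpolyX scalerA.
exists sz, (fun j => z ^+ j), (fun j => if (j < sz)%N then gs j else 0).
split; last by rewrite {1}gE; apply: eq_bigr => j _; rewrite ltn_ord.
move=> j; case: ifP => [ltj|_]; last exact: vanish_ideal0.
move=> M tau rho rhoE J XJ b bJ.
pose v j := (map_mpoly tau (gs j)).@[pluecker b]; change (v j = 0).
have hM0 : map_poly tau h != 0.
  by rewrite map_poly_eq0 monic_neq0 // hI.2.
have [M' [t [rs hrs]]] := splitting_ext hM0.
have rsU : uniq rs.
  rewrite -separable_prod_XsubC -(eqp_separable hrs) separable_map.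
  by rewrite separable_map.
have rsS : size rs = sz.
  have := eqp_size hrs; rewrite !size_map_poly size_prod_XsubC /sz => ->.
  by [].
(* At a root [y] of [h], its value is that of the conjugate of [g] under [z |-> y], which vanishes
   at [b]. With [sz] coefficients and [sz] distinct roots, it is 0. *)
pose q := \poly_(i < sz) v i.
have qrs : all (root (map_poly t q)) rs.
  apply/allP => y yrs.
  have hy : root (map_poly (t \o tau) h) y.
    rewrite map_poly_comp (eqp_root hrs) root_prod_XsubC //.
  pose sg : {rmorphism Lh -> M'} := qf_rmorph hI hy.
  have rE x : (t \o rho) x = t (rho x) by [].
  have sgE x : (t \o rho) x = sg ((qf_const hI \o psi) x).
    by rewrite [RHS]qf_rmorph_const /= rhoE.
  have := vg _ _ _ sgE _ (X_ext rE XJ) _ (scmap_basis rE bJ).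
  rewrite (meval_eq _ (pluecker_scmap _ _ _)) => {}vg.
  rewrite /root; apply/eqP; rewrite -[RHS]vg {1}(mpolyE g) map_mpoly_sum meval_sum.
  rewrite (horner_coef_wide _ (n := sz)); last by rewrite size_map_poly size_poly.
  transitivity (\sum_(i < sz) \sum_(mn <- msupp g)
     t (tau (g@_mn : {poly L})`_i) * (\prod_l t (pluecker b l) ^+ mn l) * y ^+ i).
    apply: eq_bigr => i _; rewrite coef_map coef_poly ltn_ord /v.
    rewrite map_mpoly_sum meval_sum /= rmorph_sum mulr_suml; apply: eq_bigr => mn _.
    rewrite map_mpolyZ map_mpolyX mevalZ mevalX rmorphM rmorph_prod.
    by under eq_bigr => l _ do rewrite rmorphXn.
  rewrite exchange_big /=; apply: eq_bigr => mn _.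
  rewrite map_mpolyZ map_mpolyX mevalZ mevalX /= /qf_eval.
  rewrite (horner_coef_wide _ (n := sz)) ?size_map_poly // mulr_suml.
  by apply: eq_bigr => i _; rewrite coef_map mulrAC.
have q0 : map_poly t q = 0.
  apply: roots_geq_poly_eq0 qrs _ _ => //.
  by rewrite size_map_poly rsS size_poly.
have /polyP/(_ j) : q = 0 by apply/eqP; rewrite -(map_poly_eq0 t) q0.
by rewrite coef_poly ltj coef0.
Qed.

(** A polynomial over [K] that is in the span over [M] of the ideal over [F] is already in its span
    over [K], by [in_ext_map_inv]. This allows [K] to be compared with a tower unrelated to it. *)
Lemma vanish_ideal_meet (K M : fieldType) (phi : {rmorphism F -> K})
    (rho : {rmorphism F -> M}) (k : {rmorphism K -> M}) :
    (forall x, rho x = k (phi x)) ->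
    (forall g, VI rho g -> in_ext rho (VI (idfun : {rmorphism F -> F})) g) ->
  forall g, VI phi g -> in_ext phi (VI (idfun : {rmorphism F -> F})) g.
Proof.
move=> rhoE dM g vg.
have S0 : VI (idfun : {rmorphism F -> F}) 0 by apply: vanish_ideal0.
apply: (in_ext_map_inv (tau := k) _ (@in_extD _ _ phi _ _) (@in_extZ _ _ phi _ _)).
  exact: in_ext0.
have [r [c [f [Sf ->]]]] := dM _ (vanish_ideal_map rhoE vg).
apply: in_ext_sum => [|i _]; first exact: in_ext0.
apply: in_extZ; have -> : map_mpoly rho (f i) = map_mpoly k (map_mpoly phi (f i)).
  by apply/mpolyP => mn; rewrite !mcoeff_map_mpoly /= rhoE.
by apply/in_ext_map/in_ext_map.
Qed.

Section Parametrization.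
Variables (E : fieldType) (psi : {rmorphism F -> E}) (N : nat).
Variable Q : 'I_(d * n) -> 'M[E]_(N, m).

Definition param_tuple (M : fieldType) (tau : {rmorphism E -> M})
    (rho : {rmorphism F -> M}) (T : 'rV[M]_N) : (d * n).-tuple (scext A rho) :=
  [tuple (T *m map_mx tau (Q i) : scext A rho) | i < (d * n)%N].

Hypothesis X_param : forall (M : fieldType) (tau : {rmorphism E -> M})
    (rho : {rmorphism F -> M}) T, (forall x, rho x = tau (psi x)) ->
  free (param_tuple tau rho T) -> X <<param_tuple tau rho T>>%VS.
Hypothesis X_param_surj : forall (M : fieldType) (tau : {rmorphism E -> M})
    (rho : {rmorphism F -> M}) (J : {vspace scext A rho}),
  (forall x, rho x = tau (psi x)) -> X J ->
  exists T, basis_of J (param_tuple tau rho T).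

(** The variable [ord0] is a common factor of all Plücker coordinates, since vanishing at a subspace
    is required on a whole line; the other variables are the parameters. *)
Let P := {mpoly E[N.+1]}.
Let Bgen : 'M[P]_(d * n, m) := \matrix_(r, c)
  \sum_i 'X_(lift ord0 i) * (Q r i c)%:MP.

Lemma meval_Bgen (M : fieldType) (tau : {rmorphism E -> M})
    (rho : {rmorphism F -> M}) (T : 'I_N.+1 -> M) x :
  (map_mpoly tau (plmx Bgen x)).@[T] =
  pluecker (param_tuple tau rho (\row_i T (lift ord0 i))) x.
Proof.
rewrite pluecker_rowsmx.
rewrite -[LHS]/((meval T \o map_mpoly tau) (plmx Bgen x)) -plmx_map.
congr (plmx _ x); apply/matrixP => i j; rewrite !mxE tnth_mktuple !mxE.
rewrite rmorph_sum; apply: eq_bigr => l _.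
by rewrite rmorphM /= map_mpolyX mevalXU map_mpolyC mevalC !mxE.
Qed.

Let q := [tuple 'X_ord0 * plmx Bgen x | x < #|{: pluecker_index (d * n) m}|].

(** With [g] written on scalars [cs] independent over [E], its vanishing at the generic member of
    the family is a relation between the [cs] with coefficients in [E]. So each [gs j] vanishes at
    the generic member, hence at all members. *)
Lemma vanish_ideal_param (M : fieldType) (tau : {rmorphism E -> M})
    (rho : {rmorphism F -> M}) : (forall x, rho x = tau (psi x)) ->
  forall g, VI rho g -> in_ext tau (VI psi) g.
Proof.
move=> rhoE g vg; have [cs ics [gs gE]] := mpoly_decomp tau g.
exists (size cs), (fun i => cs`_i), (fun i => if (i < size cs)%N then gs i else 0).
split; last by rewrite gE; apply: eq_bigr => i _; rewrite ltn_ord.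
move=> i; case: ifP => [lti|_]; last exact: vanish_ideal0.
move=> M1 t1 rho1 rho1E J XJ; have [T1 bT1] := X_param_surj rho1E XJ.
apply/(vanishes_atP _ dn_gt0 bT1) => c cN0.
pose T1' j := if unlift ord0 j is Some j' then T1 0 j' else c.
have T1E : \row_j T1' (lift ord0 j) = T1.
  by apply/rowP => j; rewrite mxE /T1' liftK.
have qE (M' : fieldType) (t : {rmorphism E -> M'}) (rho' : {rmorphism F -> M'}) T x :
    (map_mpoly t (tnth q x)).@[T] =
    T ord0 * pluecker (param_tuple t rho' (\row_i T (lift ord0 i))) x.
  rewrite tnth_mktuple rmorphM /= mevalM (meval_Bgen _ rho') map_mpolyX.
  by rewrite mevalXU.
suff gq0 : gs i \mPo q = 0.
  transitivity (map_mpoly t1 (gs i \mPo q)).@[T1'].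
    rewrite map_comp_meval; apply: meval_eq => x.
    by rewrite (qE _ _ rho1) T1E /T1' unlift_none.
  by rewrite gq0 !raddf0.
suff G0 : \sum_(j < size cs) cs`_j *: map_mpoly tau (gs j \mPo q) = 0.
  apply/mpolyP => mn; rewrite mcoeff0.
  apply: (ics (fun j => (gs j \mPo q)@_mn)) lti.
  have := congr1 (mcoeff mn) G0; rewrite mcoeff0 raddf_sum => e0; rewrite -[RHS]e0.
  by apply: eq_bigr => j _; rewrite /= mcoeffZ mcoeff_map_mpoly.
have [M2 [io [T2 io_eval]]] := generic_point M N.+1.
pose rho2 : {rmorphism F -> M2} := io \o rho.
have rho2E x : rho2 x = io (rho x) by [].
have rho2E' x : rho2 x = (io \o tau) (psi x) by rewrite rho2E rhoE.
have io_eval' (f : P) : (map_mpoly (io \o tau) f).@[T2] = 0 -> f = 0.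
  rewrite -map_mpoly_mpoly => /io_eval e0; apply/mpolyP => mn; rewrite mcoeff0.
  by have /eqP := congr1 (mcoeff mn) e0; rewrite mcoeff_map_mpoly mcoeff0 fmorph_eq0 => /eqP.
(* The generic tuple is free because the given point [T1] shows that some Plücker coordinate of
   [Bgen] is not the zero polynomial. *)
have [x px] : exists x, pluecker (param_tuple t1 rho1 T1) x != 0.
  exact/pluecker_free/(basis_free bT1).
have Bx : plmx Bgen x != 0.
  apply: contra_neq px => B0; rewrite -T1E -(meval_Bgen t1 rho1) B0.
  by rewrite !raddf0.
pose T3 := \row_j T2 (lift ord0 j).
have free3 : free (param_tuple (io \o tau) rho2 T3).
  apply/pluecker_free; exists x; rewrite -meval_Bgen.
  by apply: contra_neq Bx => /io_eval'.
have b3 : basis_of <<param_tuple (io \o tau) rho2 T3>> (param_tuple (io \o tau) rho2 T3).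
  by rewrite /basis_of eqxx.
have := vg _ _ _ rho2E _ (X_param rho2E' free3).
move/(vanishes_atP _ dn_gt0 b3)/(_ (T2 ord0)) => /(_ _)/wrap[].
  apply/eqP => T0; have /(congr1 (mcoeff U_(ord0))) /eqP : 'X_ord0 = 0 :> {mpoly M[N.+1]}.
    by apply: io_eval; rewrite map_mpolyX mevalXU.
  by rewrite mcoeffXU eqxx mcoeff0 oner_eq0.
move=> v0; apply: io_eval; rewrite -[RHS]v0.
rewrite map_mpoly_sum meval_sum gE map_mpoly_sum meval_sum.
apply: eq_bigr => j _; rewrite !map_mpolyZ !mevalZ; congr (_ * _).
rewrite !map_mpoly_mpoly map_comp_meval; apply: meval_eq => y.
by rewrite (qE _ _ rho2).
Qed.

End Parametrization.

End DescentSteps.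

(** * Splitting by separable extensions *)

Lemma exprB_pchar_comm (R : nzRingType) p k (x y : R) : p \in [pchar R] ->
  GRing.comm x y -> (x - y) ^+ (p ^ k) = x ^+ (p ^ k) - y ^+ (p ^ k).
Proof.
move=> pR cxy; elim: k => [|k IH]; first by rewrite expn0 !expr1.
rewrite expnSr exprM IH -!(pFrobenius_autE pR) pFrobenius_autB_comm.
  by rewrite !pFrobenius_autE -!exprM.
exact/commrX/commr_sym/commrX/commr_sym.
Qed.

Section DivisionAlgebra.
Import FalgLfun.
Variables (L : fieldType) (D : falgType L).
Hypothesis D_div : division_algebra D.
Implicit Types (x y a c w v : D) (p q h : {poly L}).

Lemma division_mul_eq0 x y : x * y = 0 -> x = 0 \/ y = 0.
Proof.
move=> xy0; have [->|/D_div ux] := eqVneq x 0; first by left.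
by right; rewrite -[y](mulKr ux) xy0 mulr0.
Qed.

Lemma horner_algE_coef y p : horner_alg y p = \sum_(i < size p) p`_i *: y ^+ i.
Proof.
rewrite /horner_alg /horner_morph horner_coef size_map_poly; apply: eq_bigr => i _.
by rewrite coef_map /= mulr_algl.
Qed.

Lemma horner_alg_comp y p q : horner_alg y (p \Po q) = horner_alg (horner_alg y q) p.
Proof.
rewrite comp_polyE linear_sum horner_algE_coef; apply: eq_bigr => i _.
by rewrite linearZ /= rmorphXn /= mulr_algl.
Qed.

Lemma exists_annihilator y : exists2 p, p != 0 & horner_alg y p = 0.
Proof.
pose X := [tuple y ^+ i | i < (\dim {:D}).+1].
have nfX : ~~ free X.
  apply/negP => /eqP; rewrite size_tuple => dX.
  by have := dimvS (subvf <<X>>%VS); rewrite dX ltnn.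
apply: NNPP => np; move: nfX => /negP; apply; apply/freeP => k k0 i.
have : \poly_(j < (\dim {:D}).+1) k (inord j) = 0.
  apply: NNPP => /eqP pN0; apply: np; exists (\poly_(j < (\dim {:D}).+1) k (inord j)) => //.
  rewrite horner_algE_coef -[RHS]k0.
  have le_sz := size_poly (\dim {:D}).+1 (fun j => k (inord j)).
  rewrite (big_ord_widen _ (fun j => _`_j *: y ^+ j) le_sz).
  rewrite big_mkcond; apply: eq_bigr => j _; rewrite (nth_map ord0); last first.
    by rewrite size_enum_ord.
  rewrite nth_ord_enum coef_poly ltn_ord inord_val.
  case: ltnP => // lej; have := coef_poly (\dim {:D}).+1 (fun j => k (inord j)) j.
  by rewrite ltn_ord inord_val nth_default // => <-; rewrite scale0r.
by move/polyP/(_ i); rewrite coef_poly ltn_ord inord_val coef0.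
Qed.

Lemma exists_minpoly y : exists h, monic_irreducible_poly h /\
  forall p, horner_alg y p = 0 <-> h %| p.
Proof.
have [p0 p0N0 p0y] := exists_annihilator y.
pose P k := exists p, [/\ p != 0, horner_alg y p = 0 & size p = k].
have P0 : P (size p0) by exists p0.
have [k [h0 [h0N0 h0y sh0]] kmin] := exists_minimal P0.
pose h := (lead_coef h0)^-1 *: h0.
have lN0 : (lead_coef h0)^-1 != 0 by rewrite invr_eq0 lead_coef_eq0.
have hy : horner_alg y h = 0 by rewrite /h linearZ /= h0y mulr0.
have sh : size h = k by rewrite size_scale.
have hN0 : h != 0 by rewrite scaler_eq0 negb_or lN0.
have hmin p : horner_alg y p = 0 <-> h %| p.
  split=> [py|/dvdpP[q ->]]; last by rewrite rmorphM /= hy mulr0.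
  rewrite /dvdp; apply/eqP; apply: NNPP => /eqP rN0.
  have ry : horner_alg y (p %% h) = 0.
    move: py; rewrite {1}(divp_eq p h) rmorphD rmorphM /= hy mulr0 add0r.
    by [].
  have := kmin _ (ex_intro _ _ (And3 rN0 ry (erefl _))).
  by rewrite -sh leqNgt ltn_modp hN0.
exists h; split=> //; split; last first.
  by apply/monicP; rewrite lead_coefZ mulVf ?lead_coef_eq0.
split.
  rewrite ltnNge; apply/negP => /size1_polyC hC.
  move: hy hN0; rewrite hC polyC_eq0 -alg_polyC linearZ /= rmorph1 mulr1.
  by move=> /eqP; rewrite scaler_eq0 oner_eq0 orbF => ->.
move=> q sq /dvdpP[r hE].
have qN0 : q != 0 by apply: contra_neq hN0 => q0; rewrite hE q0 mulr0.
have rN0 : r != 0 by apply: contra_neq hN0 => r0; rewrite hE r0 mul0r.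
have := hy; rewrite hE rmorphM /= => /division_mul_eq0[/hmin|/hmin] hd; last first.
  by rewrite -hE /eqp hd andbT hE dvdp_mull.
have := dvdp_leq rN0 hd; rewrite hE size_mul // -ltnS prednK; last first.
  by rewrite addn_gt0 size_poly_gt0 rN0.
rewrite -addn1 leq_add2l => sq1; case/negP: sq.
by rewrite eqn_leq sq1 size_poly_gt0.
Qed.

Lemma separable_irreducible h : irreducible_poly h -> h^`() != 0 -> separable_poly h.
Proof.
move=> hI dN0; rewrite unlock irreducible_poly_coprime //.
apply/negP => /(dvdp_leq dN0); rewrite leqNgt lt_size_deriv //.
by apply: contra_neq dN0 => ->; rewrite linear0.
Qed.

Lemma memv1P y : reflect (exists c : L, y = c%:A) (y \in 1%VS).
Proof. exact: vlineP. Qed.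

(* If every element that is separable over the centre is central, then all
   elements are purely inseparable, which the relation [a c - c a = a] excludes. *)
Lemma exists_separable : ('Z({:D}) = 1)%VS -> (1 < \dim {:D})%N ->
  exists (y : D) (h : {poly L}), [/\ monic_irreducible_poly h, separable_poly h,
    (2 < size h)%N & forall p, horner_alg y p = 0 <-> h %| p].
Proof.
move=> D_central D_gt1; apply: NNPP => nsep.
have small y h : monic_irreducible_poly h -> h^`() != 0 ->
    (forall p, horner_alg y p = 0 <-> h %| p) -> y \in 1%VS.
  move=> hI dN0 hy; have sh : size h = 2%N.
    apply/eqP; rewrite eqn_leq hI.1.1 andbT leqNgt; apply/negP => sh; apply: nsep.
    by exists y, h; split=> //; apply: separable_irreducible => //; exact: hI.1.
  have : horner_alg y h = 0 by apply/hy.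
  rewrite horner_algE_coef sh !big_ord_recl big_ord0 /= expr0 expr1 addr0.
  have -> : h`_1 = 1 by have /monicP := hI.2; rewrite lead_coefE sh.
  rewrite scale1r => /eqP; rewrite addrC addr_eq0 => /eqP->.
  by rewrite memvN memvZ // memv_line.
have [a aN1] : exists a, a \notin (1%VS : {vspace D}).
  apply: NNPP => na; have: (\dim {:D} <= \dim (1%VS : {vspace D}))%N.
    apply: dimvS; apply/subvP => a _; apply/negPn/negP => aN; apply: na.
    by exists a.
  by rewrite dimv1 leqNgt D_gt1.
have [ha [haI hay]] := exists_minpoly a.
have da0 : ha^`() = 0.
  by apply: NNPP => /eqP dN0; case/negP: aN1; apply: small hay.
have [p pL] : exists p : nat, p \in [pchar L].
  have: (size ha).-1%:R == 0 :> L.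
    have := coef_deriv ha (size ha).-2; rewrite da0 coef0.
    have -> : (size ha).-2.+1 = (size ha).-1 by case: (size ha) haI.1.1 => [|[|]].
    have /monicP := haI.2; rewrite lead_coefE => ->.
    by move/esym/eqP.
  move=> sz0; have /= := natf0_pchar (n := (size ha).-1) _ sz0.
  by case: (size ha) haI.1.1 => [|[|k]] //= _ /(_ isT)[p]; exists p.
have [p_pr p0] := andP pL.
have pD : p \in [pchar D] by rewrite (rmorph_pchar (in_alg D)).
(* Induction on the degree of the minimal polynomial [h]. If its derivative is 0, [h] is a
   polynomial [nu] in the [p]-th power, and the minimal polynomial of [y ^+ p] divides [nu], of
   smaller degree; otherwise [small] applies. *)
have insep y : exists k, y ^+ (p ^ k) \in 1%VS.
  have [h [hI hy]] := exists_minpoly y.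
  have [N] := ubnP (size h); elim: N => // N IH in y h hI hy *; rewrite ltnS => sN.
  have [dh0|dN0] := eqVneq h^`() 0; last first.
    by exists 0%N; rewrite expn0 expr1; apply: small hy.
  have p_gt1 := prime_gt1 p_pr; have p_gt0 := ltnW p_gt1.
  have h_p i : h`_i != 0 -> (p %| i)%N.
    case: i => // i hi; have /eqP := coef_deriv h i; rewrite dh0 coef0 eq_sym.
    by rewrite -mulr_natr mulf_eq0 (negPf hi) /= -(dvdn_pcharf pL).
  pose nu := \poly_(i < size h) h`_(i * p).
  have hE : h = nu \Po 'X^p.
    apply/polyP => i; rewrite coef_comp_poly_Xn // coef_poly.
    case: (boolP (p %| i)%N) => [pi|npi]; last first.
      by apply/eqP; apply: contraR npi => /h_p.
    rewrite divnK //; case: ltnP => // lei.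
    by rewrite nth_default // (leq_trans lei) // leq_div.
  have nuy : horner_alg (y ^+ p) nu = 0.
    rewrite -[RHS](proj2 (hy h) (dvdpp h)) [in RHS]hE horner_alg_comp.
    by rewrite rmorphXn /= horner_algX.
  have [h2 [h2I h2y]] := exists_minpoly (y ^+ p).
  have snu : (size nu < size h)%N.
    have := size_comp_poly nu 'X^p; rewrite -hE size_polyXn /=.
    have := hI.1.1; case: (size h) => [|[|k]] //= _.
    case: (size nu) => [|[|l]] //= ->; rewrite !ltnS; exact: ltn_Pmulr.
  have nuN0 : nu != 0.
    by apply: contra_eq_neq hE => ->; rewrite comp_poly0 monic_neq0 // hI.2.
  have [k ky] : exists k, (y ^+ p) ^+ (p ^ k) \in 1%VS.
    apply: (IH _ h2) => //; apply: leq_trans sN; apply: leq_ltn_trans snu.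
    exact/dvdp_leq/h2y.
  by exists k.+1; rewrite expnS exprM.
have a_neq0 : a != 0 by apply: contraNneq aN1 => ->; apply: mem0v.
have comm1 u v : u \in 1%VS -> u * v = v * u.
  by move=> /memv1P[c ->]; rewrite mulr_algl mulr_algr.
pose del u := a * u - u * a.
have [k ak] := insep a.
(* [del] is the difference of two commuting operators, the multiplications by [a] on either side, so
   its iterate of order [p ^ k] is the commutator with [a ^+ (p ^ k)], which is central. *)
have del0 u : iter (p ^ k) del u = 0.
  have pE : p \in [pchar 'End(D)] by rewrite (rmorph_pchar (in_alg 'End(D))).
  have cfg : GRing.comm (amull a : 'End(D)) (amulr a).
    by apply/lfunP => v; rewrite !lfun_mulE !lfunE /= mulrA.
  have iterE N : iter N del u = ((amull a - amulr a) ^+ N : 'End(D)) u.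
    elim: N => [|N IH]; first by rewrite expr0 lfunE.
    by rewrite iterS IH exprSr lfun_mulE add_lfunE opp_lfunE !lfunE.
  rewrite iterE exprB_pchar_comm // add_lfunE opp_lfunE.
  have lE N : (amull a ^+ N : 'End(D)) u = a ^+ N * u.
    elim: N => [|N IH]; first by rewrite !expr0 lfunE mul1r.
    by rewrite exprSr lfun_mulE IH lfunE /= mulrA -exprS.
  have rE N : (amulr a ^+ N : 'End(D)) u = u * a ^+ N.
    elim: N => [|N IH]; first by rewrite !expr0 lfunE mulr1.
    by rewrite exprSr lfun_mulE IH lfunE /= -mulrA -exprSr.
  by rewrite lE rE comm1 ?subrr.
have [u du] : exists u, del u != 0.
  apply: NNPP => nu; case/negP: aN1; rewrite -D_central memv_cap memvf /=.
  apply/centvP => u _; apply/eqP; rewrite -subr_eq0; apply/negPn/negP => du.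
  by apply: nu; exists u.
(* The last nonzero iterate [w] commutes with [a] and is some [a v - v a]. Then [c = v w^-1 a]
   satisfies [a c = (1 + c) a], and a central power of [c], of exponent a power of [p], would be
   equal to itself plus 1. *)
have [N dN Nmin] := exists_minimal (del0 u : (fun N => iter N del u = 0) _).
have [j NE] : exists j, N = j.+2.
  case: N dN {Nmin} => [u0|[d1|j _]]; last by exists j.
    by rewrite -[u]/(iter 0 del u) u0 /del mulr0 mul0r subrr eqxx in du.
  by rewrite -[del u]/(iter 1 del u) d1 eqxx in du.
pose v := iter j del u; pose w := del v.
have w_neq0 : w != 0.
  by apply/eqP => w0; have := Nmin j.+1 w0; rewrite NE ltnn.
have wa : a * w = w * a.
  by apply/eqP; rewrite -subr_eq0 -[_ - _]/(del w) -[del w]/(iter j.+2 del u) -NE dN.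
have va : a * v = w + v * a by rewrite /w /del subrK.
clearbody w; have uw := D_div w_neq0.
pose c := v * w^-1 * a.
have ac : a * c = (1 + c) * a.
  have wa' : a * w^-1 = w^-1 * a.
    by rewrite -{1}[a](mulKr uw) -wa mulrA mulrK // mulrA.
  rewrite /c !mulrA va !mulrDl mul1r mulrV // mul1r; congr (_ + _).
  by rewrite -!mulrA; congr (_ * _); rewrite !mulrA wa'.
have acN N' : a * c ^+ N' = (1 + c) ^+ N' * a.
  elim: N' => [|N' IH]; first by rewrite !expr0 mulr1 mul1r.
  by rewrite exprSr mulrA IH -mulrA ac mulrA -exprSr.
have [k' ck'] := insep c.
have e1 : (1 + c) ^+ (p ^ k') = c ^+ (p ^ k') + 1.
  have := exprB_pchar_comm k' pD (commr1 (1 + c)).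
  by rewrite addrC addKr expr1n => ->; rewrite subrK.
have := acN (p ^ k')%N; rewrite e1 mulrDl mul1r (comm1 _ a ck').
move/eqP; rewrite -subr_eq0 opprD addrA subrr add0r oppr_eq0.
exact/negP.
Qed.

End DivisionAlgebra.

(** * Split algebras in terms of matrix units *)

Section SplitAlgebra.
Variables (K : fieldType) (B : falgType K).

(** In dimension [n ^ 2], matrix units of size [n] over [e B e] force [e B e] to be the line of [e]
    ([split_corner]). A split algebra is thus given by elements, which extend along field morphisms,
    and not by an isomorphism. *)
Definition split_data (n : nat) (e : B) (x y : 'I_n -> B) :=
  wdata e x y /\ \dim {:B} = (n ^ 2)%N.

Section SplitFacts.
Variables (n : nat) (e : B) (x y : 'I_n -> B).
Hypotheses (n_gt0 : (0 < n)%N) (sd : split_data e x y).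

Let wd := sd.1.

Lemma split_dim_row : \dim (<[e]> * {:B}) = n.
Proof.
apply/eqP; rewrite -(eqn_pmul2l n_gt0); apply/eqP.
by rewrite -(wd_dim_left wd) sd.2 expnS expn1.
Qed.

Lemma split_corner : (<[e]> * {:B} * <[e]> = <[e]>)%VS.
Proof.
apply/esym/eqP; rewrite eqEdim -memvE (corner_memP wd) !(wd_idem wd) eqxx /=.
rewrite dim_vline (wd_neq0 wd) /= -(leq_pmul2l n_gt0).
by rewrite -(wd_dim_corner wd) split_dim_row muln1.
Qed.

Lemma split_corner_scalar b : exists c, e * b * e = c *: e.
Proof.
by apply/vlineP; rewrite -split_corner !memv_mul ?memv_line ?memvf.
Qed.

Lemma split_right_ideal_dim U : right_ideal U ->
  \dim U = (n * \dim (U * <[e]>))%N.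
Proof. exact: wd_dim_right wd _. Qed.

Lemma split_minimal : minimal_idem e.
Proof.
move=> U rU sU; have := dimvS sU.
rewrite (split_right_ideal_dim rU) split_dim_row -{2}[n]muln1 leq_pmul2l //.
move Uek: (\dim (U * <[e]>)) => k; case: k Uek => [|[|k]] Ue // _.
  by left; apply/eqP; rewrite -dimv_eq0 (split_right_ideal_dim rU) Ue muln0.
right; apply/eqP; rewrite eqEdim sU (split_right_ideal_dim rU) split_dim_row.
by rewrite Ue muln1 leqnn.
Qed.

Lemma split_simple : simple_algebra B.
Proof.
move=> I lI rI; have [->|IN0] := eqVneq I 0%VS; [by left|right].
have lI' b u : u \in I -> b * u \in I by move=> uI; apply/(prodvP lI)/uI/memvf.
have rI' b u : u \in I -> u * b \in I.
  by move=> uI; apply: (prodvP rI) => //; apply: memvf.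
have [u uI uN0] : exists2 u, u \in I & u != 0.
  by exists (vpick I); rewrite ?memv_pick // vpick0.
have eI : e \in I.
  apply: NNPP => eI; case/negP: uN0; apply/eqP.
  have yx0 k l : y k * u * x l = 0.
    have [c cE] := split_corner_scalar (y k * u * x l).
    move: cE; rewrite -!mulrA (wd_xe wd) !mulrA (wd_ey wd) => cE.
    have [c0|cN0] := eqVneq c 0; first by rewrite cE c0 scale0r.
    case: eI; rewrite -[e]scale1r -(mulVf cN0) -scalerA -cE memvZ //.
    by rewrite rI' ?lI'.
  rewrite -[u]mul1r -(wd_xy wd) mulr_suml big1 // => k _.
  rewrite -[_ * u]mulr1 -(wd_xy wd) mulr_sumr big1 // => l _.
  have -> : x k * y k * u * (x l * y l) = x k * (y k * u * x l) * y l.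
    by rewrite !mulrA.
  by rewrite yx0 mulr0 mul0r.
apply/eqP; rewrite eqEsubv subvf /=; apply/subvP => b _.
rewrite -[b]mul1r -(wd_xy wd) mulr_suml memv_suml // => k _.
by rewrite -(wd_xe wd) -!mulrA lI' // rI'.
Qed.

Lemma split_central : central_algebra B.
Proof.
apply/eqP; rewrite eqEsubv; apply/andP; split; last first.
  apply/subvP => _ /vlineP[c ->]; rewrite memv_cap memvf /=.
  by apply/centvP => b _; rewrite mulr_algl mulr_algr.
apply/subvP => z; rewrite memv_cap memvf => /centvP zC.
have {}zC b : z * b = b * z by apply: zC; apply: memvf.
have [c cE] := split_corner_scalar z.
suff -> : z = c *: 1 by rewrite memvZ ?memv_line.
rewrite -(wd_xy wd) scaler_sumr -[z]mulr1 -(wd_xy wd) mulr_sumr.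
apply: eq_bigr => k _; rewrite mulrA zC -mulrA.
have -> : x k * (z * y k) = x k * (e * z * e) * y k.
  by rewrite !mulrA (wd_xe wd) -!mulrA (wd_ey wd).
by rewrite cE -scalerAr -scalerAl (wd_xe wd).
Qed.

End SplitFacts.
End SplitAlgebra.

Lemma splits_data (F : fieldType) (A : falgType F) (n : nat) (K : fieldType)
    (phi : {rmorphism F -> K}) : (0 < n)%N -> \dim {:A} = (n ^ 2)%N ->
  splits A n phi ->
  exists e (x y : 'I_n -> scext A phi), split_data e x y.
Proof.
move=> n_gt0 degA [f [[f1 fM] [g fK gK]]].
have gM X Y : g (X *m Y) = g X * g Y.
  by apply: (can_inj fK); rewrite gK fM !gK.
have g1 : g 1%:M = 1 by apply: (can_inj fK); rewrite gK f1.
have g0 : g 0 = 0 by apply: (can_inj fK); rewrite gK linear0.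
have gD X Y : g (X + Y) = g X + g Y.
  by apply: (can_inj fK); rewrite gK linearD !gK.
pose o := Ordinal n_gt0; pose D i j : 'M[K]_n := delta_mx i j.
exists (g (D o o)), (fun k => g (D k o)), (fun k => g (D o k)).
split; last by rewrite dim_scext.
split; rewrite -?gM.
- by rewrite mul_delta_mx.
- apply/eqP => e0; have := congr1 f e0; rewrite gK linear0.
  by move=> /matrixP/(_ o o)/eqP; rewrite !mxE !eqxx oner_eq0.
- by move=> k; rewrite -gM mul_delta_mx.
- by move=> k; rewrite -gM mul_delta_mx.
- under eq_bigr => k _ do rewrite -gM mul_delta_mx.
  rewrite -(big_morph g gD g0) -g1; congr (g _).
  apply/matrixP => i j; rewrite summxE !mxE.
  rewrite (bigD1 i) //= mxE eqxx big1 ?addr0 => [|l li].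
    by rewrite /= eq_sym; case: eqP.
  by rewrite mxE eq_sym (negPf li).
move=> k l; rewrite -gM; have [<-|kl] := eqVneq k l; first by rewrite mul_delta_mx.
by rewrite mul_delta_mx_0.
Qed.

Section ScalarExtensionData.
Variables (F : fieldType) (A : falgType F) (K L : fieldType).
Variables (phi : {rmorphism F -> K}) (psi : {rmorphism F -> L}).
Variable tau : {rmorphism K -> L}.
Hypothesis psiE : forall x, psi x = tau (phi x).
Local Notation sm := (@scmap F A K L phi psi tau).

Lemma scmap_wdata s (e : scext A phi) (x y : 'I_s -> scext A phi) : wdata e x y ->
  wdata (sm e) (fun k => sm (x k)) (fun k => sm (y k)).
Proof.
move=> wd; split; try move=> k.
- by rewrite -scmapM // (wd_idem wd).
- apply: contra_neq (wd_neq0 wd) => e0; apply: (@scmap_inj _ _ _ _ phi psi tau).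
  by rewrite e0 [RHS]map_mx0.
- by rewrite -scmapM // (wd_xe wd).
- by rewrite -scmapM // (wd_ey wd).
- under eq_bigr => k _ do rewrite -scmapM //.
  by rewrite -scmap_sum (wd_xy wd) scmap1.
move=> l; rewrite -scmapM // (wd_yx wd); case: ifP => // _.
exact: map_mx0.
Qed.

Lemma scmap_split_data s (e : scext A phi) (x y : 'I_s -> scext A phi) :
  split_data e x y ->
  split_data (sm e) (fun k => sm (x k)) (fun k => sm (y k)).
Proof. by case=> wd dA; split; [apply: scmap_wdata | rewrite -dA !dim_scext]. Qed.

Lemma scext_simple_descent : simple_algebra (scext A psi) ->
  simple_algebra (scext A phi).
Proof.
move=> simp I lI rI.
have [||I0|If] := simp (scspan psi tau I).
- by rewrite -(scspan_full _ psiE) -scspan_prod // scspanSE.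
- by rewrite -(scspan_full _ psiE) -scspan_prod // scspanSE.
- have := dim_scspan psiE I; rewrite I0 dimv0 => /esym/eqP.
  by rewrite dimv_eq0 => /eqP; left.
by right; apply: (scspan_inj psiE); rewrite If scspan_full.
Qed.

Lemma scext_central_descent : central_algebra (scext A psi) ->
  central_algebra (scext A phi).
Proof.
move=> cent; apply/eqP; rewrite eqEsubv; apply/andP; split; last first.
  apply/subvP => _ /vlineP[c ->]; rewrite memv_cap memvf /=.
  by apply/centvP => b _; rewrite mulr_algl mulr_algr.
apply/subvP => z; rewrite memv_cap memvf => /centvP zC.
rewrite -(mem_scspanE psiE) scspan_line scmap1 //.
have -> : (<[1]>%VS : {vspace scext A psi}) = 'Z(fullv)%VS by rewrite cent.
rewrite memv_cap memvf /= -(scspan_full _ psiE).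
rewrite -subv_cent1.
rewrite /scspan /semispan; apply/span_subvP => w /mapP[u _ ->].
by apply/cent1vP; rewrite -!scmapM // zC ?memvf.
Qed.

End ScalarExtensionData.

Section CornerDivision.
Variables (L : fieldType) (B : falgType L) (s : nat) (e : B) (x y : 'I_s -> B).
Hypotheses (wd : wdata e x y) (e_min : minimal_idem e).

Let D := subvs_of (corner wd).
Let ee := wd_idem wd.

Lemma corner_one : vsval (1 : D) = e.
Proof.
rewrite -[LHS]/(algid (corner wd)).
have eC : e \in corner wd by rewrite (corner_memP wd) !ee.
have aC : e * algid (corner wd) * e == algid (corner wd).
  by rewrite -(corner_memP wd); apply: memv_algid.
by rewrite -(eqP aC) -mulrA (algidl eC) ee.
Qed.

Lemma corner_mem (u : D) : e * vsval u * e = vsval u.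
Proof. by apply/eqP; rewrite -(corner_memP wd); apply: subvsP. Qed.

Lemma corner_lift b : exists u : D, vsval u = e * b * e.
Proof.
have ebe : e * b * e \in corner wd.
  by rewrite /corner /= (corner_memP wd) !mulrA ee -!mulrA ee.
by exists (Subvs ebe).
Qed.

Lemma dim_corner : \dim {:D} = \dim (<[e]> * {:B} * <[e]>).
Proof. by rewrite dimvf. Qed.

Lemma corner_division : division_algebra D.
Proof.
have rinv (u : D) : u != 0 -> exists v, u * v = 1.
  move=> uN0; pose d := vsval u.
  have edE : e * d = d by rewrite /d -[in LHS](corner_mem u) !mulrA ee corner_mem.
  have deE : d * e = d by rewrite /d -[in LHS](corner_mem u) -!mulrA ee mulrA corner_mem.
  have [|dB0|dBE] := e_min (right_ideal_mulf <[d]>).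
  - by rewrite -edE -prodv_line -prodvA prodvSr ?subvf.
  - case/eqP: uN0; apply/val_inj/eqP; rewrite -memv0 -dB0.
    by apply/memv_linel; exists 1; rewrite ?memvf ?mulr1.
  have : e \in (<[d]> * fullv)%VS.
    by rewrite dBE; apply/memv_linel; exists 1; rewrite ?memvf ?mulr1.
  move=> /memv_linel[b _ eE]; have [v vE] := corner_lift b.
  exists v; apply/val_inj; rewrite [RHS]corner_one [LHS]/= vE -/d.
  by rewrite !mulrA deE -eE ee.
move=> u uN0; have [v uv] := rinv u uN0; apply/unitrP; exists v; split=> //.
have [w vw] : exists w, v * w = 1.
  by apply: rinv; apply: contra_eq_neq uv => ->; rewrite mulr0 eq_sym oner_neq0.
by rewrite -[RHS]vw -[X in v * X = _]mulr1 -vw [u * _]mulrA uv mul1r.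
Qed.

(** A central element [d] of [e B e] extends to the diagonal element [Z], which is central in [B],
    hence a scalar; compressing it between [y k0] and [x k0] returns [d]. *)
Lemma corner_central : central_algebra B -> central_algebra D.
Proof.
move=> centB; apply/eqP; rewrite eqEsubv; apply/andP; split; last first.
  apply/subvP => _ /vlineP[c ->]; rewrite memv_cap memvf /=.
  by apply/centvP => b _; rewrite mulr_algl mulr_algr.
apply/subvP => z; rewrite memv_cap memvf => /centvP zC.
pose d := vsval z; have dC b : (e * b * e) * d = d * (e * b * e).
  have [u <-] := corner_lift b.
  by have /(congr1 vsval) := zC u (memvf _).
pose Z := \sum_k x k * d * y k.
have ZC : Z \in 'Z({:B})%VS.
  rewrite memv_cap memvf; apply/centvP => b _.
  rewrite -[LHS]mulr1 -(wd_xy wd) mulr_sumr -[RHS]mul1r -(wd_xy wd) mulr_suml.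
  rewrite /Z [LHS](eq_bigr (fun l => \sum_k x k * (d * (e * (y k * b * x l) * e)) * y l)).
    rewrite [RHS](eq_bigr (fun k => \sum_l x k * (d * (e * (y k * b * x l) * e)) * y l)).
      by rewrite exchange_big.
    move=> k _; rewrite !mulr_sumr; apply: eq_bigr => l _; rewrite -dC.
    by rewrite !mulrA (wd_xe wd) -!mulrA [e * (d * _)]mulrA -{1}(wd_xe wd l) -!mulrA.
  move=> l _; rewrite mulr_suml mulr_suml; apply: eq_bigr => k _.
  by rewrite -!mulrA (wd_ey wd) [e * (y k * _)]mulrA (wd_ey wd).
move: ZC; rewrite centB => /vlineP[c ZE].
have [k0 _] : exists k0 : 'I_s, true.
  apply: NNPP => nk; have := wd_xy wd; rewrite big1 => [/esym/eqP|k _].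
    by rewrite oner_eq0.
  by case: nk; exists k.
have dE : d = c *: e.
  transitivity (y k0 * Z * x k0).
    rewrite /Z mulr_sumr mulr_suml (bigD1 k0) //= !mulrA (wd_yx wd) eqxx.
    rewrite -[_ * y k0 * x k0]mulrA (wd_yx wd) eqxx corner_mem.
    rewrite big1 ?addr0 // => k kk0.
    by rewrite !mulrA (wd_yx wd) eq_sym (negPf kk0) !mul0r.
  by rewrite ZE -scalerAr mulr1 -scalerAl (wd_yx wd) eqxx.
apply/vlineP; exists c; apply/val_inj; rewrite [LHS]dE.
by rewrite -[RHS]/(c *: vsval (1 : D)) corner_one.
Qed.

End CornerDivision.

Section TowerStep.
Variables (F : fieldType) (A : falgType F) (n : nat).
Hypotheses (n_gt0 : (0 < n)%N) (degA : \dim {:A} = (n ^ 2)%N).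
Variables (L : fieldType) (psi : {rmorphism F -> L}).
Local Notation B := (scext A psi).
Hypothesis centB : central_algebra B.
Variables (s : nat) (e : B) (x y : 'I_s -> B).
Hypotheses (wd : wdata e x y) (e_min : minimal_idem e) (s_neq_n : s != n).

Let D := subvs_of (corner wd).

Lemma tower_dim_gt1 : (1 < \dim {:D})%N.
Proof.
rewrite dim_corner; have := wd_dim_left wd; rewrite (wd_dim_corner wd).
rewrite dim_scext degA => nE; rewrite ltnNge; apply/negP => le1.
case/negP: s_neq_n; have : (0 < n ^ 2)%N by rewrite expn_gt0 n_gt0.
rewrite nE; case: (\dim (<[e]> * fullv * <[e]>)) le1 nE => [|[|]] // _.
  by rewrite !muln0.
by rewrite muln1 mulnn => /esym/eqP; rewrite eqn_sqr.
Qed.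

(* A root [z] of the minimal polynomial of [t] over [L] makes [t - z] a zero
   divisor, so that [(t - z) e B] is smaller than [e B]. *)
Lemma tower_step : exists (h : {poly L}) (hI : monic_irreducible_poly h),
  separable_poly h /\
  exists U : {vspace scext A (qf_const hI \o psi)},
    [/\ right_ideal U, U != 0%VS & (\dim U < \dim (<[e]> * {:B}))%N].
Proof.
have D_div : division_algebra D := corner_division e_min.
have D_cent : central_algebra D by apply: corner_central.
have [t [h [hI hsep sh hy]]] := exists_separable D_div D_cent tower_dim_gt1.
exists h, hI; split=> //.
set psi' := (X in scext A X); pose B' := scext A psi'.
have psi'E a : psi' a = qf_const hI (psi a) by [].
pose sm := @scmap F A _ _ psi psi' (qf_const hI).
pose m := (size h).-1; have smE : size h = m.+1 by rewrite /m; case: (size h) sh.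
have m_gt1 : (1 < m)%N by rewrite -ltnS -smE.
pose z : {poly %/ h with hI} := in_qpoly h 'X.
have /dvdpP[q qE] : 'X - z%:P %| map_poly (qf_const hI) h.
  by rewrite dvdp_XsubCl; apply: root_qf.
have hN0 : h != 0 by rewrite -size_poly_gt0 smE.
have qN0 : q != 0.
  apply: contra_neq hN0 => q0; apply/eqP.
  by rewrite -(map_poly_eq0 (qf_const hI)) qE q0 mul0r.
have sq : size q = m.
  have := congr1 (fun p => size (p : {poly _})) qE.
  rewrite size_map_poly smE size_Mmonic ?monicXsubC // size_XsubC addn2.
  by case.
(* The unit of the corner is [e], so [b 0] is the image of [e] and not 1. *)
pose b i : B' := sm (vsval (t ^+ i)).
have bM i j : b i * b j = b (i + j)%N.
  by rewrite /b exprD /sm -scmapM.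
have b0 : b 0%N = sm e by rewrite /b expr0 corner_one.
have free_b : free (map_tuple sm [tuple vsval (t ^+ i) | i < m]).
  apply: (scmap_free psi'E); apply/freeP => k k0 i.
  pose k' j := if insub j is Some j' then k j' else 0.
  have k'E (j : 'I_m) : k' j = k j by rewrite /k' valK.
  pose p := \poly_(j < m) k' j.
  have : horner_alg t p = 0.
    have le_p := size_poly m k'.
    rewrite horner_algE_coef (big_ord_widen _ (fun j => p`_j *: t ^+ j) le_p).
    apply/val_inj; rewrite [RHS]/= -[RHS]k0 big_mkcond linear_sum.
    apply: eq_bigr => j _; rewrite (nth_map j) ?size_enum_ord // nth_ord_enum.
    case: ltnP => [_|lej]; first by rewrite coef_poly ltn_ord k'E linearZ.
    have := coef_poly m k' j; rewrite ltn_ord k'E nth_default // => <-.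
    by rewrite scale0r linear0.
  move/hy => hp; have p0 : p = 0.
    apply/eqP; apply: contraTT hp => pN0; apply/negP => /(dvdp_leq pN0).
    by rewrite smE leqNgt ltnS size_poly.
  by move/polyP/(_ i): p0; rewrite coef_poly ltn_ord k'E coef0.
have {}free_b (k : nat -> {poly %/ h with hI}) :
    \sum_(i < m) k i *: b i = 0 -> forall i, (i < m)%N -> k i = 0.
  move=> k0 i lti; move/freeP: free_b => /(_ (fun i => k i) _ (Ordinal lti)); apply.
  rewrite -[RHS]k0; apply: eq_bigr => j _.
  by rewrite -tnth_nth tnth_map tnth_mktuple.
(* [c] is [t - z] and [w] is [q(t)], where [h = q (X - z)], so their product is [h(t) = 0]. Neither
   is 0: the powers of [t] below the degree of [h], which is at least 2, stay independent after
   extension. *)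
pose w := \sum_(i < m) q`_i *: b i; pose c := b 1%N - z *: b 0%N.
have bh : \sum_(j < m.+1) (map_poly (qf_const hI) h)`_j *: b j = 0.
  have hty : horner_alg t h = 0 by apply/hy/dvdpp.
  have := congr1 (fun u => sm (vsval u)) hty; rewrite horner_algE_coef smE.
  rewrite linear_sum /sm scmap_sum linear0 => e0; rewrite -[RHS](map_mx0 (qf_const hI)).
  rewrite -[RHS]e0; apply: eq_bigr => j _.
  by rewrite linearZ /= scmapZ coef_map.
have cw : c * w = 0.
  rewrite -[RHS]bh qE mulrC /c /w mulrBl !mulr_sumr.
  under [RHS]eq_bigr => j _ do rewrite mulrBl coefB coefXM mul_polyC coefZ scalerBl.
  rewrite sumrB; congr (_ - _).
    rewrite big_ord_recl scale0r add0r; apply: eq_bigr => j _.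
    by rewrite -scalerAr bM.
  rewrite big_ord_recr /= [q`_m]nth_default ?sq // mulr0 scale0r addr0.
  apply: eq_bigr => j _; rewrite -scalerAr -scalerAl bM scalerA.
  by rewrite add0n mulrC.
have wN0 : w != 0.
  apply: contra_neq qN0 => w0; apply/polyP => i; rewrite coef0.
  have [lti|lei] := ltnP i m; last by rewrite nth_default ?sq.
  exact: (free_b (fun i => q`_i)).
have cN0 : c != 0.
  apply/eqP => c0; pose k i := if i == 0%N then - z else (i == 1%N)%:R.
  suff : k 1%N = 0 by move/eqP; rewrite oner_eq0.
  apply: free_b => //; rewrite -[RHS]c0 /c.
  case: (m) m_gt1 => [|[|m']] // _; rewrite !big_ord_recl /= big1 ?addr0.
    by rewrite /k /= scale1r scaleNr addrC.
  by move=> i _; rewrite /k /= scale0r.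
pose e1 := sm e; have e1b i : e1 * b i = b i by rewrite /e1 -b0 bM.
have be1 i : b i * e1 = b i by rewrite /e1 -b0 bM addn0.
exists (amull c @: (<[e1]> * fullv))%VS; split.
- apply/right_idealP => _ u /memv_imgP[_ /memv_linel[v _ ->] ->].
  rewrite amullE -!mulrA; have -> : c * (e1 * (v * u)) = amull c (e1 * (v * u)).
    by rewrite amullE.
  by apply/memv_img/memv_mul; rewrite ?memv_line ?memvf.
- rewrite -subv0; apply/subvPn; exists (c * e1).
    rewrite -amullE; apply: memv_img; apply/memv_linel; exists 1; rewrite ?memvf //.
    by rewrite mulr1.
  by rewrite memv0 /c mulrBl -scalerAl !be1.
have -> : \dim (<[e]> * {:B}) = \dim (<[e1]> * {:B'}).
  rewrite -(dim_scspan psi'E) (scspan_prod psi'E) (scspan_full _ psi'E).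
  by rewrite scspan_line.
rewrite -(limg_ker_dim (amull c) (<[e1]> * fullv)) -{1}[\dim (_ @: _)]add0n.
rewrite ltn_add2r lt0n dimv_eq0; apply: contra wN0 => /eqP K0.
rewrite -memv0 -K0 memv_cap memv_ker amullE cw eqxx andbT.
apply/memv_linel; exists w; rewrite ?memvf // /w mulr_sumr.
by apply: eq_bigr => i _; rewrite -scalerAr e1b.
Qed.

End TowerStep.

Section SplittingTower.
Variables (F : fieldType) (A : falgType F) (n d : nat).
Hypotheses (n_gt0 : (0 < n)%N) (degA : \dim {:A} = (n ^ 2)%N).
Variables (K : fieldType) (phi : {rmorphism F -> K}).
Hypothesis K_splits : splits A n phi.

(** Common overfields with an arbitrary extension are built along the tower, by adjoining to the
    overfield a root of each defining polynomial ([has_composites_qf]). *)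
Definition has_composites (L : fieldType) (psi : {rmorphism F -> L}) :=
  forall (K : fieldType) (phi : {rmorphism F -> K}),
  exists (M : fieldType) (k : {rmorphism K -> M}) (l : {rmorphism L -> M}),
    forall x, k (phi x) = l (psi x).

Lemma has_composites_id : has_composites (idfun : {rmorphism F -> F}).
Proof. by move=> K' phi'; exists K', idfun, phi'. Qed.

Lemma has_composites_qf (L : fieldType) (psi : {rmorphism F -> L}) (h : {poly L})
    (hI : monic_irreducible_poly h) :
  has_composites psi -> has_composites (qf_const hI \o psi).
Proof.
move=> cpsi K' phi'; have [M [k [l kl]]] := cpsi K' phi'.
have [|M' [t [z hz]]] := @adjoin_root M (map_poly l h).
  by rewrite size_map_poly hI.1.1.
have hz' : root (map_poly (t \o l) h) z by rewrite map_poly_comp.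
exists M', (t \o k), (qf_rmorph hI hz') => a.
by rewrite [RHS]qf_rmorph_const /= kl.
Qed.

Lemma has_composites_simple (L : fieldType) (psi : {rmorphism F -> L}) :
  has_composites psi ->
  simple_algebra (scext A psi) /\ central_algebra (scext A psi).
Proof.
move=> cpsi; have [M [k [l kl]]] := cpsi K phi.
have [e [x [y sd]]] := splits_data n_gt0 degA K_splits.
pose rho : {rmorphism F -> M} := k \o phi.
have rhoE a : rho a = k (phi a) by [].
have sd' := scmap_split_data rhoE sd.
split.
  exact: (scext_simple_descent (psi := rho) (tau := l) kl (split_simple n_gt0 sd')).
exact: (scext_central_descent (psi := rho) (tau := l) kl (split_central n_gt0 sd')).
Qed.

Variable X : forall (L : fieldType) (psi : {rmorphism F -> L}),
  {vspace scext A psi} -> Prop.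
Hypothesis X_ext : forall (L M : fieldType) (psi : {rmorphism F -> L})
  (rho : {rmorphism F -> M}) (tau : {rmorphism L -> M}),
  (forall x, rho x = tau (psi x)) ->
  forall J : {vspace scext A psi}, X J -> X (scspan rho tau J).

Local Notation VI := (vanish_ideal (n := n) (d := d) X).

Definition descends (L : fieldType) (psi : {rmorphism F -> L}) :=
  forall g, VI psi g -> in_ext psi (VI (idfun : {rmorphism F -> F})) g.

(** Induction on a bound for the least dimension of a nonzero right ideal, which [tower_step] lowers
    as long as there are not [n] matrix units. Descent of the vanishing ideal of [X] is carried
    along, one separable step at a time. *)
Lemma exists_splitting : exists (L : fieldType) (psi : {rmorphism F -> L}),
  [/\ has_composites psi, descends psi &
    exists e (x y : 'I_n -> scext A psi), split_data e x y].
Proof.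
suff IH N : forall (L : fieldType) (psi : {rmorphism F -> L}),
    has_composites psi -> descends psi ->
    (exists U : {vspace scext A psi},
       [/\ right_ideal U, U != 0%VS & (\dim U <= N)%N]) ->
    exists (L : fieldType) (psi : {rmorphism F -> L}),
      [/\ has_composites psi, descends psi &
        exists e (x y : 'I_n -> scext A psi), split_data e x y].
  apply: (IH (\dim {:A}) F idfun has_composites_id).
    move=> g vg.
    have <- : map_mpoly (idfun : {rmorphism F -> F}) g = g.
      by apply/mpolyP => mn; rewrite mcoeff_map_mpoly.
    exact: in_ext_map.
  exists fullv; split; [exact: right_idealf | | by rewrite dim_scext].
  by rewrite -dimv_eq0 dim_scext degA -lt0n expn_gt0 n_gt0.
elim: N => [|N IH] L psi cpsi dpsi [U [rU UN0 dU]].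
  by case/negP: UN0; rewrite -dimv_eq0 -leqn0.
have [simpB centB] := has_composites_simple cpsi.
have [e [s [x [y [wd e_min emin]]]]] := simple_wdata simpB.
have [sn|sn] := eqVneq s n.
  subst s; exists L, psi; split=> //; exists e, x, y; split=> //.
  by rewrite dim_scext.
have [h [hI [hsep [U' [rU' U'N0 dU']]]]] :=
  tower_step n_gt0 degA centB wd e_min sn.
apply: (IH _ (qf_const hI \o psi)).
- exact: has_composites_qf.
- move=> g vg; apply: (in_ext_trans (tau := psi) (ups := qf_const hI)) (dpsi) _ => //.
    exact: vanish_ideal0.
  exact: vanish_ideal_quotient.
exists U'; split=> //; rewrite -ltnS; apply: leq_trans dU' _.
exact: leq_trans (emin _ rU UN0) dU.
Qed.

End SplittingTower.

(** * Varieties of ideals meeting a flag *)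

(** Vectors are added one at a time: that of index [k], from 0, is taken in the [p.2] with the least
    [p.1] above [k]. This subspace lies in all the others with [k < p.1], and its dimension exceeds
    [k]. *)
Lemma adapted_basis (K : fieldType) (V : vectType K) (W : {vspace V})
    (s : seq (nat * {vspace V})) :
    (forall p, p \in s -> (p.1 <= \dim p.2)%N /\ (p.2 <= W)%VS) ->
    (forall p q, p \in s -> q \in s -> (p.1 <= q.1)%N -> (p.2 <= q.2)%VS) ->
  exists w : (\dim W).-tuple V, basis_of W w /\
    forall p i, p \in s -> (i < p.1)%N -> w`_i \in p.2.
Proof.
move=> sW s_mono.
suff IH k : (k <= \dim W)%N -> exists w : seq V, [/\ size w = k, free w,
    (<<w>> <= W)%VS &
    forall p i, p \in s -> (i < p.1)%N -> (i < k)%N -> w`_i \in p.2].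
  have [w [sw fw wW wp]] := IH _ (leqnn _).
  have swP : size w == \dim W by apply/eqP.
  exists (Tuple swP); split.
    by rewrite basisEfree fw wW size_tuple leqnn.
  move=> p i ps ip; apply: wp => //; apply: leq_trans ip _.
  by have [h1 /dimvS] := sW _ ps; apply: leq_trans.
elim: k => [|k IH] lek.
  by exists [::]; split; rewrite ?nil_free ?span_nil ?sub0v.
have [w [sw fw wW wp]] := IH (ltnW lek).
have [H [kH HW Hp]] : exists H : {vspace V}, [/\ (k < \dim H)%N, (H <= W)%VS &
    forall p, p \in s -> (k < p.1)%N -> (H <= p.2)%VS].
  have [[p ps kp]|np] := classic (exists2 p, p \in s & (k < p.1)%N).
    pose P j := exists2 q, q \in s & (k < q.1)%N /\ q.1 = j.
    have P0 : P p.1 by exists p.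
    have [j [q qs [kq qj]] jmin] := exists_minimal P0.
    have [q1 qW] := sW _ qs; exists q.2; split=> //; first exact: leq_trans q1.
    move=> r rs kr; apply: s_mono => //; rewrite qj; apply: jmin.
    by exists r.
  exists W; split=> // p ps kp; case: np; by exists p.
have /subvPn[v vH vw] : ~~ (H <= <<w>>)%VS.
  apply/negP => /dimvS; rewrite leqNgt; move/eqP: fw => ->.
  by rewrite sw kH.
exists (rcons w v); split.
- by rewrite size_rcons sw.
- by rewrite (perm_free (introT permPl (perm_rcons v w))) free_cons vw.
- by rewrite (eq_span (mem_rcons w v)) span_cons subv_add wW -memvE (subvP HW).
move=> p i ps ip; rewrite ltnS leq_eqVlt nth_rcons sw => /predU1P[ik|ltik].
  by rewrite ik ltnn eqxx; apply: (subvP (Hp p ps _)) => //; rewrite -ik.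
by rewrite ltik; apply: wp.
Qed.

Section FlagVariety.
Variables (F : fieldType) (A : falgType F) (n d : nat).
Local Notation m := (\dim {:A}).
Hypotheses (n_gt0 : (0 < n)%N) (d_gt0 : (0 < d)%N) (degA : m = (n ^ 2)%N).
Variables (K : fieldType) (phi : {rmorphism F -> K}).
Hypothesis K_splits : splits A n phi.

Lemma split_extension (L : fieldType) (psi : {rmorphism F -> L}) :
  exists (M : fieldType) (k : {rmorphism L -> M}) e
    (x y : 'I_n -> scext A (k \o psi)), split_data e x y.
Proof.
(* Only the splitting field is wanted here, so the family [X] is taken empty. *)
have [|E [psiE [cE _ [e [x [y sd]]]]]] :=
  exists_splitting 0 n_gt0 degA K_splits (X := fun _ _ _ => False).
  by [].
have [M [k [l kl]]] := cE L psi; exists M, k.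
have rhoE a : (k \o psi) a = l (psiE a) by rewrite /= kl.
exists (scmap (k \o psi) l e), (fun i => scmap (k \o psi) l (x i)).
exists (fun i => scmap (k \o psi) l (y i)).
exact: (scmap_split_data (psi := k \o psi) rhoE sd).
Qed.

(** Checked over a split extension; it makes the integer division in [rrank] exact. *)
Lemma right_ideal_dvdn (L : fieldType) (psi : {rmorphism F -> L})
    (J : {vspace scext A psi}) : right_ideal J -> (n %| \dim J)%N.
Proof.
move=> rJ; have [M [k [e [x [y sd]]]]] := split_extension psi.
have kE a : (k \o psi) a = k (psi a) by [].
rewrite -(dim_scspan kE) (split_right_ideal_dim sd); first exact: dvdn_mulr.
exact: scspan_right_ideal.
Qed.

Lemma SB_dim (L : fieldType) (psi : {rmorphism F -> L}) (J : {vspace scext A psi}) :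
  SB n d J <-> right_ideal J /\ \dim J = (d * n)%N.
Proof.
split=> -[rJ dJ]; split=> //; last by rewrite /rrank dJ mulnK.
by rewrite -dJ /rrank divnK // right_ideal_dvdn.
Qed.

Variables (conds : seq (nat * nat)) (I : nat -> {vspace A}).
Hypothesis I_ideal : forall p, p \in conds -> right_ideal (I p.2).
Hypothesis conds_le : forall p, p \in conds -> (p.1 <= d)%N.
Hypothesis I_mono : forall p q, p \in conds -> q \in conds ->
  (p.1 <= q.1)%N -> (I p.2 <= I q.2)%VS.

Definition flag_variety (L : fieldType) (psi : {rmorphism F -> L})
    (J : {vspace scext A psi}) :=
  SB n d J /\ forall p, p \in conds ->
    (p.1 <= rrank n (J :&: extend_vs psi (I p.2)))%N.

Lemma flag_variety_ext (L M : fieldType) (psi : {rmorphism F -> L})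
    (rho : {rmorphism F -> M}) (tau : {rmorphism L -> M}) :
    (forall x, rho x = tau (psi x)) ->
  forall J : {vspace scext A psi},
  flag_variety J -> flag_variety (scspan rho tau J).
Proof.
move=> rhoE J [[rJ dJ] cJ]; split.
  by split; [apply: scspan_right_ideal | rewrite /rrank (dim_scspan rhoE)].
move=> p pc; rewrite -(scspan_extend_vs rhoE) -(scspan_cap rhoE) /rrank.
by rewrite (dim_scspan rhoE); apply: cJ.
Qed.

Section SplitParam.
Variables (E : fieldType) (psi : {rmorphism F -> E}).
Local Notation B := (scext A psi).
Variables (e : B) (x y : 'I_n -> B).
Hypothesis sd : split_data e x y.

(** In terms of [J e], of dimension [d], a condition [(j, a)] asks that the first [j] vectors of a
    suitable basis lie in [W (j, a)]. Hence [U i] is where the vector of index [i], counted from 0,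
    may vary; it is [B e] if no condition bears on it. *)
Let W (p : nat * nat) : {vspace B} := (extend_vs psi (I p.2) * <[e]>)%VS.
Let U i : {vspace B} :=
  (\big[capv/(fullv * <[e]>)]_(p <- conds | (i < p.1)%N) W p)%VS.

Let endmx (f : 'End(B)) : 'M[E]_m :=
  \matrix_(c, j) (f (delta_mx 0 c : 'rV_m) : 'rV_m) 0 j.

Let Qrow (r : 'I_(d * n)) : 'I_d.
Proof. by exists (r %/ n)%N; rewrite ltn_divLR. Defined.

Let Qcol (r : 'I_(d * n)) : 'I_n.
Proof. by exists (r %% n)%N; rewrite ltn_mod. Defined.

(** The parameters are [d] arbitrary elements of [B]. For [r = i * n + l], the [i]-th is projected
    to [U i] and multiplied by [y l]; for fixed [i] these products span the right ideal of the
    projection. Projecting, instead of choosing bases of the [U i], keeps all blocks of the same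
    size. *)
Definition flag_param (r : 'I_(d * n)) : 'M[E]_(d * m, m) :=
  (\matrix_(a, c) (a == mxvec_index (Qrow r) c)%:R) *m
  endmx (projv (U (Qrow r))) *m endmx (amulr (y (Qcol r))).

Section Param.
Variables (M : fieldType) (tau : {rmorphism E -> M}) (rho : {rmorphism F -> M}).
Hypothesis rhoE : forall a, rho a = tau (psi a).
Local Notation B' := (scext A rho).
Local Notation sm := (@scmap F A E M psi rho tau).
Let sd' := scmap_split_data rhoE sd.
Let wd' := sd'.1.
Local Notation e' := (sm e).
Local Notation y' := (fun l => sm (y l)).

Let apmx (f : 'End(B)) (u : B') : B' := (u : 'rV_m) *m map_mx tau (endmx f).

Lemma apmxE f u : apmx f u = \sum_c (u : 'rV_m) 0 c *: sm (f (delta_mx 0 c : 'rV_m)).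
Proof.
apply/rowP => j; rewrite summxE mxE; apply: eq_bigr => c _.
by rewrite !mxE.
Qed.

Lemma rowE' (u : B') : u = \sum_c (u : 'rV_m) 0 c *: (delta_mx 0 c : 'rV_m).
Proof. exact: row_sum_delta. Qed.

Lemma apmx_sm f v : apmx f (sm v) = sm (f v).
Proof.
rewrite apmxE [in RHS](row_sum_delta v) linear_sum scmap_sum; apply: eq_bigr => c _.
by rewrite linearZ scmapZ !mxE.
Qed.

Lemma apmx_mul z u : apmx (amulr z) u = u * sm z.
Proof.
rewrite apmxE [in RHS](rowE' u) mulr_suml; apply: eq_bigr => c _.
rewrite amulrE scmapM // -scalerAl; congr (_ *: (_ * _)).
by apply/rowP => j; rewrite !mxE rmorph_nat.
Qed.

Lemma apmx_proj_mem S u : apmx (projv S) u \in scspan rho tau S.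
Proof.
rewrite apmxE; apply: memv_suml => c _; apply: memvZ; apply: mem_scspan.
exact: memv_proj.
Qed.

Lemma apmx_proj_id S u : u \in scspan rho tau S -> apmx (projv S) u = u.
Proof.
move=> uS; rewrite {2}(coord_span (X := in_tuple _) uS).
rewrite {1}(coord_span (X := in_tuple _) uS).
rewrite /apmx mulmx_suml; apply: eq_bigr => c _; rewrite -scalemxAl; congr (_ *: _).
have /mapP[v vS ->] : (in_tuple (map sm (vbasis S)))`_c \in map sm (vbasis S).
  exact: mem_nth.
by rewrite -[LHS]/(apmx _ (sm v)) apmx_sm projv_id // vbasis_mem.
Qed.

Lemma flag_param_tuple (T : 'rV[M]_(d * m)) r :
  tnth (param_tuple flag_param tau rho T) r =
  apmx (projv (U (Qrow r))) (\row_c T 0 (mxvec_index (Qrow r) c)) * sm (y (Qcol r)).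
Proof.
rewrite tnth_mktuple -apmx_mul /apmx /flag_param !map_mxM !mulmxA.
congr (_ *m _ *m _); apply/rowP => c; rewrite !mxE.
rewrite (bigD1 (mxvec_index (Qrow r) c)) //= !mxE eqxx rmorph1 mulr1 big1 ?addr0 // => a ac.
by rewrite !mxE (negPf ac) rmorph0 mulr0.
Qed.

Lemma row_gen v b : v * e' = v -> v * b \in <<[seq (v * sm (y l))%R | l <- enum 'I_n]>>%VS.
Proof.
move=> ve; have bE : b = \sum_l b * (sm (x l) * sm (y l)).
  by rewrite -[RHS]mulr_sumr (wd_xy wd') mulr1.
rewrite -ve -mulrA bE [e' * _]mulr_sumr [v * _]mulr_sumr.
apply: memv_suml => l _.
have [c cE] := split_corner_scalar n_gt0 sd' (b * sm (x l)).
have {}cE : e' * (b * sm (x l)) = c *: e' by rewrite -cE -!mulrA (wd_xe wd').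
have -> : v * (e' * (b * (sm (x l) * sm (y l)))) = c *: (v * sm (y l)).
  rewrite [b * _]mulrA [e' * _]mulrA cE -scalerAl -scalerAr; congr (_ *: (v * _)).
  exact: (wd_ey wd').
by apply/memvZ/memv_span/mapP; exists l; rewrite ?ve ?mem_enum.
Qed.

Lemma row_span_ideal (w : d.-tuple B') (b : (d * n).-tuple B') :
    (forall i, tnth w i * e' = tnth w i) ->
    (forall r, tnth b r = tnth w (Qrow r) * sm (y (Qcol r))) ->
  <<b>>%VS = (<<w>> * fullv)%VS.
Proof.
move=> we bE; apply: subv_anti; apply/andP; split.
  apply/span_subvP => _ /tnthP[r ->].
  by rewrite bE memv_mul ?memvf // memv_span // mem_tnth.
apply/prodvP => u v uw _; rewrite (coord_span uw) mulr_suml.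
apply: memv_suml => i _; rewrite -scalerAl memvZ // -tnth_nth.
apply: (subvP _ _ (row_gen v (we i))); apply/span_subvP => _ /mapP[l _ ->].
have ltr : (i * n + l < d * n)%N.
  apply: (@leq_trans (i * n + n)); first by rewrite ltn_add2l.
  by rewrite addnC -mulSn leq_mul2r ltn_ord orbT.
apply: memv_span; apply/tnthP; exists (Ordinal ltr); rewrite bE.
congr (tnth w _ * sm (y _)); apply/val_inj => /=.
  by rewrite divnMDl // divn_small ?addn0.
by rewrite modnMDl modn_small.
Qed.

Lemma param_in_U T i :
  apmx (projv (U i)) T \in scspan rho tau (U i).
Proof. exact: apmx_proj_mem. Qed.

Lemma scspan_U i : scspan rho tau (U i) =
  (\big[capv/(fullv * <[e']>)]_(p <- conds | (i < p.1)%N) (extend_vs rho (I p.2) * <[e']>))%VS.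
Proof.
rewrite /U (big_morph (scspan rho tau) (scspan_cap rhoE) (erefl _)).
rewrite (scspan_prod rhoE) (scspan_full _ rhoE) scspan_line.
apply: eq_bigr => p _.
by rewrite (scspan_prod rhoE) (scspan_extend_vs rhoE) scspan_line.
Qed.

Lemma mem_scspan_U i v : v \in scspan rho tau (U i) <->
  v * e' = v /\ forall p, p \in conds -> (i < p.1)%N ->
    v \in (extend_vs rho (I p.2) * <[e']>)%VS.
Proof.
have e'e' := wd_idem wd'.
rewrite scspan_U; elim: conds => [|p s IH].
  rewrite big_nil; split=> [/memv_liner[u _ ->]|[ve _]].
    by split=> //; rewrite -mulrA e'e'.
  by apply/memv_liner; exists v; rewrite ?memvf.
rewrite big_cons; case: ifP => [ip|ip]; last first.
  rewrite IH; split=> -[ve h]; split=> // q; last first.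
    by move=> qs; apply: h; rewrite inE qs orbT.
  by rewrite inE => /predU1P[->|]; [rewrite ip | apply: h].
rewrite memv_cap; split=> [/andP[vp /IH[ve h]]|[ve h]].
  by split=> // q; rewrite inE => /predU1P[->|] //; apply: h.
apply/andP; split; first by apply: h => //; rewrite mem_head.
by apply/IH; split=> // q qs; apply: h; rewrite inE qs orbT.
Qed.

Lemma flag_param_sound T : free (param_tuple flag_param tau rho T) ->
  flag_variety <<param_tuple flag_param tau rho T>>%VS.
Proof.
set b := param_tuple _ _ _ _ => fb.
pose w := [tuple apmx (projv (U i)) (\row_c T 0 (mxvec_index i c)) | i < d].
have wU i : tnth w i \in scspan rho tau (U i).
  by rewrite tnth_mktuple; apply: param_in_U.
have we i : tnth w i * e' = tnth w i by have /mem_scspan_U[] := wU i.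
have bE r : tnth b r = tnth w (Qrow r) * sm (y (Qcol r)).
  by rewrite flag_param_tuple tnth_mktuple.
split.
  apply/SB_dim; split; first by rewrite (row_span_ideal we bE); apply: right_ideal_mulf.
  by move/eqP: fb => ->; rewrite size_tuple.
move=> p pc; have pd := conds_le pc.
rewrite /rrank leq_divRL //.
have lt_pd : (p.1 * n <= size b)%N by rewrite size_tuple leq_mul2r pd orbT.
have ft : free (take (p.1 * n) b).
  by apply: (catl_free (Y := drop (p.1 * n) b)); rewrite cat_take_drop.
have dt : \dim <<take (p.1 * n) b>> = (p.1 * n)%N.
  by move/eqP: ft => ->; rewrite size_takel.
rewrite -{1}dt; apply: dimvS; rewrite subv_cap; apply/andP; split.
  by apply: sub_span => u; apply: mem_take.
apply/span_subvP => u /(nthP 0)[r]; rewrite size_takel // => ltr.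
rewrite nth_take // => <-; have ltr' : (r < d * n)%N.
  by apply: leq_trans ltr _; rewrite leq_mul2r pd orbT.
rewrite -[r]/(val (Ordinal ltr')) -tnth_nth bE.
have rI : right_ideal (extend_vs rho (I p.2)).
  by apply/extend_vs_right_ideal/I_ideal.
move/right_idealP: rI => rI; apply: (rI).
have /mem_scspan_U[_ /(_ p pc)] := wU (Qrow (Ordinal ltr')).
rewrite /= ltn_divLR // => /(_ ltr) /memv_liner[v vI ->].
exact: rI.
Qed.

Lemma flag_param_surj (J : {vspace B'}) : flag_variety J ->
  exists T, basis_of J (param_tuple flag_param tau rho T).
Proof.
move=> [/SB_dim[rJ dJ] cJ].
have rJ' := proj1 (right_idealP J) rJ.
have dW : \dim (J * <[e']>) = d.
  apply/eqP; rewrite -(eqn_pmul2l n_gt0) -(split_right_ideal_dim sd' rJ) dJ.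
  by rewrite mulnC.
pose G (p : nat * nat) := ((J :&: extend_vs rho (I p.2)) * <[e']>)%VS.
have rG p : p \in conds -> right_ideal (J :&: extend_vs rho (I p.2)).
  by move=> pc; apply: right_ideal_cap => //; apply/extend_vs_right_ideal/I_ideal.
have [||w [wW wG]] := @adapted_basis _ _ (J * <[e']>)%VS [seq (p.1, G p) | p <- conds].
- move=> _ /mapP[p pc ->] /=; split; last by apply: prodvSl; apply: capvSl.
  have := cJ _ pc; rewrite /rrank (split_right_ideal_dim sd' (rG p pc)).
  by rewrite mulKn.
- move=> _ _ /mapP[p pc ->] /mapP[q qc ->] /= le_pq; apply: prodvSl.
  by rewrite subv_cap capvSl /=; apply: subv_trans (capvSr _ _) _;
    apply/extend_vsS/I_mono.
move: w wW wG; rewrite dW => w wW wG.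
pose T := mxvec (\matrix_(i < d, c < m) (tnth w i : 'rV_m) 0 c).
have TE i : \row_c T 0 (mxvec_index i c) = tnth w i.
  by apply/rowP => c; rewrite mxE mxvecE mxE.
have we i : tnth w i * e' = tnth w i.
  have : tnth w i \in (J * <[e']>)%VS by rewrite (basis_mem wW) // mem_tnth.
  by move=> /memv_liner[v _ ->]; rewrite -mulrA (wd_idem wd').
have wU i : tnth w i \in scspan rho tau (U i).
  apply/mem_scspan_U; split=> // p pc ip.
  have : tnth w i \in G p.
    rewrite (tnth_nth 0); apply: (wG (p.1, G p)) => //.
    by apply/mapP; exists p.
  by apply: subvP; apply: prodvSl; apply: capvSr.
pose b := param_tuple flag_param tau rho T.
have bE r : tnth b r = tnth w (Qrow r) * sm (y (Qcol r)).
  by rewrite flag_param_tuple TE apmx_proj_id.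
exists T; rewrite basisEdim size_tuple dJ leqnn andbT.
rewrite -/b (row_span_ideal we bE) (span_basis wW).
apply/subvP => u uJ; rewrite -[u]mulr1 -(wd_xy wd') mulr_sumr.
apply: memv_suml => l _.
have -> : u * (sm (x l) * sm (y l)) = u * sm (x l) * e' * sm (y l).
  by rewrite -[u * sm (x l) * e']mulrA (wd_xe wd') mulrA.
apply: memv_mul; rewrite ?memvf //.
by apply: memv_mul; rewrite ?memv_line // rJ'.
Qed.

End Param.
End SplitParam.

Local Notation VI := (vanish_ideal (n := n) (d := d) flag_variety).

(** Over the composite [M] of [L] with a splitting field [E], the parametrization brings the ideal
    down to [E], and the tower brings it from [E] to [F]. [vanish_ideal_meet] then passes from [M]
    to [L]. *)
Lemma flag_variety_descends (L : fieldType) (psi : {rmorphism F -> L}) :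
  forall g, VI psi g -> in_ext psi (VI (idfun : {rmorphism F -> F})) g.
Proof.
have dn_gt0 : (0 < d * n)%N by rewrite muln_gt0 d_gt0.
have [E [psiE [cE dE [e [x [y sd]]]]]] :=
  exists_splitting d n_gt0 degA K_splits flag_variety_ext.
have [M [k [l kl]]] := cE L psi.
have rhoE a : (k \o psi) a = k (psi a) by [].
have rhoE' a : (k \o psi) a = l (psiE a) by rewrite /= kl.
apply: (vanish_ideal_meet (rho := k \o psi) (k := k)) => // g vg.
apply: (in_ext_trans (tau := psiE) (ups := l) _ _ dE) => //.
  exact: vanish_ideal0.
apply: (vanish_ideal_param (Q := flag_param e y) dn_gt0 _ _ rhoE' vg).
  by move=> M' t rho T e'; apply: (flag_param_sound sd).
by move=> M' t rho J e'; apply: (flag_param_surj sd).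
Qed.

End FlagVariety.

(** * The index *)

(** [U] is a right vector space over [D]: a stable proper subspace [W] is enlarged by some [x D],
    which meets [W] trivially and has the dimension of [D], because each nonzero [d] acts
    invertibly. *)
Lemma division_module_dim (F : fieldType) (D : falgType F) (V : vectType F)
    (U : {vspace V}) (act : D -> V -> V) : division_algebra D ->
    (forall c a b v, act (c *: a + b) v = c *: act a v + act b v) ->
    (forall c d u v, act d (c *: u + v) = c *: act d u + act d v) ->
    (forall a b v, act (a * b) v = act b (act a v)) ->
    (forall v, v \in U -> act 1 v = v) ->
    (forall d v, v \in U -> act d v \in U) ->
  (\dim {:D} %| \dim U)%N.
Proof.
move=> D_div actDl actDr actM act1 actU.
have ext k : exists W : {vspace V}, [/\ (W <= U)%VS,
    (forall d v, v \in W -> act d v \in W), (\dim {:D} %| \dim W)%N &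
    W = U \/ (k <= \dim W)%N].
  elim: k => [|k [W [WU actW dW kW]]].
    exists 0%VS; rewrite sub0v dimv0 dvdn0; split=> //; last by right.
    move=> d v; rewrite memv0 => /eqP->; have := actDr (-1) d 0 0.
    by rewrite scaler0 add0r scaleN1r addNr => ->; apply: mem0v.
  have [WE|WN] := eqVneq W U; first by exists W; split=> //; left.
  have {kW} kW : (k <= \dim W)%N by case: kW => // WE; rewrite WE eqxx in WN.
  have /subvPn[x xU xW] : ~~ (U <= W)%VS.
    by apply: contra WN => UW; rewrite eqEsubv WU.
  have invW d : act d x \in W -> d = 0.
    move=> dxW; apply/eqP/negPn/negP => dN0; case/negP: xW.
    rewrite -[x]act1 // -(mulrV (D_div d dN0)) actM; exact: actW.
  have linx : linear (fun d => act d x) by move=> c a b; apply: actDl.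
  pose fL := GRing.isLinear.Build F D V _ (fun d => act d x) linx.
  pose f : {linear D -> V} := HB.pack (fun d => act d x) fL.
  have fE d : linfun f d = act d x by rewrite lfunE.
  have capW : (W :&: limg (linfun f) = 0)%VS.
    apply/eqP; rewrite -subv0; apply/subvP => v; rewrite memv_cap memv0.
    move=> /andP[vW /memv_imgP[d _ vE]]; move: vW; rewrite vE fE.
    by move/invW->; rewrite -(fE 0) linear0.
  have dimx : \dim (limg (linfun f)) = \dim {:D}.
    apply: limg_dim_eq; apply/eqP; rewrite -subv0; apply/subvP => d.
    rewrite memv_cap memv_ker memv0 fE => /andP[_ /eqP d0].
    by apply/eqP/invW; rewrite d0 mem0v.
  exists (W + limg (linfun f))%VS; split.
  - rewrite subv_add WU; apply/subvP => v /memv_imgP[d _ ->].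
    by rewrite fE actU.
  - move=> d v /memv_addP[w wW [_ /memv_imgP[b _ ->] ->]].
    rewrite -[w]scale1r actDr scale1r memv_add ?actW // fE -actM -fE.
    by rewrite memv_img ?memvf.
  - by rewrite dimv_disjoint_sum // dvdn_add // dimx.
  right; rewrite dimv_disjoint_sum // dimx -addn1 leq_add //.
  by rewrite dimvf FalgType_proper.
have [W [WU _ dW]] := ext (\dim U).+1.
by case=> [<-//|/leq_trans/(_ (dimvS WU))]; rewrite ltnn.
Qed.

Section MatrixActions.
Variables (F : fieldType) (A : falgType F) (p : nat).
Local Notation V := {ffun 'I_p -> A}.

(** Matrices act on rows from the right, which preserves the rows with entries in a given right
    ideal, and on columns from the left, which commutes with right multiplication by [A]. The first
    action constrains the dimensions of right ideals, the second produces a small one. *)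
Definition rowact (X : 'M[A]_p) (v : V) : V := [ffun j => \sum_i v i * X i j].
Definition colact (X : 'M[A]_p) (v : V) : V := [ffun i => \sum_j X i j * v j].

Fact rowact_linear X : linear (rowact X).
Proof.
move=> c u v; apply/ffunP => j; rewrite !ffunE scaler_sumr -big_split /=.
by apply: eq_bigr => i _; rewrite !ffunE mulrDl scalerAl.
Qed.

Fact colact_linear X : linear (colact X).
Proof.
move=> c u v; apply/ffunP => j; rewrite !ffunE scaler_sumr -big_split /=.
by apply: eq_bigr => i _; rewrite !ffunE mulrDr scalerAr.
Qed.

HB.instance Definition _ X :=
  GRing.isLinear.Build F V V _ (rowact X) (rowact_linear X).
HB.instance Definition _ X :=
  GRing.isLinear.Build F V V _ (colact X) (colact_linear X).

Lemma rowactM X Y v : rowact (X *m Y) v = rowact Y (rowact X v).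
Proof.
apply/ffunP => j; rewrite !ffunE.
under eq_bigr => i _ do rewrite !mxE mulr_sumr.
under [RHS]eq_bigr => i _ do rewrite ffunE mulr_suml.
rewrite exchange_big; apply: eq_bigr => i _; apply: eq_bigr => k _.
by rewrite mulrA.
Qed.

Lemma colactM X Y v : colact (X *m Y) v = colact X (colact Y v).
Proof.
apply/ffunP => j; rewrite !ffunE.
under eq_bigr => i _ do rewrite !mxE mulr_suml.
under [RHS]eq_bigr => i _ do rewrite ffunE mulr_sumr.
rewrite exchange_big; apply: eq_bigr => i _; apply: eq_bigr => k _.
by rewrite mulrA.
Qed.

Lemma rowact1 v : rowact 1%:M v = v.
Proof.
apply/ffunP => j; rewrite ffunE (bigD1 j) //= !mxE eqxx mulr1 big1 ?addr0 //.
by move=> i ij; rewrite !mxE (negPf ij) mulr0.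
Qed.

Lemma colact1 v : colact 1%:M v = v.
Proof.
apply/ffunP => j; rewrite ffunE (bigD1 j) //= !mxE eqxx mul1r big1 ?addr0 //.
by move=> i ij; rewrite !mxE eq_sym (negPf ij) mul0r.
Qed.

Lemma rowact_lin c X Y v :
  rowact ((c%:A : A) *: X + Y) v = c *: rowact X v + rowact Y v.
Proof.
apply/ffunP => j; rewrite !ffunE scaler_sumr -big_split /=.
by apply: eq_bigr => i _; rewrite !mxE mulrDr mulr_algl scalerAr.
Qed.

Lemma colact_lin c X Y v :
  colact ((c%:A : A) *: X + Y) v = c *: colact X v + colact Y v.
Proof.
apply/ffunP => j; rewrite !ffunE scaler_sumr -big_split /=.
by apply: eq_bigr => i _; rewrite !mxE mulrDl mulr_algl scalerAl.
Qed.

Definition ffeval (k : 'I_p) (v : V) : A := v k.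
Definition ffinj (k : 'I_p) (a : A) : V := [ffun i => if i == k then a else 0].

Fact ffeval_linear k : linear (ffeval k).
Proof. by move=> c u v; rewrite /ffeval !ffunE. Qed.

Fact ffinj_linear k : linear (ffinj k).
Proof.
move=> c u v; apply/ffunP => i; rewrite !ffunE.
by case: eqP => _ //; rewrite scaler0 addr0.
Qed.

HB.instance Definition _ k :=
  GRing.isLinear.Build F V A _ (ffeval k) (ffeval_linear k).
HB.instance Definition _ k :=
  GRing.isLinear.Build F A V _ (ffinj k) (ffinj_linear k).

Definition ffspace (I : {vspace A}) : {vspace V} :=
  (\bigcap_k (linfun (ffeval k) @^-1: I))%VS.

Lemma mem_ffspace (I : {vspace A}) (v : V) : reflect (forall k, v k \in I) (v \in ffspace I).
Proof.
apply: (iffP idP) => [vI k|vI].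
  have : v \in (linfun (ffeval k) @^-1: I)%VS.
    by apply: subvP vI; apply: bigcapv_inf.
  by rewrite -memv_preim lfunE.
rewrite memvE; apply/subv_bigcapP => k _; rewrite -memvE -memv_preim lfunE.
exact: vI.
Qed.

Lemma dim_ffspace I : \dim (ffspace I) = (p * \dim I)%N.
Proof.
apply: (dim_pieces (a := fun k => linfun (ffeval k)) (b := fun k => linfun (ffinj k))).
- by move=> k u /mem_ffspace uI; rewrite lfunE; apply: uI.
- move=> k w wI; apply/mem_ffspace => i; rewrite lfunE /= ffunE.
  by case: eqP => // _; apply: mem0v.
- move=> u _; apply/ffunP => i; rewrite sum_ffunE (bigD1 i) //= !lfunE /= ffunE eqxx.
  by rewrite big1 ?addr0 // => k ki; rewrite !lfunE /= ffunE eq_sym (negPf ki).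
by move=> k l w _; rewrite !lfunE /= /ffeval ffunE; case: eqP.
Qed.

Lemma dim_ffun : \dim {:V} = (p * \dim {:A})%N.
Proof.
have <- : ffspace fullv = fullv.
  by apply/eqP; rewrite eqEsubv subvf /=; apply/subvP => v _; apply/mem_ffspace
    => k; apply: memvf.
exact: dim_ffspace.
Qed.

End MatrixActions.

Section MatrixUnits.
Variables (F : fieldType) (A : falgType F) (p q : nat).
Local Notation V := {ffun 'I_p -> A}.
Variable u : 'I_q.+1 -> 'I_q.+1 -> 'M[A]_p.
Hypothesis uM : forall i j k l, u i j *m u k l = if j == k then u i l else 0.
Hypothesis u1 : \sum_k u k k = 1%:M.

Lemma rowact0 v : rowact 0 v = 0 :> V.
Proof. by have := rowact_lin (-1) 0 0 v; rewrite scaler0 add0r scaleN1r addNr. Qed.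

Lemma colact0 v : colact 0 v = 0 :> V.
Proof. by have := colact_lin (-1) 0 0 v; rewrite scaler0 add0r scaleN1r addNr. Qed.

Lemma rowact_sum (I : Type) (r : seq I) (P : pred I) (X : I -> 'M[A]_p) (v : V) :
  rowact (\sum_(i <- r | P i) X i) v = \sum_(i <- r | P i) rowact (X i) v.
Proof.
apply: (big_morph (fun X => rowact X v)); last exact: rowact0.
by move=> Y Z; have := rowact_lin 1 Y Z v; rewrite !scale1r.
Qed.

Lemma colact_sum (I : Type) (r : seq I) (P : pred I) (X : I -> 'M[A]_p) (v : V) :
  colact (\sum_(i <- r | P i) X i) v = \sum_(i <- r | P i) colact (X i) v.
Proof.
apply: (big_morph (fun X => colact X v)); last exact: colact0.
by move=> Y Z; have := colact_lin 1 Y Z v; rewrite !scale1r.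
Qed.

Lemma dim_row_unit (U : {vspace V}) :
    (forall X v, v \in U -> rowact X v \in U) ->
  \dim U = (q.+1 * \dim (linfun (rowact (u ord0 ord0)) @: U))%N.
Proof.
move=> rU; apply: (dim_pieces (a := fun k => linfun (rowact (u k ord0)))
  (b := fun k => linfun (rowact (u ord0 k)))).
- move=> k v vU; rewrite lfunE /=.
  have -> : rowact (u k ord0) v = linfun (rowact (u ord0 ord0)) (rowact (u k ord0) v).
    by rewrite lfunE /= -rowactM uM eqxx.
  by rewrite memv_img ?rU.
- by move=> k w /memv_imgP[v vU ->]; rewrite !lfunE /= !rU.
- move=> v _; rewrite -{1}[v]rowact1 -u1 rowact_sum; apply: eq_bigr => k _.
  by rewrite !lfunE /= -rowactM uM eqxx.
move=> k l w /memv_imgP[v vU ->]; rewrite !lfunE /= -!rowactM uM eq_sym.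
by case: eqP => // _; rewrite ?uM ?eqxx // mulmx0 rowact0.
Qed.

Lemma dim_col_unit :
  \dim {:V} = (q.+1 * \dim (limg (linfun (colact (u ord0 ord0)))))%N.
Proof.
apply: (dim_pieces (a := fun k => linfun (colact (u ord0 k)))
  (b := fun k => linfun (colact (u k ord0)))) => [k v vU||v _|k l w].
- rewrite lfunE /=.
  have -> : colact (u ord0 k) v = linfun (colact (u ord0 ord0)) (colact (u ord0 k) v).
    by rewrite lfunE /= -colactM uM eqxx.
  by rewrite memv_img ?memvf.
- by move=> *; apply: memvf.
- rewrite -{1}[v]colact1 -u1 colact_sum; apply: eq_bigr => k _.
  by rewrite !lfunE /= -colactM uM eqxx.
move=> /memv_imgP[v vU ->]; rewrite !lfunE /= -!colactM uM.
by case: eqP => // _; rewrite ?uM ?eqxx // ?mul0mx ?colact0.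
Qed.

End MatrixUnits.

Section BrauerIndex.
Variables (F : fieldType) (A D : falgType F) (n i : nat).
Hypotheses (n_gt0 : (0 < n)%N) (degA : \dim {:A} = (n ^ 2)%N).
Hypotheses (D_div : division_algebra D) (degD : \dim {:D} = (i ^ 2)%N).
Variables (p q : nat) (f : {rmorphism 'M[A]_p.+1 -> 'M[D]_q.+1}).
Variable g : 'M[D]_q.+1 -> 'M[A]_p.+1.
Hypotheses (fK : cancel f g) (gK : cancel g f).
Hypothesis fZ : forall (c : F) X, f ((c%:A : A) *: X) = (c%:A : D) *: f X.

Let gM X Y : g (X *m Y) = g X *m g Y.
Proof.
apply: (can_inj fK); rewrite gK -[_ *m g Y]/(g X * g Y) rmorphM !gK.
by [].
Qed.

Let gD X Y : g (X + Y) = g X + g Y.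
Proof. by apply: (can_inj fK); rewrite gK rmorphD !gK. Qed.

Let gZ c X : g ((c%:A : D) *: X) = (c%:A : A) *: g X.
Proof. by apply: (can_inj fK); rewrite gK fZ gK. Qed.

Let g0 : g 0 = 0. Proof. by apply: (can_inj fK); rewrite gK rmorph0. Qed.
Let g1 : g 1%:M = 1%:M.
Proof. by apply: (can_inj fK); rewrite gK; apply: esym (rmorph1 f). Qed.

Let u j k := g (delta_mx j k).

Let uM j k l m : u j k *m u l m = if k == l then u j m else 0.
Proof.
rewrite /u -gM; case: eqP => [->|/eqP kl]; first by rewrite mul_delta_mx.
by rewrite mul_delta_mx_0.
Qed.

Let u1 : \sum_k u k k = 1%:M.
Proof.
rewrite -(big_morph g gD g0) -g1; congr (g _).
apply/matrixP => j k; rewrite summxE (bigD1 j) //= !mxE eqxx.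
by rewrite big1 ?addr0 1?eq_sym // => l lj; rewrite mxE eq_sym (negPf lj).
Qed.

Lemma brauer_dim_eq : (p.+1 * n = q.+1 * i)%N.
Proof.
have dim_le (B C : falgType F) s t (h : 'M[B]_s -> 'M[C]_t) : injective h ->
    (forall c X Y, h ((c%:A : B) *: X + Y) = (c%:A : C) *: h X + h Y) ->
    (s * s * \dim {:B} <= t * t * \dim {:C})%N.
  move=> h_inj hL.
  pose VB := {ffun 'I_s * 'I_s -> B}; pose VC := {ffun 'I_t * 'I_t -> C}.
  pose mB (v : VB) : 'M[B]_s := \matrix_(j, k) v (j, k).
  pose h' (v : VB) : VC := [ffun jk => h (mB v) jk.1 jk.2].
  have h'L : linear h'.
    move=> c v w; apply/ffunP => jk; rewrite !ffunE.
    have -> : mB (c *: v + w) = (c%:A : B) *: mB v + mB w.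
      by apply/matrixP => j k; rewrite !mxE !ffunE mulr_algl.
    by rewrite hL !mxE mulr_algl.
  pose hl : {linear VB -> VC} := HB.pack h' (GRing.isLinear.Build F VB VC _ h' h'L).
  have h'I : injective h'.
    move=> v w /ffunP e; have : mB v = mB w.
      by apply: h_inj; apply/matrixP => j k; have := e (j, k); rewrite !ffunE.
    by move=> /matrixP e'; apply/ffunP => -[j k]; have := e' j k; rewrite !mxE.
  have : (\dim {:VB} <= \dim {:VC})%N.
    rewrite -(limg_dim_eq (f := linfun hl)); first exact/dimvS/subvf.
    apply/eqP; rewrite -subv0; apply/subvP => v; rewrite memv_cap memv_ker lfunE memv0.
    by move=> /andP[_ /eqP hv]; apply/eqP/h'I; rewrite [RHS](linear0 hl).
  by rewrite !dimvf /dim /= !card_prod !card_ord.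
have le1 : (p.+1 * p.+1 * \dim {:A} <= q.+1 * q.+1 * \dim {:D})%N.
  apply: (dim_le _ _ _ _ f) => [|c X Y]; first exact: can_inj fK.
  by rewrite rmorphD fZ.
have le2 : (q.+1 * q.+1 * \dim {:D} <= p.+1 * p.+1 * \dim {:A})%N.
  apply: (dim_le _ _ _ _ g) => [|c X Y]; first exact: can_inj gK.
  by rewrite gD gZ.
apply/eqP; rewrite -eqn_sqr !expnMn -degA -degD -!mulnn eqn_leq.
by rewrite le1 le2.
Qed.

(** [D] acts on [U0], the part of the rows over [I] cut out by one diagonal matrix unit, so [i ^ 2]
    divides [\dim U0]. The claim follows from [p.+1 * \dim I = q.+1 * \dim U0] and
    [p.+1 * n = q.+1 * i]. *)
Lemma brauer_dvd (I : {vspace A}) : right_ideal I -> (n * i %| \dim I)%N.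
Proof.
move=> /right_idealP rI; pose U := ffspace p.+1 I.
have rU (X : 'M[A]_p.+1) v : v \in U -> rowact X v \in U.
  move=> /mem_ffspace vI; apply/mem_ffspace => k; rewrite ffunE.
  by apply: memv_suml => l _; apply: rI.
have dU := dim_row_unit uM u1 rU; rewrite dim_ffspace in dU.
set U0 := (_ @: U)%VS in dU.
have U0E v : v \in U0 -> rowact (u ord0 ord0) v = v.
  by move=> /memv_imgP[w _ ->]; rewrite !lfunE /= -rowactM uM eqxx.
have dD : (\dim {:D} %| \dim U0)%N.
  pose act (d : D) (v : {ffun 'I_p.+1 -> A}) := rowact (g (d *: delta_mx ord0 ord0)) v.
  apply: (division_module_dim (act := act)) => //.
  - move=> c a b v; rewrite /act -rowact_lin; congr (rowact _ v).
    by rewrite -gZ -gD scalerDl scalerA mulr_algl.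
  - by move=> c d v w; rewrite /act linearP.
  - move=> a b v; rewrite /act -rowactM; congr (rowact _ v).
    rewrite -gM; congr (g _); apply/matrixP => j k.
    rewrite !mxE (bigD1 ord0) //= !mxE big1 ?addr0 => [|l l0].
      by rewrite !mulr_natr; case: (j == _); case: (k == _);
        rewrite ?mulr1n ?mulr0n ?mulr0 ?mul0r ?mul0rn.
    by rewrite !mxE (negPf l0) andbF mulr0 mul0r.
  - by move=> v vU; rewrite /act scale1r; apply: U0E.
  move=> d v vU; have -> : act d v = linfun (rowact (u ord0 ord0)) (act d v).
    rewrite lfunE /= /act -rowactM; congr (rowact _ v).
    rewrite /u -gM; congr (g _); rewrite -scalemxAl mul_delta_mx //.
  apply: memv_img; apply: (rU); apply: subvP vU.
  by apply/subvP => w /memv_imgP[w' wU ->]; rewrite lfunE /=; apply: rU.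
rewrite degD in dD.
rewrite -(dvdn_pmul2l (ltn0Sn p)) dU mulnA brauer_dim_eq -mulnA mulnn.
exact: dvdn_mul.
Qed.

(** The columns [N] cut out by a diagonal matrix unit have dimension [n * i] and are stable under
    right multiplication by [A]; so a nonzero coordinate projection of [N] is a right ideal, of
    dimension at most [n * i]. *)
Lemma brauer_ideal : exists2 I : {vspace A}, right_ideal I &
  I != 0%VS /\ (\dim I <= n * i)%N.
Proof.
have dN := dim_col_unit uM u1; set N := limg _ in dN.
rewrite dim_ffun degA in dN.
have dNE : \dim N = (n * i)%N.
  apply/eqP; rewrite -(eqn_pmul2l (ltn0Sn q)) -dN expnS expn1 mulnA brauer_dim_eq.
  by rewrite -!mulnA [(i * n)%N]mulnC.
have NN0 : N != 0%VS.
  rewrite -dimv_eq0 dNE -lt0n muln_gt0 n_gt0 lt0n; apply/eqP => i0.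
  by have := FalgType_proper D; rewrite -dimvf degD i0.
have [v vN [k vk]] : exists2 v, v \in N & exists k, v k != 0.
  exists (vpick N); first exact: memv_pick.
  apply: NNPP => nk; case/negP: NN0; rewrite -vpick0; apply/eqP/ffunP => k.
  by rewrite ffunE; apply/eqP/negPn/negP => vk; apply: nk; exists k.
exists (linfun (ffeval k) @: N)%VS.
  apply/right_idealP => _ a /memv_imgP[w /memv_imgP[w' _ ->] ->]; rewrite !lfunE /=.
  pose w2 : {ffun 'I_p.+1 -> A} := [ffun j => w' j * a].
  have -> : ffeval k (colact (u ord0 ord0) w') * a =
      linfun (ffeval k) (linfun (colact (u ord0 ord0)) w2).
    rewrite !lfunE /= /ffeval !ffunE mulr_suml; apply: eq_bigr => j _.
    by rewrite ffunE mulrA.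
  by apply/memv_img/memv_img/memvf.
split; last by rewrite -dNE -(limg_ker_dim (linfun (ffeval k)) N) leq_addl.
rewrite -subv0; apply/subvPn; exists (linfun (ffeval k) v); first exact: memv_img.
by rewrite memv0 lfunE.
Qed.

End BrauerIndex.

Section IndexExists.
Variables (F : fieldType) (A : falgType F) (n : nat).
Hypotheses (n_gt0 : (0 < n)%N) (degA : \dim {:A} = (n ^ 2)%N).
Hypotheses (A_central : central_algebra A) (A_simple : simple_algebra A).

Section Iso.
Variables (s : nat) (e : A) (x y : 'I_s.+1 -> A).
Hypothesis wd : wdata e x y.
Let D := subvs_of (corner wd).

Let corn a k l : vsval (vsproj (corner wd) (y k * a * x l)) = y k * a * x l.
Proof.
apply: vsprojK; rewrite (corner_memP wd) -!mulrA (wd_xe wd) !mulrA.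
by rewrite (wd_ey wd).
Qed.

(** The Wedderburn isomorphism, on matrices of size 1 over [A] to fit [brauer_equivalent] with
    [p = 0]. *)
Definition corner_mx (X : 'M[A]_1) : 'M[D]_s.+1 :=
  \matrix_(k, l) vsproj (corner wd) (y k * X ord0 ord0 * x l).

Fact corner_mx_zmod : zmod_morphism corner_mx.
Proof.
by move=> X Y; apply/matrixP => k l; rewrite !mxE mulrBr mulrBl linearB.
Qed.

Fact corner_mx_monoid : monoid_morphism corner_mx.
Proof.
split=> [|X Y]; apply/matrixP => k l; apply/val_inj; rewrite !mxE [LHS]corn.
  rewrite eqxx mulr1 (wd_yx wd); case: eqP => _; last by [].
  by rewrite [RHS]corner_one.
rewrite big_ord1 linear_sum /=.
under eq_bigr => j _ do rewrite !mxE /= !corn.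
transitivity (\sum_j y k * X ord0 ord0 * (x j * y j) * (Y ord0 ord0 * x l)).
  by rewrite -mulr_suml -mulr_sumr (wd_xy wd) mulr1 !mulrA.
by apply: eq_bigr => j _; rewrite !mulrA.
Qed.

HB.instance Definition _ := GRing.isZmodMorphism.Build
  'M[A]_1 'M[D]_s.+1 corner_mx corner_mx_zmod.
HB.instance Definition _ := GRing.isMonoidMorphism.Build
  'M[A]_1 'M[D]_s.+1 corner_mx corner_mx_monoid.

Lemma corner_brauer : brauer_equivalent A D.
Proof.
exists 0%N, s, corner_mx; split; last first.
  move=> c X; apply/matrixP => k l; rewrite !mxE !mulr_algl.
  by rewrite -scalerAr -scalerAl linearZ.
exists (fun Y : 'M[D]_s.+1 => const_mx (\sum_k \sum_l x k * vsval (Y k l) * y l)).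
  move=> X; apply/matrixP => a b; rewrite !ord1 mxE.
  rewrite -[RHS]mul1r -(wd_xy wd) mulr_suml; apply: eq_bigr => k _.
  rewrite -[RHS]mulr1 -(wd_xy wd) mulr_sumr; apply: eq_bigr => l _.
  by rewrite mxE corn !mulrA.
move=> Y; apply/matrixP => k l; apply/val_inj; rewrite !mxE [LHS]corn.
rewrite mulr_sumr mulr_suml (bigD1 k) //= mulr_sumr mulr_suml (bigD1 l) //=.
rewrite !mulrA (wd_yx wd) eqxx -mulrA (wd_yx wd) eqxx corner_mem.
rewrite !big1 ?addr0 // => j jk.
  rewrite mulr_sumr mulr_suml big1 // => j' _.
  by rewrite !mulrA (wd_yx wd) eq_sym (negPf jk) !mul0r.
by rewrite -!mulrA (wd_yx wd) (negPf jk) !mulr0.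
Qed.

End Iso.

(** [ind] is a choice, with no known property until some division algebra equivalent to [A] is
    exhibited. The corner of a minimal idempotent is one; its degree is [n] divided by the number of
    matrix units. *)
Lemma is_index_ind : is_index A (ind A).
Proof.
apply: epsilon_spec.
have [e [s [x [y [wd e_min emin]]]]] := simple_wdata A_simple.
case: s x y wd => [|s] x y wd.
  by have := wd_xy wd; rewrite big_ord0 => /esym/eqP; rewrite oner_eq0.
pose D := subvs_of (corner wd).
have dA : (n ^ 2 = s.+1 ^ 2 * \dim {:D})%N.
  by rewrite -degA (wd_dim_left wd) (wd_dim_corner wd) dim_corner mulnA mulnn.
have /dvdnP[i nE] : (s.+1 %| n)%N by rewrite -(@dvdn_pexp2r s.+1 n 2) // dA dvdn_mulr.
exists i, D; split.
- exact: corner_central.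
- exact: corner_division.
- exact: corner_brauer.
apply/eqP; rewrite -(eqn_pmul2l (_ : 0 < s.+1 ^ 2)%N) ?expn_gt0 // -dA nE expnMn.
by rewrite mulnC.
Qed.

Lemma ind_dvd (I : {vspace A}) : right_ideal I -> (n * ind A %| \dim I)%N.
Proof.
move=> rI; have [D [_ D_div [p [q [f [[g fK gK] fZ]]]]] degD] := is_index_ind.
exact: (brauer_dvd degA D_div degD fK gK fZ).
Qed.

Lemma ind_ideal : exists2 I : {vspace A}, right_ideal I & \dim I = (n * ind A)%N.
Proof.
have [D [_ D_div [p [q [f [[g fK gK] fZ]]]]] degD] := is_index_ind.
have [I rI [IN0 dI]] := brauer_ideal n_gt0 degA degD fK gK fZ.
exists I => //; apply/eqP; rewrite eqn_leq dI dvdn_leq ?ind_dvd //.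
by rewrite lt0n dimv_eq0.
Qed.

End IndexExists.

(** * Schubert conditions *)

Section RefineChain.
Variables (E : fieldType) (B : falgType E) (e : B).
Hypotheses (ee : e * e = e) (e_neq0 : e != 0) (e_min : minimal_idem e).
Hypothesis e_gen : (fullv * <[e]> * fullv = fullv :> {vspace B})%VS.
Local Notation dl := (\dim (<[e]> * {:B})).
Variables (t N : nat) (G : nat -> {vspace B}).
Hypothesis t_gt0 : (0 < t)%N.
Hypothesis G_ideal : forall b, (b <= N)%N -> right_ideal (G b).
Hypothesis G_dim : forall b, (b <= N)%N -> \dim (G b) = (b * t * dl)%N.
Hypothesis G_mono : forall b c, (b <= c <= N)%N -> (G b <= G c)%VS.

Lemma minimal_row_gt0 : (0 < dl)%N.
Proof.
rewrite lt0n dimv_eq0; apply: contra e_neq0 => /eqP eB0; rewrite -memv0 -eB0.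
by apply/memv_linel; exists 1; rewrite ?memvf ?mulr1.
Qed.

(** Used twice: to refine [0 <= A] into a chain of right ideals of [A] of step [ind A], then to
    refine the extension of that chain to [K] into a full chain, whose members with index divisible
    by [ind A] are thus defined over [F]. *)
Lemma refine_chain : exists C : nat -> {vspace B},
  [/\ forall j, (j <= N * t)%N -> right_ideal (C j) /\ \dim (C j) = (j * dl)%N,
      forall j, (j < N * t)%N -> (C j <= C j.+1)%VS &
      forall b, (b <= N)%N -> C (b * t)%N = G b].
Proof.
(* The last two clauses keep [C j] between the neighbouring [G b], so that the refined chain passes
   through each of them. *)
pose ok k (C : nat -> {vspace B}) := forall j, (j <= k)%N ->
  [/\ right_ideal (C j), \dim (C j) = (j * dl)%N, (j < k)%N -> (C j <= C j.+1)%VS,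
      forall b, (b <= N)%N -> (b * t <= j)%N -> (G b <= C j)%VS &
      forall b, (b <= N)%N -> (j <= b * t)%N -> (C j <= G b)%VS].
have IH k : (k <= N * t)%N -> exists C, ok k C.
  elim: k => [|k IH] lek.
    exists (fun=> 0%VS) => -[|//] _; split=> //; first exact: right_ideal0.
    - by rewrite dimv0.
    - move=> b bN; rewrite leqn0 muln_eq0 (gtn_eqF t_gt0) orbF => /eqP b0.
      by rewrite subv0 -dimv_eq0 G_dim // b0 mul0n.
    by move=> b _ _; apply: sub0v.
  have [C Cok] := IH (ltnW lek); have [rC dC _ GC CG] := Cok _ (leqnn k).
  pose b := (k %/ t)%N; have bN : (b < N)%N by rewrite ltn_divLR.
  have kb : (k < b.+1 * t)%N by rewrite -ltn_divLR.
  have CGb := CG _ bN (ltnW kb).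
  have CNG : C k != G b.+1.
    apply/eqP => e1; have := G_dim bN; rewrite -e1 dC => /eqP.
    by rewrite eqn_pmul2r ?minimal_row_gt0 // ltn_eqF.
  have [U [rU /andP[CU UG] dU]] :=
    right_ideal_between ee e_min e_gen rC (G_ideal bN) CGb CNG.
  exists (fun j => if (j <= k)%N then C j else U) => j.
  rewrite leq_eqVlt => /predU1P[->|]; last first.
    rewrite ltnS => jk; have [r1 d1 m1 g1 c1] := Cok _ jk.
    rewrite jk; split=> // _; rewrite ltn_neqAle jk andbT.
    by case: eqVneq => [->//|jk'] /=; apply: m1; rewrite ltn_neqAle jk'.
  rewrite ltnn; have dU1 : \dim U = (k.+1 * dl)%N by rewrite dU dC mulSn addnC.
  split=> // [|b' b'N|b' b'N].
  - by rewrite ltnn.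
  - rewrite leq_eqVlt => /predU1P[bk|]; last first.
      by rewrite ltnS => bk; apply: subv_trans CU; apply: GC.
    have bb' : b' = b.+1.
      apply/eqP; rewrite eqn_leq -(leq_pmul2r t_gt0) bk kb /=.
      by rewrite ltn_divLR // bk.
    have /eqP -> : U == G b' by rewrite eqEdim bb' UG /= G_dim // dU1 -bb' bk leqnn.
    exact: subvv.
  move=> kb'; apply: subv_trans UG _; apply: G_mono.
  by rewrite b'N andbT ltn_divLR.
have [C Cok] := IH _ (leqnn _); exists C; split=> [j jN|j jN|b bN].
- by have [? ? _ _ _] := Cok _ jN.
- by have [_ _ ? _ _] := Cok _ (ltnW jN); auto.
have bt : (b * t <= N * t)%N by rewrite leq_mul2r bN orbT.
have [_ _ _ h1 h2] := Cok _ bt.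
by apply: subv_anti; rewrite h1 ?h2.
Qed.

End RefineChain.

Section Partition.
Variables (n d : nat) (lam : d.-tuple nat).
Hypotheses (d_bounds : (1 <= d <= n)%N) (lam_sorted : sorted geq lam).
Hypothesis lam_bound : all (fun x => (x <= n - d)%N) lam.
Local Notation pt := (part lam).
Local Notation s := (schubert_idx n d lam).

Lemma part_le j : (pt j <= n - d)%N.
Proof.
rewrite /part; have [lt|le] := ltnP j.-1 (size lam); last by rewrite nth_default.
exact: (allP lam_bound) (mem_nth _ lt).
Qed.

Lemma part_anti j : (0 < j)%N -> (pt j.+1 <= pt j)%N.
Proof.
case: j => // j _; rewrite /part /=.
have [lt|le] := ltnP j.+1 (size lam); last by rewrite nth_default.
by move/(sortedP 0%N): lam_sorted => /(_ _ lt).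
Qed.

Lemma part_last : pt d.+1 = 0%N.
Proof. by rewrite /part /= nth_default // size_tuple. Qed.

Lemma mem_essential p : p \in essential_set n d lam ->
  [/\ (1 <= p.1 <= d)%N, (pt p.1.+1 < pt p.1)%N & p.2 = s p.1].
Proof.
move=> /mapP[j]; rewrite mem_filter mem_iota add1n ltnS => /andP[lt jd] ->.
by [].
Qed.

Lemma essential_mem j : (1 <= j <= d)%N -> (pt j.+1 < pt j)%N ->
  (j, s j) \in essential_set n d lam.
Proof.
move=> jd lt; apply/mapP; exists j => //.
by rewrite mem_filter lt mem_iota add1n ltnS.
Qed.

Lemma schubert_idx_lt j k : (0 < j)%N -> (j < k)%N -> (s j < s k)%N.
Proof.
move=> j0; elim: k => // k IH; rewrite ltnS leq_eqVlt => /predU1P[<-|jk].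
  rewrite /schubert_idx addnS ltn_subRL; have := part_anti j0.
  have := part_le j; have := part_le j.+1; lia.
apply: ltn_trans (IH jk) _; rewrite /schubert_idx.
have := part_anti (ltn_trans j0 jk); have := part_le k; have := part_le k.+1.
lia.
Qed.

Lemma schubert_idx_bounds j : (1 <= j <= d)%N -> (1 <= s j <= n)%N.
Proof.
rewrite /schubert_idx; have := part_le j; move: d_bounds; lia.
Qed.

Lemma essential_lt p : p \in essential_set n d lam -> (1 <= p.2 < n)%N.
Proof.
move=> /mem_essential[pd lt ->]; rewrite /schubert_idx.
have := part_le p.1; move: d_bounds pd lt; lia.
Qed.

Lemma essential_mono p q : p \in essential_set n d lam ->
  q \in essential_set n d lam -> (p.1 < q.1)%N -> (p.2 < q.2)%N.
Proof.
move=> /mem_essential[/andP[p0 _] _ ->] /mem_essential[_ _ ->].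
exact: schubert_idx_lt.
Qed.

End Partition.

Section SchubertFlag.
Variables (F : fieldType) (A : falgType F) (n : nat).
Local Notation m := (\dim {:A}).
Hypotheses (A_central : central_algebra A) (A_simple : simple_algebra A).
Hypothesis degA : m = (n ^ 2)%N.
Variables (K : fieldType) (phi : {rmorphism F -> K}).
Hypothesis K_splits : splits A n phi.
Variable d : nat.
Hypothesis d_bounds : (1 <= d <= n)%N.
Variable lam : d.-tuple nat.
Hypotheses (lam_sorted : sorted geq lam).
Hypothesis lam_bound : all (fun x => (x <= n - d)%N) lam.

Local Notation E := (essential_set n d lam).
Local Notation s := (schubert_idx n d lam).

Let d_gt0 : (0 < d)%N. Proof. by case/andP: d_bounds. Qed.
Let n_gt0 : (0 < n)%N. Proof. by case/andP: d_bounds => d0; apply: leq_trans. Qed.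
Let dn_gt0 : (0 < d * n)%N. Proof. by rewrite muln_gt0 d_gt0. Qed.

Section WithChain.
Variable C : nat -> {vspace scext A phi}.
Hypothesis C_full : full_chain n C.

Lemma full_chain_dim j : (1 <= j <= n)%N -> \dim (C j) = (j * n)%N.
Proof.
have [Cr _ _] := C_full; move=> /Cr[rC dC].
by rewrite -{2}dC /rrank divnK // (right_ideal_dvdn n_gt0 degA K_splits rC).
Qed.

Lemma full_chain_mono i j : (1 <= i)%N -> (i <= j <= n)%N -> (C i <= C j)%VS.
Proof.
have [_ Cm _] := C_full; move=> i1.
elim: j => [|j IH]; first by rewrite leqn0 => /andP[/eqP i0]; rewrite i0 in i1.
rewrite leq_eqVlt => /andP[/predU1P[->|ij] jn]; first exact: subvv.
apply: subv_trans (IH _) (Cm _ _); first by rewrite (ltnW jn) andbT.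
by rewrite jn (leq_trans i1).
Qed.

Lemma full_chain_ideal j : (1 <= j <= n)%N -> right_ideal (C j).
Proof. by have [Cr _ _] := C_full; move=> /Cr[]. Qed.

Section OverL.
Variables (L : fieldType) (tau : {rmorphism K -> L}).
Local Notation psi := (tau \o phi).
Let psiE x : psi x = tau (phi x). Proof. by []. Qed.

(** Descending induction on [j]. If [j < d] is not essential, [C (s j)] has codimension [n] in
    [C (s j.+1)], so the intersection with [J] loses at most one unit of reduced rank. If [d] is not
    essential, its condition involves [C n], the whole algebra. *)
Lemma schubert_essential (J : {vspace scext A psi}) :
  schubert n d lam C J <-> SB n d J /\
    forall p, p \in E -> (p.1 <= rrank n (J :&: scspan psi tau (C p.2)))%N.
Proof.
split=> -[SBJ cJ]; split=> //.
  by move=> p pE; have [pd _ ->] := mem_essential pE; apply: cJ.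
move=> j; rewrite -/(scspan _ _ _).
have := leq_subr j d; move: {2}(d - j)%N (erefl (d - j)%N) => k.
elim: k j => [|k IH] j dj _ /andP[j1 jd].
  have je : j = d by apply/eqP; rewrite eqn_leq jd -subn_eq0 dj.
  subst j; have [lt|ge] := ltnP (part lam d.+1) (part lam d).
    have dE : (d, s d) \in E by apply: (essential_mem n) => //; rewrite d_gt0 leqnn.
    by apply: (cJ _ dE).
  have sd : s d = n.
    rewrite part_last leqn0 in ge; rewrite /schubert_idx (eqP ge) subn0 subnK //.
    by case/andP: d_bounds.
  have [_ _ Cn] := C_full; rewrite sd Cn [extend_vs2 _ _](scspan_full _ psiE) capvf.
  by case: SBJ => _ ->.
have [lt|ge] := ltnP (part lam j.+1) (part lam j).
  have jE : (j, s j) \in E by apply: (essential_mem n); rewrite // j1.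
  by apply: (cJ _ jE).
have jd' : (j < d)%N by rewrite -subn_gt0 dj.
have ss : s j.+1 = (s j).+1.
  have := part_anti lam_sorted j1; have := part_le lam_bound j.
  by rewrite /schubert_idx; move: ge; lia.
have sj : (1 <= s j <= n)%N 
  by apply: (schubert_idx_bounds d_bounds lam_sorted lam_bound); rewrite ?j1.
have sj1 : (1 <= s j.+1 <= n)%N by apply: (schubert_idx_bounds d_bounds lam_sorted lam_bound).
have := IH j.+1; rewrite ss => /(_ _ _ _)/wrap[||//|].
- by rewrite subnS dj.
- exact: leq_subr.
set C0 := extend_vs2 tau (C (s j)); set C1 := extend_vs2 tau (C (s j).+1).
have C01 : (C0 <= C1)%VS.
  apply: (@scspanS _ _ _ _ _ _ tau).
  by have [_ Cm _] := C_full; apply: Cm; move: sj sj1; rewrite ss; lia.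
have dC0 : \dim C0 = (s j * n)%N.
  by rewrite [C0]/(scspan _ _ _) (dim_scspan psiE) full_chain_dim.
have dC1 : \dim C1 = ((s j).+1 * n)%N.
  by rewrite [C1]/(scspan _ _ _) (dim_scspan psiE) full_chain_dim // -ss.
rewrite /rrank !leq_divRL // => le1.
have capE : (J :&: C1 :&: C0 = J :&: C0)%VS by rewrite -capvA (capv_idPr C01).
have : (\dim (J :&: C1 + C0) <= \dim C1)%N.
  by apply: dimvS; rewrite subv_add capvSr C01.
rewrite -(leq_add2r (\dim (J :&: C0))) -{1}capE dimv_sum_cap dC0 dC1.
move: le1; rewrite !mulSn => le1 le2; rewrite -(leq_add2l n) (leq_trans le1) //.
by rewrite -(leq_add2r (schubert_idx n d lam j * n)) addnAC.
Qed.

Variable I : nat -> {vspace A}.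
Hypothesis CI : forall p, p \in E -> C p.2 = extend_vs phi (I p.2).

Lemma schubert_flag_variety (J : {vspace scext A psi}) :
  schubert n d lam C J <-> flag_variety n d E I J.
Proof.
rewrite schubert_essential.
by split=> -[SBJ cJ]; split=> // p pE; have := cJ p pE;
  rewrite (CI pE) (scspan_extend_vs psiE).
Qed.

End OverL.
End WithChain.

Section WithFlag.
Variable I : nat -> {vspace A}.
Hypothesis I_ideal : forall p, p \in E -> right_ideal (I p.2).
Hypothesis I_mono' : forall p q, p \in E -> q \in E ->
  (p.2 <= q.2)%N -> (I p.2 <= I q.2)%VS.

Let E_le p : p \in E -> (p.1 <= d)%N.
Proof. by move=> /mem_essential[/andP[]]. Qed.

Let I_mono p q : p \in E -> q \in E -> (p.1 <= q.1)%N -> (I p.2 <= I q.2)%VS.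
Proof.
move=> pE qE; rewrite leq_eqVlt => /predU1P[e1|lt1]; apply: I_mono' => //.
  have [_ _ ->] := mem_essential pE; have [_ _ ->] := mem_essential qE.
  by rewrite e1.
exact: ltnW (essential_mono d_bounds lam_sorted lam_bound pE qE lt1).
Qed.

Local Notation X := (flag_variety n d E I).
Local Notation VI := (vanish_ideal (n := n) (d := d)
  (fun L (psi : {rmorphism F -> L}) => @flag_variety F A n d E I L psi)).

Definition flag_closed_subvariety : closed_subvariety A n d.
Proof.
exists (VI (idfun : {rmorphism F -> F})).
- exact: vanish_ideal0.
- exact: vanish_idealD.
- exact: vanish_idealM.
- by move=> f k; apply: vanish_ideal_homog => //; apply: flag_variety_ext.
- exact: vanish_ideal_radical.
move=> f vf M tau rho rhoE J [SBJ _].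
have <- : map_mpoly rho f = map_mpoly tau f.
  by apply/mpolyP => mn; rewrite !mcoeff_map_mpoly /= rhoE.
exact: vf.
Defined.

(** [schubert_ideal] tests the morphisms [tau \o phi], [vanish_ideal] all those that agree with them
    pointwise; [J] is carried from the latter to the former along the identity of [L]. *)
Lemma vanish_flag_schubert (C : nat -> {vspace scext A phi}) g :
    full_chain n C -> (forall p, p \in E -> C p.2 = extend_vs phi (I p.2)) ->
  VI phi g <-> schubert_ideal lam C g.
Proof.
move=> C_full CI; split=> [vg L tau J XJ|sg L tau rho rhoE J XJ].
  by apply: vg; last exact/(schubert_flag_variety C_full CI).
have idE x : (tau \o phi) x = (idfun : {rmorphism L -> L}) (rho x) by rewrite /= rhoE.
have XJ' := flag_variety_ext idE XJ.
have := sg L tau _ (proj2 (schubert_flag_variety C_full CI _) XJ').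
have idg : map_mpoly (idfun : {rmorphism L -> L}) (map_mpoly tau g) = map_mpoly tau g.
  by apply/mpolyP => mn; rewrite mcoeff_map_mpoly.
rewrite -{1}idg.
exact: (@vanishes_at_descent F A L L rho (tau \o phi) idfun idE n d (map_mpoly tau g) J).
Qed.

Lemma ext_ideal_in_ext (P : closed_subvariety A n d) g :
  ext_ideal P phi g <-> in_ext phi P g.
Proof.
split=> [[r [h [f [Pf ->]]]]|[r [c [f [Pf ->]]]]]; last first.
  exists r, (fun i => (c i)%:MP), f; split=> //.
  by apply: eq_bigr => i _; rewrite mul_mpolyC.
have P0 := csv_ideal0 P; apply: in_ext_sum => // i _.
rewrite (mpolyE (h i)) mulr_suml; apply: in_ext_sum => // mn _.
rewrite -scalerAl; apply: in_extZ.
have -> : 'X_[mn] * map_mpoly phi (f i) = map_mpoly phi ('X_[mn] * f i).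
  by rewrite rmorphM /= map_mpolyX.
exact/in_ext_map/csv_idealM.
Qed.

Lemma ext_ideal_descent (P : closed_subvariety A n d) f :
  ext_ideal P phi (map_mpoly phi f) -> P f.
Proof.
move=> /ext_ideal_in_ext; apply: in_ext_map_inv.
- exact: csv_ideal0.
- exact: csv_idealD.
by move=> a h Ph; rewrite -mul_mpolyC; apply: csv_idealM.
Qed.

Lemma vanish_flag_descends (L : fieldType) (psi : {rmorphism F -> L}) g :
  VI psi g -> in_ext psi (VI (idfun : {rmorphism F -> F})) g.
Proof. exact: (flag_variety_descends n_gt0 d_gt0 degA K_splits I_ideal E_le I_mono). Qed.

Lemma flag_extends_to_schubert (C : nat -> {vspace scext A phi}) :
    full_chain n C -> (forall p, p \in E -> C p.2 = extend_vs phi (I p.2)) ->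
  extends_to_schubert lam phi flag_closed_subvariety.
Proof.
move=> C_full CI; exists C; split=> // g; rewrite ext_ideal_in_ext.
rewrite -(vanish_flag_schubert _ C_full CI); split; last exact: vanish_flag_descends.
by move=> vg; apply: (vanish_ideal_in_ext (tau := phi) _ vg).
Qed.

(** It concerns every [P] that extends to [X_lambda], not only the one constructed above: the ideal
    of [P] is the contraction of the ideal over [K], which the flag determines. *)
Lemma schubert_ideal_flag (P : closed_subvariety A n d) (C : nat -> {vspace scext A phi}) f :
    full_chain n C -> (forall p, p \in E -> C p.2 = extend_vs phi (I p.2)) ->
    (forall g, ext_ideal P phi g <-> schubert_ideal lam C g) ->
  P f <-> VI (idfun : {rmorphism F -> F}) f.
Proof.
move=> C_full CI PC.
have fE : ext_ideal P phi (map_mpoly phi f) <-> VI phi (map_mpoly phi f).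
  by rewrite (vanish_flag_schubert _ C_full CI).
split=> [Pf|vf].
  have /vanish_flag_descends : VI phi (map_mpoly phi f).
    by apply/fE/ext_ideal_in_ext/in_ext_map.
  by apply: in_ext_map_inv => [|g h|a g];
    [exact: vanish_ideal0 | exact: vanish_idealD | exact: vanish_idealZ].
apply: ext_ideal_descent; apply/fE.
exact: (vanish_ideal_map (tau := phi) _ vf).
Qed.

End WithFlag.

Lemma essential_dvd : (ind A %| \big[gcdn/0%N]_(a <- essential_proj n d lam) a)%N <->
  forall p, p \in E -> (ind A %| p.2)%N.
Proof.
rewrite /essential_proj big_map; split=> [dv p pE|].
  apply: dvdn_trans dv _; elim: (E) pE => // q r IH.
  rewrite inE big_cons => /predU1P[->|/IH]; first exact: dvdn_gcdl.
  exact: dvdn_trans (dvdn_gcdr _ _).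
elim: (E) => [|q r IH] h; first by rewrite big_nil dvdn0.
rewrite big_cons dvdn_gcd h ?mem_head //=; apply: IH => p pr.
by apply: h; rewrite inE pr orbT.
Qed.

Lemma exists_subvariety : (forall p, p \in E -> (ind A %| p.2)%N) ->
  exists P : closed_subvariety A n d, extends_to_schubert lam phi P.
Proof.
move=> dvE; pose i := ind A.
have [e [s' [x [y [wd e_min emin]]]]] := simple_wdata A_simple.
have e_gen := wd_gen wd; have ee := wd_idem wd; have eN0 := wd_neq0 wd.
have [I0 rI0 dI0] := ind_ideal n_gt0 degA A_central A_simple.
(* The dimension of the minimal right ideal [e A] is a multiple of [n * i], and is at most that of
   [I0]. *)
have de : \dim (<[e]> * {:A}) = (n * i)%N.
  have dv := ind_dvd degA A_central A_simple (right_ideal_mulf <[e]>).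
  have le : (n * i <= \dim (<[e]> * {:A}))%N by apply: dvdn_leq dv; apply: minimal_row_gt0.
  apply/eqP; rewrite eqn_leq le andbT /i -dI0 emin // -dimv_eq0 dI0 -lt0n.
  have [i0|//] := posnP (n * ind A).
  by have := minimal_row_gt0 eN0; rewrite i0 dvd0n in dv; rewrite (eqP dv).
have i_gt0 : (0 < i)%N.
  by have := minimal_row_gt0 eN0; rewrite de muln_gt0 => /andP[].
have /dvdnP[t nE] : (i %| n)%N.
  have := ind_dvd degA A_central A_simple (right_idealf A).
  by rewrite degA expnS expn1 dvdn_pmul2l.
have t_gt0 : (0 < t)%N by case: (t) nE n_gt0 => // ->.
pose G b : {vspace A} := if b == 0%N then 0%VS else fullv.
have [||b c|T [T_id T_mono _]] := refine_chain (t := t) (N := 1) (G := G)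
    ee eN0 e_min e_gen t_gt0.
- by case=> [|b] _; [exact: right_ideal0 | exact: right_idealf].
- case=> [|[|//]] _; rewrite /G /= ?dimv0 ?mul0n // mul1n degA de expnS expn1.
  by rewrite {2}nE mulnCA mulnA [(t * n)%N]mulnC.
- rewrite /G; case: (b) => [|b'] /=; first by rewrite sub0v.
  by case: c => // c _; apply: subvv.
rewrite mul1n in T_id T_mono.
have T_le b c : (b <= c <= t)%N -> (T b <= T c)%VS.
  elim: c => [|c IH]; first by rewrite leqn0 => /andP[/eqP->]; rewrite subvv.
  rewrite leq_eqVlt => /andP[/predU1P[->|bc] ct]; first exact: subvv.
  by apply: subv_trans (IH _) (T_mono _ ct); rewrite -ltnS bc (ltnW ct).
have [ex [x' [y' sd]]] := splits_data n_gt0 degA K_splits.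
have wd' := sd.1.
have [|b bt|b c bc|C [C_id C_mono CT]] := refine_chain (t := i) (N := t)
    (G := fun b => extend_vs phi (T b)) (wd_idem wd') (wd_neq0 wd')
    (split_minimal n_gt0 sd) (wd_gen wd') i_gt0.
- by move=> b bt; apply/extend_vs_right_ideal; case: (T_id b bt).
- rewrite dim_extend_vs (split_dim_row n_gt0 sd); have [_ ->] := T_id b bt.
  by rewrite de -!mulnA [(i * n)%N]mulnC.
- exact/extend_vsS/T_le.
rewrite -nE (split_dim_row n_gt0 sd) in C_id C_mono.
(* [T b] has reduced rank [b * i], so for [a] divisible by [i] this is the member of reduced rank
   [a]. *)
pose I a := T (a %/ i)%N.
have tE p : p \in E -> (p.2 %/ i <= t)%N.
  move=> pE; rewrite -(leq_pmul2r i_gt0) divnK ?dvE // -nE ltnW //.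
  by case/andP: (essential_lt d_bounds lam_sorted lam_bound pE).
have I_ideal p : p \in E -> right_ideal (I p.2).
  by move=> pE; have [] := T_id _ (tE p pE).
have I_mono p q : p \in E -> q \in E -> (p.2 <= q.2)%N -> (I p.2 <= I q.2)%VS.
  by move=> pE qE pq; apply: T_le; rewrite tE // andbT leq_div2r.
exists (flag_closed_subvariety I).
apply: (flag_extends_to_schubert I_ideal I_mono (C := C)).
  split.
  - move=> j /andP[_ jn]; have [rC dC] := C_id _ jn.
    by rewrite /rrank dC mulnK.
  - by move=> j /andP[_ jn]; apply: C_mono.
  apply/eqP; rewrite eqEdim subvf dim_scext degA expnS expn1.
  by have [_ d1] := C_id _ (leqnn n); rewrite d1 leqnn.
by move=> p pE; rewrite -(CT _ (tE p pE)) divnK // dvE.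
Qed.

End SchubertFlag.

(** * The stabilizer of a Schubert variety *)

Section Polarization.

Lemma coef1M (R : comNzRingType) (p q : {poly R}) :
  (p * q)`_1 = p`_0 * q`_1 + p`_1 * q`_0.
Proof. by rewrite coefM big_ord_recl big_ord1. Qed.

Lemma coef1_prod (R : comNzRingType) k (a b : 'I_k -> R) :
  (\prod_j ((a j)%:P + 'X * (b j)%:P))`_1 =
  \sum_j b j * \prod_(i | i != j) a i.
Proof.
have coef0_prod (I : Type) (r : seq I) (f : I -> {poly R}) :
  (\prod_(i <- r) f i)`_0 = \prod_(i <- r) (f i)`_0.
  elim: r => [|i r IH]; first by rewrite !big_nil coef1.
  by rewrite !big_cons coef0M IH.
have ab0 (u v : R) : (u%:P + 'X * v%:P)`_0 = u.
  by rewrite coefD coefC coefXM addr0.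
have ab1 (u v : R) : (u%:P + 'X * v%:P)`_1 = v.
  by rewrite coefD coefC coefXM /= coefC add0r.
elim: k a b => [|k IH] a b; first by rewrite !big_ord0 coef1.
rewrite big_ord_recl coef1M ab0 ab1 IH big_ord_recl addrC; congr (_ + _).
  rewrite coef0_prod [in RHS]big_mkcond big_ord_recl /= mul1r.
  by congr (_ * _); apply: eq_bigr => i _; rewrite ab0.
rewrite mulr_sumr; apply: eq_bigr => j _.
rewrite [in RHS]big_mkcond big_ord_recl /= mulrCA; congr (_ * (_ * _)).
rewrite big_mkcond; apply: eq_bigr => i _.
by rewrite (inj_eq lift_inj).
Qed.

Variables (k m : nat).
Local Notation N := #|{: pluecker_index k m}|.

Section OneRing.
Variable R : comNzRingType.
Implicit Types (X : 'M[R]_m) (g : {mpoly R[N]}).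

(** The matrix of the derivation that [X] induces on the [k]-th tensor power: one index is changed
    by [X], the others are kept. It gives the coefficient of [t] in the Plücker coordinates of
    [B (1 + t X)] ([plmx_flow1]). *)
Definition polar_coef X (x y : 'I_N) : R :=
  \sum_j X (enum_val x j) (enum_val y j) *
    \prod_(i | i != j) (enum_val x i == enum_val y i)%:R.

(* the derivation of the homogeneous coordinate ring induced by the
   endomorphism X *)
Definition polar X g : {mpoly R[N]} :=
  \sum_y g^`M(y) * \sum_x polar_coef X x y *: 'X_x.

Lemma polar_sum X (I : Type) (r : seq I) (P : pred I) (c : I -> R) f :
  polar X (\sum_(i <- r | P i) c i *: f i) =
  \sum_(i <- r | P i) c i *: polar X (f i).
Proof.
elim/big_rec2: _ => [|i g h _ IH].
  by rewrite /polar big1 // => y _; rewrite mderiv0 mul0r.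
rewrite -IH /polar scaler_sumr -big_split; apply: eq_bigr => y _ /=.
by rewrite mderivD mderivZ mulrDl scalerAl.
Qed.

Lemma polar_coef_sum (I : Type) (r : seq I) (P : pred I) (c : I -> R)
    (X : I -> 'M[R]_m) x y :
  polar_coef (\sum_(i <- r | P i) c i *: X i) x y =
  \sum_(i <- r | P i) c i * polar_coef (X i) x y.
Proof.
rewrite /polar_coef; under [RHS]eq_bigr do rewrite mulr_sumr.
rewrite exchange_big /=; apply: eq_bigr => j _.
by rewrite summxE mulr_suml; apply: eq_bigr => i _; rewrite mxE mulrA.
Qed.

Lemma polar_suml (I : Type) (r : seq I) (P : pred I) (c : I -> R)
    (X : I -> 'M[R]_m) g :
  polar (\sum_(i <- r | P i) c i *: X i) g =
  \sum_(i <- r | P i) c i *: polar (X i) g.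
Proof.
rewrite /polar; under [RHS]eq_bigr do rewrite scaler_sumr.
rewrite exchange_big /=; apply: eq_bigr => y _.
under [RHS]eq_bigr do rewrite scalerAr scaler_sumr.
rewrite -mulr_sumr exchange_big /=; congr (_ * _); apply: eq_bigr => x _.
by rewrite polar_coef_sum scaler_suml; apply: eq_bigr => i _; rewrite scalerA.
Qed.

Definition flow (B : 'M[R]_(k, m)) X : 'M[{poly R}]_(k, m) :=
  map_mx polyC B + 'X *: map_mx polyC (B *m X).

Lemma plmx_flow0 B X x : (plmx (flow B X) x)`_0 = plmx B x.
Proof.
rewrite -horner_coef0 -[_.[0]]/(horner_eval 0 _) -plmx_map; congr (plmx _ x).
apply/matrixP => i j; rewrite !mxE -[LHS]/(horner _ 0) hornerD hornerM hornerX.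
by rewrite mul0r addr0 hornerC.
Qed.

Lemma plmx_flow1 B X y :
  (plmx (flow B X) y)`_1 = \sum_x polar_coef X x y * plmx B x.
Proof.
have -> : plmx (flow B X) y =
    \sum_(x : 'I_N) (\prod_j (((enum_val x j == enum_val y j)%:R : R)%:P +
        'X * (X (enum_val x j) (enum_val y j))%:P)) * (plmx B x)%:P.
  pose Y : 'M[{poly R}]_(m, k) := \matrix_(c, j)
    (((c == enum_val y j)%:R : R)%:P + 'X * (X c (enum_val y j))%:P).
  transitivity (\sum_x detform Y x * plmx (map_mx polyC B) x); last first.
    apply: eq_bigr => x _; rewrite plmx_map /detform; congr (_ * _).
    by apply: eq_bigr => j _; rewrite mxE.
  rewrite detformE; congr (\det _); apply/matrixP => i j.
  rewrite !mxE; under [RHS]eq_bigr do rewrite !mxE mulrDr.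
  rewrite big_split /= [X in _ = X + _](bigD1 (enum_val y j)) //= eqxx mulr1
    [X in _ = _ + X + _]big1 => [|c cy].
    rewrite addr0 raddf_sum mulr_sumr; congr (_ + _); apply: eq_bigr => c _ /=.
    by rewrite polyCM mulrCA.
  by rewrite (negPf cy) mulr0.
rewrite coef_sum; apply: eq_bigr => x _.
by rewrite coefMC coef1_prod.
Qed.

Lemma meval_coef0 g (v : 'I_N -> {poly R}) :
  ((map_mpoly polyC g).@[v])`_0 = g.@[fun x => (v x)`_0].
Proof.
rewrite -horner_coef0 -[_.[0]]/(horner_eval 0 _) -map_meval map_mpoly_mpoly.
have -> : map_mpoly (horner_eval 0 \o polyC) g = g.
  by apply/mpolyP => mn; rewrite mcoeff_map_mpoly /= /horner_eval hornerC.
by apply: meval_eq => x; rewrite -horner_coef0.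
Qed.

Lemma meval_coef1 g (v : 'I_N -> {poly R}) :
  ((map_mpoly polyC g).@[v])`_1 =
  \sum_x (g^`M(x)).@[fun x => (v x)`_0] * (v x)`_1.
Proof.
pose ok g := ((map_mpoly polyC g).@[v])`_1 =
  \sum_x (g^`M(x)).@[fun x => (v x)`_0] * (v x)`_1.
have ok1 : ok 1.
  rewrite /ok rmorph1 meval1 coef1 big1 // => x _.
  by rewrite -mpolyC1 mderivC meval0 mul0r.
have okM f h : ok f -> ok h -> ok (f * h).
  rewrite /ok => of_ oh.
  have -> : map_mpoly polyC (f * h) = map_mpoly polyC f * map_mpoly polyC h.
    exact: rmorphM.
  rewrite mevalM coef1M; move: of_ oh (meval_coef0 f v) (meval_coef0 h v).
  move: (map_mpoly polyC f).@[v] (map_mpoly polyC h).@[v] => p q of_ oh pf qh.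
  rewrite [p`_1]of_ [q`_1]oh [p`_0]pf [q`_0]qh {of_ oh pf qh p q}.
  rewrite mulr_sumr mulr_suml -big_split; apply: eq_bigr => x _ /=.
  rewrite mderivM mevalD !mevalM mulrDl addrC mulrA; congr (_ + _).
  by rewrite mulrAC.
have okX x : ok 'X_x.
  rewrite /ok map_mpolyX mevalXU (bigD1 x) //= big1 => [|y yx].
    by rewrite addr0 mderivX mnm1E eqxx scale1r -{1}[U_(x)%MM]add0m addmK mpolyX0 meval1 mul1r.
  by rewrite mderivX mnm1E eq_sym (negPf yx) scale0r meval0 mul0r.
have okP (f : {mpoly R[N]}) e : ok f -> ok (f ^+ e).
  by move=> of_; elim: e => [|e IH]; rewrite ?expr0 // exprS; apply: okM.
elim/mpolyind: g => [|c mn g _ _ IH]; rewrite -/(ok _).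
  by rewrite /ok rmorph0 meval0 coef0 big1 // => x _; rewrite mderiv0 meval0 mul0r.
have okm : ok 'X_[mn].
  rewrite mpolyXE_id; apply: (big_ind ok) => [||x _]; [exact: ok1|exact: okM|].
  exact/okP/okX.
rewrite /ok in okm; rewrite /ok rmorphD /= map_mpolyZ mevalD mevalZ coefD coefCM.
move: okm IH; move: (map_mpoly polyC 'X_[mn]).@[v] (map_mpoly polyC g).@[v] => p q okm IH.
rewrite [p`_1]okm [q`_1]IH {okm IH p q} mulr_sumr -big_split; apply: eq_bigr => x _ /=.
by rewrite mderivD mderivZ mevalD mevalZ mulrDl mulrA.
Qed.

(** The chain rule: [polar X g] is the derivative of [g] at [t = 0] along the curve [B (1 + t X)].
    The curve is taken over a polynomial ring, which embeds in a field, unlike the dual numbers; so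
    it can be tested as a point. *)
Lemma meval_polar X g B :
  (polar X g).@[plmx B] = ((map_mpoly polyC g).@[plmx (flow B X)])`_1.
Proof.
rewrite meval_coef1 /polar meval_sum; apply: eq_bigr => y _.
rewrite mevalM plmx_flow1; congr (_ * _); first by apply: meval_eq => x; rewrite plmx_flow0.
by rewrite meval_sum; apply: eq_bigr => x _; rewrite mevalZ mevalXU.
Qed.

End OneRing.

Lemma map_polar (R S : comNzRingType) (f : {rmorphism R -> S}) X g :
  map_mpoly f (polar X g) = polar (map_mx f X) (map_mpoly f g).
Proof.
rewrite /polar map_mpoly_sum; apply: eq_bigr => y _; rewrite rmorphM /=.
congr (_ * _).
  by apply/mpolyP => mn; rewrite mcoeff_deriv !mcoeff_map_mpoly /= mcoeff_deriv rmorphMn.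
rewrite map_mpoly_sum; apply: eq_bigr => x _; rewrite map_mpolyZ map_mpolyX.
congr (_ *: _); rewrite /polar_coef rmorph_sum; apply: eq_bigr => j _ /=.
by rewrite rmorphM rmorph_prod mxE; congr (_ * _); apply: eq_bigr => i _; rewrite rmorph_nat.
Qed.

End Polarization.

Lemma map_linform (R S : comNzRingType) (f : {rmorphism R -> S}) k m
    (l : 'I_#|{: pluecker_index k m}| -> R) :
  map_mpoly f (linform l) = linform (fun x => f (l x)).
Proof.
rewrite map_mpoly_sum; apply: eq_bigr => x _.
by rewrite map_mpolyZ map_mpolyX.
Qed.

(** * Determinants as equations for intersection conditions *)

Section Determinantal.
Variables (F : fieldType) (A : falgType F).
Local Notation m := (\dim {:A}).

Section OneField.
Variables (L : fieldType) (psi : {rmorphism F -> L}).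
Local Notation B := (scext A psi).

(** If the determinant is not 0, a basis of [J :&: U] has independent images under [T], all with
    zero entries in the columns of [R]; so there are at most [k - #|R|] of them. *)
Lemma det_mulmx_cap k (T : 'M[L]_(m, k)) (J U : {vspace B}) (R : {set 'I_k})
    (b : k.-tuple B) :
    basis_of J b -> (forall u r, u \in U -> r \in R -> ((u : 'rV_m) *m T) 0 r = 0) ->
    (k < \dim (J :&: U) + #|R|)%N ->
  \det (rowsmx b *m T) = 0.
Proof.
move=> bJ TU lt; apply/eqP; apply: contraLR lt => det_n0; rewrite -leqNgt.
set e := \dim (J :&: U); pose c := vbasis (J :&: U).
pose G := \matrix_(i < e, j < k) coord b j (tnth c i).
have cE : rowsmx c = G *m rowsmx b.
  apply: rowsmx_lin => i; have : tnth c i \in (J :&: U)%VS.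
    by apply/vbasis_mem/mem_tnth.
  rewrite memv_cap => /andP[cJ _]; rewrite {1}(coord_basis bJ cJ).
  by apply: eq_bigr => j _; rewrite mxE [tnth b j](tnth_nth 0).
have Cf : row_free (rowsmx c) by rewrite -free_rowsmx (basis_free (vbasisP _)).
have GU : \rank (G *m (rowsmx b *m T)) = e.
  rewrite mxrankMfree; last by rewrite row_free_unit unitmxE unitfE.
  apply/eqP; rewrite eqn_leq rank_leq_row /=.
  by rewrite -[X in (X <= _)%N](eqP Cf) cE mxrankM_maxl.
have -> : (e + #|R| <= k)%N = (e <= #|~: R|)%N.
  have := cardsC R; rewrite card_ord => kE.
  by rewrite -[X in (_ <= X)%N]kE addnC leq_add2l.
rewrite -GU mulmxA -cE; set D := _ *m T.
have -> : D = (\matrix_(i, a) D i (enum_val (A := ~: R) a)) *m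
    (\matrix_(a, j) (enum_val a == j)%:R).
  apply/matrixP => i j; rewrite [RHS]mxE.
  have [jR|jR] := boolP (j \in R).
    rewrite big1 => [|a _]; last first.
      rewrite !mxE; case: eqP => [ej|]; last by rewrite mulr0.
      by have := enum_valP a; rewrite inE ej jR.
    have cU : tnth c i \in U.
      have : tnth c i \in (J :&: U)%VS by apply/vbasis_mem/mem_tnth.
      by rewrite memv_cap => /andP[].
    by rewrite -(TU _ _ cU jR) !mxE; apply: eq_bigr => l _; rewrite !mxE.
  have jR' : j \in ~: R by rewrite inE.
  rewrite (bigD1 (enum_rank_in jR' j)) //= big1 => [|a aj].
    by rewrite addr0 [X in _ = X * _]mxE [X in _ = _ * X]mxE enum_rankK_in // eqxx mulr1.
  rewrite !mxE; case: eqP => [ej|]; last by rewrite mulr0.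
  by case/eqP: aj; apply: enum_val_inj; rewrite enum_rankK_in.
exact: mulmx_max_rank.
Qed.

(** [b] begins with a basis of [J :&: U] and is completed by a basis of a complement [W] of
    [J :&: U] in [U]. [T] reads the coordinates on [b]: on [U], only the first [\dim (J :&: U)] of
    them can be nonzero. *)
Lemma adapted_functionals k (J U : {vspace B}) : \dim J = k ->
  exists (b : k.-tuple B) (T : 'M[L]_(m, k)),
    [/\ basis_of J b, rowsmx b *m T = 1%:M,
        forall i : 'I_k, (i < \dim (J :&: U))%N -> tnth b i \in U,
        (J :&: U <= <<take (\dim (J :&: U)) b>>)%VS &
        forall u (r : 'I_k), u \in U -> (\dim (J :&: U) <= r)%N ->
          ((u : 'rV_m) *m T) 0 r = 0].
Proof.
move=> dJ; set e := \dim (J :&: U).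
pose b1 := vbasis (J :&: U); pose b2 := vbasis (J :\: U).
have JE : (J :&: U + (J :\: U) = J)%VS by rewrite addvC addv_diff_cap.
have dcap : (J :&: U :&: (J :\: U) = 0)%VS.
  by apply/eqP; rewrite -subv0 -(capv_diff J U) capvC capvS ?capvSr.
have bJ' : basis_of J (b1 ++ b2).
  have : basis_of (J :&: U + (J :\: U)) (b1 ++ b2).
    by apply: cat_basis; rewrite ?vbasisP //; apply/directv_addP.
  by rewrite JE.
have bs : size (b1 ++ b2) == k.
  by rewrite size_cat !size_tuple dimv_cap_compl dJ.
have [b bE] : exists b : k.-tuple B, tval b = b1 ++ b2 by exists (Tuple bs).
rewrite -bE in bJ'.
pose W := (U :\: J)%VS; pose S := [tuple of b ++ vbasis W].
have SW : basis_of (J + W) S.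
  apply: cat_basis; rewrite ?vbasisP //; apply/directv_addP.
  by apply/eqP; rewrite -subv0 -(capv_diff U J) capvC subvv.
pose T : 'M[L]_(m, k) :=
  \matrix_(c, r) coord S (lshift _ r) (delta_mx 0 c : 'rV_m).
have TE (u : B) r : ((u : 'rV_m) *m T) 0 r = coord S (lshift _ r) u.
  rewrite {2}[u](row_sum_delta (u : 'rV_m)) linear_sum mxE.
  by apply: eq_bigr => c _; rewrite linearZ mxE.
have Sf := basis_free SW.
have Sb (i : 'I_k) : tnth b i = S`_(lshift (\dim W) i).
  by rewrite [RHS]nth_cat size_tuple /= ltn_ord (tnth_nth 0).
have b1E i : (i < e)%N -> b`_i = b1`_i by move=> ie; rewrite bE nth_cat size_tuple ie.
exists b, T; split=> // [|i ie||u r uU er].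
- apply/matrixP => i r; rewrite !mxE -[i == r](inj_eq (@lshift_inj k (\dim W))).
  rewrite -(coord_free _ _ Sf) -Sb -TE mxE.
  by apply: eq_bigr => c _; rewrite !mxE.
- rewrite (tnth_nth 0) b1E //; have : b1`_i \in (J :&: U)%VS.
    by apply/vbasis_mem/mem_nth; rewrite size_tuple.
  by rewrite memv_cap => /andP[].
- rewrite bE take_size_cat ?size_tuple // (span_basis (vbasisP _)).
  exact: subvv.
rewrite TE; have : u \in (J :&: U + W)%VS by rewrite capvC addvC addv_diff_cap.
case/memv_addP => u1 u1J [u2 u2W ->]; rewrite linearD /=.
rewrite (coord_vbasis u1J) (coord_vbasis u2W) !linear_sum /=.
rewrite !big1 ?addr0 // => i _; rewrite linearZ /=.
  have -> : (vbasis W)`_i = S`_(rshift k i).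
    by rewrite [RHS]nth_cat size_tuple ltnNge leq_addr /= addKn.
  by rewrite coord_free // eq_rlshift mulr0.
have ik : (i < k)%N by rewrite (leq_trans (ltn_ord i)) // -dJ dimvS ?capvSl.
rewrite -/b1 -b1E // -(tnth_nth 0 b (Ordinal ik)) Sb coord_free // eq_shift.
case: eqP => [ri|]; last by rewrite mulr0.
by have := ltn_ord i; rewrite ltnNge -/e; move: er; rewrite -ri => ->.
Qed.

End OneField.

Section TwoFields.
Variables (K L : fieldType) (phi : {rmorphism F -> K}) (psi : {rmorphism F -> L}).
Variable tau : {rmorphism K -> L}.
Hypothesis psiE : forall x, psi x = tau (phi x).

Lemma meval_detform (n d : nat) (T : 'M[K]_(m, d * n)) (b : (d * n).-tuple (scext A psi)) :
  (map_mpoly tau (linform (detform T))).@[pluecker b] =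
  \det (rowsmx b *m map_mx tau T).
Proof.
rewrite map_linform meval_linform -detformE.
apply: eq_bigr => x _; rewrite pluecker_rowsmx /detform rmorph_prod.
by congr (_ * _); apply: eq_bigr => j _; rewrite mxE.
Qed.

Lemma detform_vanishes (n d : nat) (T : 'M[K]_(m, d * n)) (R : {set 'I_(d * n)})
    (U : {vspace scext A phi}) (J : {vspace scext A psi}) :
    (forall u r, u \in U -> r \in R -> ((u : 'rV_m) *m T) 0 r = 0) ->
    (d * n < \dim (J :&: scspan psi tau U) + #|R|)%N ->
  vanishes_at (map_mpoly tau (linform (detform T))) J.
Proof.
move=> TU lt b bJ; rewrite meval_detform.
apply: (det_mulmx_cap bJ _ lt) => u r uU rR.
rewrite (coord_span uU) mulmx_suml summxE big1 // => i _.
rewrite -scalemxAl mxE (nth_map 0) ?size_tuple //.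
set v := (vbasis U)`_i; rewrite -map_mxM mxE TU ?rmorph0 ?mulr0 //.
by apply/vbasis_mem/mem_nth; rewrite size_tuple.
Qed.

End TwoFields.
End Determinantal.

(** * A point of the Schubert variety moved by a given element *)

Section TestIdeal.
Variables (K : fieldType) (B : falgType K) (n : nat) (e : B) (x y : 'I_n -> B).
Hypotheses (n_gt0 : (0 < n)%N) (sd : split_data e x y).
Implicit Types (U V W G J Q : {vspace B}) (z w : B).

Let wd := sd.1.
Let ee := wd_idem wd.
Let e_neq0 := wd_neq0 wd.
Let e_min := split_minimal n_gt0 sd.
Let e_gen := wd_gen wd.

Lemma dim_add_line U z : right_ideal U -> z * e = z -> z \notin U ->
  \dim (U + <[z]> * fullv) = (\dim U + n)%N.
Proof.
move=> rU ze zU; rewrite -[n in RHS](split_dim_row n_gt0 sd).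
apply: (minimal_step_dim ee) => // c ec zc; apply/eqP; apply: contraNT zU => c0.
have [|cB|cB] := e_min (right_ideal_mulf <[c]>).
- apply/subvP => u /memv_linel[b _ ->]; rewrite -ec -mulrA; apply/memv_linel.
  by exists (c * b); rewrite ?memvf.
- case/eqP: c0; apply/eqP; rewrite -memv0 -cB; apply/memv_linel.
  by exists 1; rewrite ?memvf ?mulr1.
have : e \in (<[c]> * fullv)%VS.
  by rewrite cB; apply/memv_linel; exists 1; rewrite ?memvf ?mulr1.
case/memv_linel => b _ eb; rewrite -ze eb mulrA.
exact: (proj1 (right_idealP U)).
Qed.

(** [G] is the sum of [U] and of a complement in [V] of [U + z B], which has reduced rank 1 over
    [U]. *)
Lemma hyperplane_ideal_in U V z : right_ideal U -> right_ideal V -> (U <= V)%VS ->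
    z \in V -> z * e = z -> z \notin U ->
  exists G, [/\ right_ideal G, (U <= G <= V)%VS, (\dim G + n)%N = \dim V & z \notin G].
Proof.
move=> rU rV UV zV ze zU; pose W := (U + <[z]> * fullv)%VS.
have zW : z \in W.
  apply: (subvP (addvSr _ _)); apply/memv_linel.
  by exists 1; rewrite ?memvf ?mulr1.
have rW : right_ideal W := right_idealD rU (right_ideal_mulf _).
have WV : (W <= V)%VS.
  rewrite subv_add UV; apply/subvP => u /memv_linel[b _ ->].
  exact: (proj1 (right_idealP V)).
have [Z rZ [WZ capWZ]] := right_ideal_compl ee e_neq0 e_min e_gen rW.
have WZV : (W + Z :&: V = V)%VS by rewrite vspace_modl // WZ capfv.
have cap0 : (W :&: (Z :&: V) = 0)%VS by rewrite capvA capWZ cap0v.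
have Uc0 : (U :&: (Z :&: V) = 0)%VS.
  by apply/eqP; rewrite -subv0 -cap0 capvS // addvSl.
exists (U + Z :&: V)%VS; split.
- exact: right_idealD rU (right_ideal_cap rZ rV).
- by rewrite addvSl subv_add UV capvSr.
- rewrite dimv_disjoint_sum // -[in RHS]WZV dimv_disjoint_sum //.
  by rewrite dim_add_line // addnAC.
apply: contra zU => /memv_addP[u uU [t tZ zE]].
have t0 : t = 0.
  apply/eqP; rewrite -memv0 -cap0 memv_cap tZ andbT.
  have -> : t = z - u by rewrite zE addrC addKr.
  by rewrite rpredB // (subvP (addvSl _ _)).
by rewrite zE t0 addr0.
Qed.

Lemma hyperplane_ideal U V z : right_ideal U -> right_ideal V -> (U <= V)%VS ->
    ~~ (V <= U)%VS -> z * e = z -> z \notin U ->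
  exists G, [/\ right_ideal G, (U <= G <= V)%VS, (\dim G + n)%N = \dim V & z \notin G].
Proof.
move=> rU rV UV VU ze zU; have [zV|zV] := boolP (z \in V).
  exact: hyperplane_ideal_in.
have [z' [zV' ze' zU']] := minimal_step ee e_min e_gen rU rV VU.
have [|G [rG /andP[UG GV] dG _]] := hyperplane_ideal_in rU rV UV zV' ze'.
  by apply: contra e_neq0 => h; apply/eqP/zU' => //; rewrite ze'.
exists G; rewrite UG GV; split=> //; apply: contra zV; exact: (subvP GV).
Qed.

Lemma moved_element U V z : right_ideal U -> right_ideal V ->
    ~~ (<[z]> * U <= V)%VS ->
  exists w, [/\ w \in U, w * e = w & z * w \notin V].
Proof.
move=> rU rV zUV; pose U' := (U :&: (amull z @^-1: V))%VS.
have rU' : right_ideal U'.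
  apply: right_ideal_cap => //; apply/right_idealP => u b.
  by rewrite -!memv_preim !amullE mulrA; apply: (proj1 (right_idealP V)).
have UU' : ~~ (U <= U')%VS.
  apply: contra zUV; rewrite subv_cap => /andP[_ /subvP UzV].
  by apply/subvP => _ /memv_linel[u uU ->]; rewrite -amullE memv_preim UzV.
have [w [wU we wU']] := minimal_step ee e_min e_gen rU' rU UU'.
exists w; split=> //; rewrite -amullE memv_preim; apply: contra e_neq0 => zw.
by apply/eqP/wU'; rewrite // we memv_cap wU.
Qed.

Section Test.
Variables (C : nat -> {vspace B}) (d j a : nat) (z : B).
Hypothesis C_ideal : forall i, (1 <= i <= n)%N -> right_ideal (C i).
Hypothesis C_dim : forall i, (1 <= i <= n)%N -> \dim (C i) = (i * n)%N.
Hypothesis C_mono : forall i k, (1 <= i)%N -> (i <= k <= n)%N -> (C i <= C k)%VS.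
Hypotheses (jd : (1 <= j <= d)%N) (ja : (j <= a)%N) (adn : (a + 1 + (d - j) <= n)%N).
Hypothesis zC : ~~ (<[z]> * C a <= C a)%VS.

Let an : (1 <= a <= n)%N. Proof. move: jd ja adn; lia. Qed.

(** If [z] moves [C j.-1] out of [C a], then [U] is [C j]; otherwise [U] is the sum of [C j.-1] and
    of [w B], with [w] an element of [C a] that [z] moves out of it. *)
Lemma test_ideal_low : exists U w, [/\ right_ideal U, \dim U = (j * n)%N,
  (U <= C a)%VS, forall i, (1 <= i < j)%N -> (C i <= U)%VS &
  [/\ w \in U, w * e = w & z * w \notin C a]].
Proof.
(* [C 0] is unspecified, so 0 is put in its place. *)
pose D := if j == 1%N then 0%VS else C j.-1.
have j1 : (1 <= j)%N by case/andP: jd.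
have rD : right_ideal D.
  rewrite /D; case: eqP => [_|j1']; first exact: right_ideal0.
  apply: C_ideal; move: j1' an ja jd; clear -n; lia.
have dD : (\dim D + n)%N = (j * n)%N.
  rewrite /D; case: eqP => [->|j1']; first by rewrite dimv0 mul1n.
  rewrite C_dim; last by move: j1' an ja jd; clear -n; lia.
  by case: (j) j1 => // j' _; rewrite mulSn addnC.
have CD i : (1 <= i < j)%N -> (C i <= D)%VS.
  rewrite /D => ij; case: eqP => [j1'|_]; first by move: ij; rewrite j1'; clear -n; lia.
  apply: C_mono; move: ij an ja jd; clear -n; lia.
have DC : (D <= C j)%VS.
  rewrite /D; case: eqP => [_|j1']; first exact: sub0v.
  apply: C_mono; move: j1' an ja jd; clear -n; lia.
have Cja : (C j <= C a)%VS by apply: C_mono; move: an ja jd; clear -n; lia.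
have DCa := subv_trans DC Cja; have rCa := C_ideal an.
have [zD|zD] := boolP (<[z]> * D <= C a)%VS.
  have [w [wC we zw]] := moved_element rCa rCa zC.
  have wD : w \notin D.
    by apply: contra zw => wD; apply: (subvP zD); rewrite memv_mul ?memv_line.
  have wBC : (<[w]> * fullv <= C a)%VS.
    by apply/subvP => _ /memv_linel[b _ ->]; apply: (proj1 (right_idealP _)).
  exists (D + <[w]> * fullv)%VS, w; split=> //.
  - exact: right_idealD rD (right_ideal_mulf _).
  - by rewrite dim_add_line.
  - by rewrite subv_add DCa.
  - by move=> i /CD CiD; apply: subv_trans CiD (addvSl _ _).
  split=> //; apply: (subvP (addvSr _ _)); apply/memv_linel.
  by exists 1; rewrite ?memvf ?mulr1.
have [w [wD we zw]] := moved_element rD rCa zD.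
exists (C j), w; split=> //.
- by apply: C_ideal; move: an ja jd; clear -n; lia.
- by apply: C_dim; move: an ja jd; clear -n; lia.
- by move=> i /CD CiD; apply: subv_trans CiD DC.
by split=> //; apply: (subvP DC).
Qed.

(* [J + C a] has codimension one in its member [C (a + 1 + (d - j))] of the
   chain and avoids an element of [z (J :&: C a)]. *)
Lemma test_ideal : exists J w, [/\ right_ideal J, \dim J = (d * n)%N,
    \dim (J :&: C a) = (j * n)%N,
    [/\ w \in (J :&: C a)%VS & z * w \notin (C a + J)%VS] &
    (forall i, (1 <= i < j)%N -> (i * n <= \dim (J :&: C i))%N) /\
    forall r, (r <= d - j)%N -> ((j + r) * n <= \dim (J :&: C (a + 1 + r)))%N].
Proof.
have [U [w [rU dU UC CU [wU we zw]]]] := test_ideal_low.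
pose N := (a + 1 + (d - j))%N; have Nn0 : (N <= n)%N by [].
have Nn : (1 <= N <= n)%N by rewrite Nn0 /N addn1 addSn.
have rCa := C_ideal an; have rCN := C_ideal Nn.
have aN : (C a <= C N)%VS by apply: C_mono; move: an adn; rewrite /N; clear -n; lia.
have Na : ~~ (C N <= C a)%VS.
  apply/negP => /dimvS; rewrite !C_dim // leq_pmul2r //.
  by apply/negP; rewrite -ltnNge /N addn1 addSn ltnS leq_addr.
have zwe : z * w * e = z * w by rewrite -mulrA we.
have [G [rG /andP[aG GN] dG zG]] := hyperplane_ideal rCa rCN aN Na zwe zw.
have dG' : \dim G = ((a + (d - j)) * n)%N.
  apply/eqP; rewrite -(eqn_add2r n) dG C_dim // /N -addnA addnCA addnA.
  by rewrite [(1 + a)%N]addnC -addnA add1n addnS mulSn addnC.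
have [Z rZ [CZ capCZ]] := right_ideal_compl ee e_neq0 e_min e_gen rCa.
(* [Q] is a complement of [C a] in [G]; so [U + Q] has reduced rank [d], meets [C a] in [U] only,
   and adds up with [C a] to [G], which avoids [z * w]. *)
pose Q := (Z :&: G)%VS.
have CQ : (C a + Q = G)%VS by rewrite vspace_modl // CZ capfv.
have capCQ : (C a :&: Q = 0)%VS by rewrite capvA capCZ cap0v.
have capUQ : (U :&: Q = 0)%VS by apply/eqP; rewrite -subv0 -capCQ capvS.
have dQ : \dim Q = ((d - j) * n)%N.
  by apply/eqP; rewrite -(eqn_add2l (\dim (C a))) -dimv_disjoint_sum // CQ dG' C_dim // mulnDl.
have CJ : (C a + (U + Q) = G)%VS by rewrite addvA (addv_idPl UC).
have dJ : \dim (U + Q) = (d * n)%N.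
  by rewrite dimv_disjoint_sum // dU dQ -mulnDl subnKC //; case/andP: jd.
exists (U + Q)%VS, w; split=> //.
- exact: right_idealD rU (right_ideal_cap rZ rG).
- have := dimv_sum_cap (U + Q) (C a); rewrite addvC CJ dJ dG' C_dim // -mulnDl => h.
  apply/eqP; rewrite -(eqn_add2l ((a + (d - j)) * n)) h -mulnDl eqn_pmul2r //.
  by move: jd; clear -n; lia.
- by rewrite CJ memv_cap (subvP (addvSl _ _)) // (subvP UC).
split=> [i ij|r rd].
  rewrite -C_dim; last by move: ij an ja jd; clear -n; lia.
  by apply: dimvS; rewrite subv_cap subvv andbT (subv_trans (CU _ ij)) ?addvSl.
set N' := (a + 1 + r)%N; have N'n : (1 <= N' <= n)%N.
  by move: adn rd; rewrite /N /N'; clear -n; lia.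
have N'N : (C N' <= C N)%VS.
  by apply: C_mono; move: adn rd; rewrite /N /N'; clear -n; lia.
have aN' : (C a <= C N')%VS.
  by apply: C_mono; move: adn an rd; rewrite /N /N'; clear -n; lia.
apply: leq_trans (_ : \dim (U + (Q :&: C N')) <= _)%N; last first.
  apply: dimvS; rewrite subv_cap !subv_add addvSl (subv_trans (capvSl _ _)) ?addvSr //.
  by rewrite (subv_trans UC) //= capvSr.
rewrite dimv_disjoint_sum; last first.
  by apply/eqP; rewrite -subv0 -capUQ capvS // capvSl.
rewrite mulnDl dU leq_add2l.
have QN : (Q + C N' <= C N)%VS.
  by rewrite subv_add N'N andbT (subv_trans (capvSr _ _)).
(* Inside [C N], of reduced rank [a + 1 + (d - j)], the reduced ranks of [Q] and [C N'] are [d - j]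
   and [a + 1 + r], so they meet in reduced rank at least [r]. *)
have := dimvS QN; have := dimv_sum_cap Q (C N'); rewrite !C_dim // dQ.
rewrite -(leq_add2r (\dim (Q :&: C N'))) => -> le.
rewrite -(leq_add2l (N * n)) (leq_trans _ le) // -!mulnDl leq_pmul2r //.
by move: rd; rewrite /N /N'; clear -n; lia.
Qed.

End Test.

End TestIdeal.

(** [M0] is the identity with column [r0] replaced by 0. A permutation other than 1 moves at least
    two indices, so at first order it keeps an entry of [M0] off the diagonal, which is 0; for the
    identity only the term at [r0] avoids the zero column. *)
Lemma coef1_det (R : comNzRingType) k (M0 M1 : 'M[R]_k) (r0 : 'I_k) :
    (forall i r, r != r0 -> M0 i r = (i == r)%:R) -> (forall i, M0 i r0 = 0) ->
  (\det (map_mx polyC M0 + 'X *: map_mx polyC M1))`_1 = M1 r0 r0.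
Proof.
move=> M0E M00; rewrite /determinant coef_sum (bigD1 (1%g : 'S_k)) //=.
have ME (s : 'S_k) : ((-1) ^+ s * \prod_i
    (map_mx polyC M0 + 'X *: map_mx polyC M1) i (s i))`_1 =
    (-1) ^+ s * \sum_j M1 j (s j) * \prod_(i | i != j) M0 i (s i).
  have -> : (-1) ^+ s = ((-1) ^+ s : R)%:P by rewrite polyC_exp polyCN.
  rewrite coefCM -coef1_prod.
  rewrite (eq_bigr (fun i => (M0 i (s i))%:P + 'X * (M1 i (s i))%:P)) // => i _.
  by rewrite !mxE.
rewrite [X in _ + X = _]big1 ?addr0 => [|s s1]; last first.
  rewrite ME [X in _ * X]big1 ?mulr0 // => j _.
  have [i /andP[ij si]] : exists i, (i != j) && (s i != i).
    apply/existsP; apply: contraNT s1 => /existsPn h; apply/eqP/permP => i.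
    rewrite perm1; have fix_ l : l != j -> s l = l.
      by move=> lj; have := h l; rewrite lj /= negbK => /eqP.
    have [->|/fix_//] := eqVneq i j; apply/eqP; apply/negPn/negP => sj.
    by have := fix_ _ sj => /perm_inj; apply/eqP.
  rewrite (bigD1 i) //=; have [->|sr] := eqVneq (s i) r0.
    by rewrite M00 mul0r mulr0.
  by rewrite M0E // eq_sym (negPf si) mul0r mulr0.
rewrite ME odd_perm1 expr0 mul1r (bigD1 r0) //= big1 => [|i ir]; last first.
  by rewrite perm1 M0E // eqxx.
rewrite perm1 mulr1 big1 ?addr0 // => j jr.
by rewrite (bigD1 r0) 1?eq_sym //= !perm1 M00 mul0r mulr0.
Qed.

Lemma generic_line (L : fieldType) :
  exists (M : fieldType) (j : {rmorphism {poly L} -> M}), injective j.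
Proof.
exists {fraction {poly L}}, (tofracR {poly L}) => p q /eqP.
by rewrite tofrac_eq => /eqP.
Qed.

Section LeftMultiplication.
Variables (F : fieldType) (A : falgType F).
Local Notation m := (\dim {:A}).

Definition lmx (L : fieldType) (psi : {rmorphism F -> L}) (v : scext A psi) : 'M[L]_m :=
  \matrix_(i, j) ((v * ((delta_mx 0 i : 'rV[L]_m) : scext A psi) : scext A psi) : 'rV_m) 0 j.

Section OneField.
Variables (L : fieldType) (psi : {rmorphism F -> L}).
Local Notation B := (scext A psi).

Lemma mulmx_lmx (u v : B) : (u : 'rV_m) *m lmx v = v * u :> B.
Proof.
have uE : u = \sum_i (u : 'rV_m) 0 i *: ((delta_mx 0 i : 'rV[L]_m) : B).
  exact: row_sum_delta.
rewrite [in RHS]uE [RHS]mulr_sumr; apply/rowP => j; rewrite mxE summxE.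
apply: eq_bigr => i _; rewrite mxE.
by rewrite -[v * (_ *: _)]scalerAr [RHS]mxE.
Qed.

Lemma lmx_sum k (c : 'I_k -> L) (v : 'I_k -> B) :
  lmx (\sum_(i < k) c i *: v i) = \sum_(i < k) c i *: lmx (v i).
Proof.
apply/matrixP => i j; rewrite mxE [RHS]summxE [in LHS]mulr_suml [LHS]summxE.
apply: eq_bigr => l _.
by rewrite -[in LHS]scalerAl [LHS]mxE [RHS]mxE [in RHS]mxE.
Qed.

End OneField.

Lemma lmx_scmap (K L : fieldType) (phi : {rmorphism F -> K}) (psi : {rmorphism F -> L})
    (tau : {rmorphism K -> L}) (v : scext A phi) :
    (forall x, psi x = tau (phi x)) ->
  lmx (scmap psi tau v) = map_mx tau (lmx v).
Proof.
move=> psiE; apply/matrixP => i j; rewrite !mxE.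
have -> : ((delta_mx 0 i : 'rV[L]_m) : scext A psi) =
    scmap psi tau ((delta_mx 0 i : 'rV[K]_m) : scext A phi).
  by apply/rowP => l; rewrite !mxE rmorph_nat.
by rewrite -(scmapM psiE) mxE.
Qed.

Lemma lmx_scemb (L : fieldType) (psi : {rmorphism F -> L}) (a : A) :
  lmx (scemb psi a) = map_mx psi (lmx (scemb (idfun : {rmorphism F -> F}) a)).
Proof.
have psiE x : psi x = psi ((idfun : {rmorphism F -> F}) x) by [].
by rewrite -(lmx_scmap _ psiE) (scmap_scemb psiE).
Qed.

End LeftMultiplication.

Lemma scspan_comp (F : fieldType) (A : falgType F) (K L M : fieldType)
    (phi : {rmorphism F -> K}) (psi : {rmorphism F -> L}) (rho : {rmorphism F -> M})
    (tau : {rmorphism K -> L}) (ups : {rmorphism L -> M}) (ut : {rmorphism K -> M})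
    (U : {vspace scext A phi}) :
    ut =1 ups \o tau ->
  scspan rho ups (scspan psi tau U) = scspan rho ut U.
Proof.
move=> utE; rewrite [scspan psi tau U]/semispan scspan_span -map_comp.
by congr <<_>>%VS; apply: eq_map => v; apply/rowP => i; rewrite !mxE utE.
Qed.

Lemma card_ord_lt k e : (#|[set r : 'I_k | (r < e)%N]| <= e)%N.
Proof.
rewrite -[X in (_ <= X)%N](size_iota 0) cardE -(size_map val) uniq_leq_size //.
  by rewrite map_inj_uniq ?enum_uniq //; apply: val_inj.
by move=> x /mapP[r]; rewrite mem_enum inE => re ->; rewrite mem_iota.
Qed.

Section EssentialIndices.
Variables (n d : nat) (lam : d.-tuple nat).
Hypotheses (d_bounds : (1 <= d <= n)%N) (lam_sorted : sorted geq lam).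
Hypothesis lam_bound : all (fun x => (x <= n - d)%N) lam.
Local Notation s := (schubert_idx n d lam).

Lemma schubert_idx_ge j : (j <= s j)%N.
Proof. by rewrite /schubert_idx; have := part_le lam_bound j; lia. Qed.

(** At an essential index the sequence [s] jumps by at least 2, and it increases afterwards. So the
    member [a + 1 + r] of the chain in [test_ideal] is contained in the one that the condition of
    index [j + r] involves. *)
Lemma essential_next p i : p \in essential_set n d lam -> (p.1 < i)%N ->
  (p.2 + 1 + (i - p.1) <= s i)%N.
Proof.
move=> /mem_essential[/andP[p0 _] lt ->]; elim: i => // i IH.
rewrite ltnS leq_eqVlt => /predU1P[<-|pi].
  have := part_le lam_bound p.1; have := part_le lam_bound p.1.+1.
  move: lt; rewrite /schubert_idx; clear; lia.
have := schubert_idx_lt d_bounds lam_sorted lam_bound (ltn_trans p0 pi) (ltnSn i).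
have := IH pi; move: pi; clear; lia.
Qed.

Lemma essential_room p : p \in essential_set n d lam ->
  (p.2 + 1 + (d - p.1) <= n)%N.
Proof.
move=> pE; have [/andP[p1 pd] _ _] := mem_essential pE.
move: pd; rewrite leq_eqVlt => /predU1P[->|pd].
  by rewrite subnn addn0 addn1; case/andP: (essential_lt d_bounds lam_sorted lam_bound pE).
apply: leq_trans (essential_next pE pd) _.
have d1 : (1 <= d <= d)%N by rewrite leqnn; case/andP: d_bounds => ->.
by case/andP: (schubert_idx_bounds d_bounds lam_sorted lam_bound d1).
Qed.

End EssentialIndices.

Section Stabilizer.
Variables (F : fieldType) (A : falgType F) (n : nat).
Local Notation m := (\dim {:A}).
Hypothesis degA : m = (n ^ 2)%N.
Variables (K : fieldType) (phi : {rmorphism F -> K}).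
Hypothesis K_splits : splits A n phi.
Variable d : nat.
Hypothesis d_bounds : (1 <= d <= n)%N.
Variable lam : d.-tuple nat.
Hypotheses (lam_sorted : sorted geq lam).
Hypothesis lam_bound : all (fun x => (x <= n - d)%N) lam.
Variable C : nat -> {vspace scext A phi}.
Hypothesis C_full : full_chain n C.

Local Notation E := (essential_set n d lam).
Local Notation s := (schubert_idx n d lam).
Local Notation SI := (schubert_ideal (n := n) (d := d) lam C).

Let d_gt0 : (0 < d)%N. Proof. by case/andP: d_bounds. Qed.
Let n_gt0 : (0 < n)%N. Proof. by case/andP: d_bounds => d0; apply: leq_trans. Qed.
Let SBE L psi := SB_dim d n_gt0 degA K_splits (L := L) (psi := psi).
Let schubertE L tau := schubert_essential degA K_splits d_bounds lam_sorted lam_bound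
  C_full (L := L) (tau := tau).

Section Flow.
Variables (L : fieldType) (tau : {rmorphism K -> L}).
Variables (J : {vspace scext A (tau \o phi)}) (x : scext A phi).
Hypothesis x_stable : forall p, p \in E -> (<[x]> * C p.2 <= C p.2)%VS.
Hypothesis sJ : schubert n d lam C J.

(* multiplication by [1 + t x], for [t] an indeterminate, moves [J] in [X_lambda] *)
Lemma flow_schubert (b : (d * n).-tuple (scext A (tau \o phi))) : basis_of J b ->
  exists (M : fieldType) (j : {rmorphism {poly L} -> M}) (jC : {rmorphism L -> M})
    (J' : {vspace scext A ((jC \o tau) \o phi)})
    (b' : (d * n).-tuple (scext A ((jC \o tau) \o phi))),
  [/\ injective j, jC =1 j \o polyC, schubert n d lam C J', basis_of J' b' &
      rowsmx b' = map_mx j (flow (rowsmx b) (map_mx tau (lmx x)))].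
Proof.
move=> bJ; have [M [j j_inj]] := generic_line L.
pose jC : {rmorphism L -> M} := j \o polyC.
pose tau' : {rmorphism K -> M} := jC \o tau.
pose rho : {rmorphism F -> M} := tau' \o phi.
have rhoE a : rho a = jC ((tau \o phi) a) by [].
have rhoE' a : rho a = tau' (phi a) by [].
pose t := j 'X; pose u := 1 + t *: scmap rho tau' x.
pose JM := scspan rho jC J; pose bM := map_tuple (scmap rho jC) b.
have bJM : basis_of JM bM := scmap_basis rhoE bJ.
pose J' := (amull u @: JM)%VS; pose b' := map_tuple ( *%R u) bM.
have b'E : rowsmx b' = map_mx j (flow (rowsmx b) (map_mx tau (lmx x))).
  apply/matrixP => i l; rewrite mxE !tnth_map.
  set v := tnth b i; set xL := scmap (tau \o phi) tau x.
  have -> : u * scmap rho jC v = scmap rho jC v + t *: scmap rho jC (xL * v).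
    rewrite mulrDl mul1r -[t *: _ * _]scalerAl (scmapM rhoE); congr (_ + t *: (_ * _)).
    by apply/rowP => c; rewrite !mxE.
  have xvE : ((xL * v : scext A (tau \o phi)) : 'rV_m) 0 l =
      (rowsmx b *m map_mx tau (lmx x)) i l.
    rewrite -mulmx_lmx (lmx_scmap (psi := tau \o phi) (tau := tau)) // !mxE.
    by apply: eq_bigr => c _; rewrite !mxE.
  rewrite [LHS]mxE [X in _ + X]mxE [RHS]mxE [flow _ _ i l]mxE rmorphD; congr (_ + _).
    by rewrite !mxE.
  rewrite [in RHS]mxE rmorphM; congr (t * _).
  by rewrite [RHS](congr1 j (mxE _ _ _ _)) -xvE [LHS]mxE.
(* At [t = 0] the moved tuple specializes to [b], so its Plücker coordinates are not all 0. *)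
have b'f : free b'.
  rewrite free_rowsmx plmx_row_free b'E.
  have /plmx_row_free[y yN0] : row_free (rowsmx b) by rewrite -free_rowsmx (basis_free bJ).
  exists y; rewrite plmx_map; apply: contra_neq yN0 => /eqP.
  rewrite -(rmorph0 j) => /eqP/j_inj fl0.
  by rewrite -(plmx_flow0 _ (map_mx tau (lmx x))) fl0 coef0.
have b'J : basis_of J' b'.
  apply/andP; split=> //; rewrite /J' -(span_basis bJM) limg_span; apply/eqP.
  by congr <<_>>%VS; apply: eq_map => v; rewrite amullE.
have dJM : \dim JM = (d * n)%N by rewrite (vector.size_basis bJM).
have dJ' : \dim J' = (d * n)%N by rewrite (vector.size_basis b'J).
have ker0 : (JM :&: lker (amull u) = 0)%VS.
  apply/eqP; rewrite -dimv_eq0 -(eqn_add2r (\dim J')) limg_ker_dim dJ' dJM.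
  by rewrite add0n.
have [[rJ _] cJ] := (schubertE _).1 sJ.
have rJM : right_ideal JM by apply: scspan_right_ideal.
exists M, j, jC, J', b'; split=> //.
apply: (schubertE _).2; split.
  apply/SBE; split=> //; apply/right_idealP => v w /memv_imgP[v' v'J ->].
  by rewrite amullE -mulrA -amullE memv_img // (right_idealP _).1.
move=> p pE; rewrite -[scspan _ _ _]/(scspan rho tau' (C p.2)).
set Cp := scspan rho tau' (C p.2).
have CpE : Cp = scspan rho jC (scspan (tau \o phi) tau (C p.2)).
  by rewrite (@scspan_comp _ _ _ _ _ _ (tau \o phi) rho tau jC tau').
have sub : (amull u @: (JM :&: Cp) <= J' :&: Cp)%VS.
  rewrite subv_cap limgS ?capvSl //=.
  apply/subvP => v /memv_imgP[w wJC ->]; have wC : w \in Cp := subvP (capvSr _ _) _ wJC.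
  rewrite amullE mulrDl mul1r -[t *: _ * _]scalerAl rpredD // rpredZ //.
  apply: (subvP (scspanS rho tau' (x_stable pE))).
  by rewrite (scspan_prod rhoE') scspan_line memv_mul // memv_line.
apply: leq_trans (cJ p pE) _; rewrite /rrank leq_div2r //.
rewrite -(dim_scspan rhoE) (scspan_cap rhoE) -/JM -CpE -(limg_dim_eq (f := amull u)).
  exact: dimvS.
by apply/eqP; rewrite -subv0 -ker0 capvS // capvSl.
Qed.

End Flow.

(** [f] vanishes along the curve of [flow_schubert], which stays in [X_lambda], so the coefficient
    of [t] is 0. *)
Lemma stable_polar (x : scext A phi) f :
    (forall p, p \in E -> (<[x]> * C p.2 <= C p.2)%VS) -> SI f ->
  SI (polar (lmx x) f).
Proof.
move=> x_st If L tau J sJ b bJ.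
have [M [j [jC [J' [b' [j_inj jCE sJ' b'J b'E]]]]]] := flow_schubert x_st sJ bJ.
rewrite map_polar (meval_eq _ (pluecker_rowsmx b)) meval_polar.
set g := (_.@[_]); suff -> : g = 0 by rewrite coef0.
apply: j_inj; rewrite rmorph0 -(If _ _ _ sJ' _ b'J) /g -map_meval map_mpoly_mpoly.
rewrite map_mpoly_mpoly.
have -> : map_mpoly (j \o polyC \o tau) f = map_mpoly (jC \o tau) f.
  by apply/mpolyP => mn; rewrite !mcoeff_map_mpoly; apply: esym (jCE _).
by apply: meval_eq => y; rewrite pluecker_rowsmx b'E plmx_map.
Qed.

Lemma separating_functional (L : fieldType) (psi : {rmorphism F -> L})
    (U : {vspace scext A psi}) v : v \notin U ->
  exists T : 'cV[L]_m, (forall u, u \in U -> (u : 'rV_m) *m T = 0) /\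
    ((v : 'rV_m) *m T) 0 0 != 0.
Proof.
move=> vU; have v0 : v != 0 by apply: contraNneq vU => ->; rewrite mem0v.
have cap0 : \dim (<[v]> :&: U) = 0%N.
  apply/eqP; rewrite dimv_eq0 -subv0; apply/subvP => w.
  rewrite memv_cap memv0 => /andP[/vlineP[c ->]]; have [->|c0] := eqVneq c 0.
    by rewrite scale0r.
  by move=> cvU; case/negP: vU; rewrite -[v](scalerK c0) rpredZ.
have dv : \dim <[v]> = 1%N by rewrite dim_vline v0.
have [b [T [bv bT _ _ TU]]] := adapted_functionals U dv.
exists T; split=> [u uU|].
  by apply/rowP => r; rewrite ord1 TU ?mxE // cap0.
have /vlineP[c bE] : tnth b 0 \in <[v]>%VS by apply: (basis_mem bv); apply: mem_tnth.
have /eqP : (rowsmx b *m T) 0 0 = 1 by rewrite bT mxE.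
have -> : (rowsmx b *m T) 0 0 = ((tnth b 0 : 'rV_m) *m T) 0 0.
  by rewrite !mxE; apply: eq_bigr => i _; rewrite mxE.
rewrite bE -scalemxAl mxE; apply: contraTneq => ->.
by rewrite mulr0 eq_sym oner_eq0.
Qed.

Lemma polar_stable (x : scext A phi) p :
    (forall f, SI f -> SI (polar (lmx x) f)) -> p \in E ->
  (<[x]> * C p.2 <= C p.2)%VS.
Proof.
move=> q pE; apply/negPn/negP => xC; pose j := p.1; pose a := p.2.
have [jd lt sE] := mem_essential pE.
have an := essential_lt d_bounds lam_sorted lam_bound pE.
have an' : (1 <= a <= n)%N by case/andP: an => -> /ltnW.
pose tau : {rmorphism K -> K} := idfun.
pose psi : {rmorphism F -> K} := tau \o phi.
have psiE b : psi b = tau (phi b) by [].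
pose sm := scmap psi tau : scext A phi -> scext A psi.
have [e [x' [y' sd0]]] := splits_data n_gt0 degA K_splits.
have sd := scmap_split_data psiE sd0.
pose C' i := scspan psi tau (C i).
have C'r i : (1 <= i <= n)%N -> right_ideal (C' i).
  by move=> iN; apply: (scspan_right_ideal psiE); apply: (full_chain_ideal C_full).
have C'd i : (1 <= i <= n)%N -> \dim (C' i) = (i * n)%N.
  move=> iN; rewrite (dim_scspan psiE).
  exact: (full_chain_dim degA K_splits d_bounds C_full).
have C'm i k : (1 <= i)%N -> (i <= k <= n)%N -> (C' i <= C' k)%VS.
  by move=> i1 ik; apply: scspanS; apply: (full_chain_mono C_full).
have adn := essential_room d_bounds lam_sorted lam_bound pE.
have ja : (j <= a)%N by rewrite /a sE; apply: schubert_idx_ge.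
have zC : ~~ (<[sm x]> * C' a <= C' a)%VS.
  by rewrite -scspan_line -(scspan_prod psiE) scspanSE.
have [J [w [rJ dJ dJC [wJC zw] [Jlo Jhi]]]] :=
  test_ideal n_gt0 sd C'r C'd C'm jd ja adn zC.
have sJ : @schubert F A n d lam K phi C K tau J.
  split; first by apply/SBE.
  move=> i id; rewrite -[extend_vs2 _ _]/(C' (s i)) /rrank leq_divRL //.
  have [ij|ji|ij] := ltngtP i j.
  - apply: leq_trans (Jlo i _) _; first by rewrite ij andbT; case/andP: id.
    apply/dimvS/capvS => //; apply: C'm; first by case/andP: id.
    rewrite schubert_idx_ge //=.
    by case/andP: (schubert_idx_bounds d_bounds lam_sorted lam_bound id).
  - case/andP: (id) => _ id'; have := Jhi (i - j)%N; rewrite leq_sub2r // => /(_ isT).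
    rewrite subnKC; last exact: ltnW.
    move=> h; apply: leq_trans h _; apply/dimvS/capvS => //; apply: C'm.
      by rewrite addn1 addSn.
    rewrite (essential_next d_bounds lam_sorted lam_bound pE ji) /=.
    by case/andP: (schubert_idx_bounds d_bounds lam_sorted lam_bound id).
  by rewrite ij -sE -/a dJC.
have [b [T [bJ bT bC JC TC]]] := adapted_functionals (C' a) dJ.
rewrite dJC in bC JC TC; pose U := (C' a + J)%VS.
(* The first [j * n] vectors of [b] span [J :&: C' a], which contains [w]; as [x] moves [w] out of
   [U], it moves one of these vectors out of [U]. *)
have [r0 r0j zb] : exists2 r0 : 'I_(d * n), (r0 < j * n)%N & sm x * tnth b r0 \notin U.
  apply: NNPP => none; case/negP: zw; rewrite -amullE memv_preim.
  apply: (subvP _ _ wJC); apply: subv_trans JC _; apply/span_subvP => v /(nthP 0)[i].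
  rewrite size_take_min leq_min size_tuple => /andP[ij idn] <-.
  rewrite nth_take // -memv_preim amullE; apply/negPn/negP => zbi; case: none.
  by exists (Ordinal idn); rewrite ?(tnth_nth 0).
have [T0 [T0U T0z]] := separating_functional zb.
(* Column [r0] becomes a functional that vanishes on [C' a + J] but not at the moved vector. Now
   more than [d * n - j * n] columns, those of [R], vanish on [C a], so the determinant is an
   equation of [X_lambda]. *)
pose T' : 'M[K]_(m, d * n) := \matrix_(c, r) if r == r0 then T0 c 0 else T c r.
have TE (u : scext A psi) r : ((u : 'rV_m) *m T') 0 r =
    if r == r0 then ((u : 'rV_m) *m T0) 0 0 else ((u : 'rV_m) *m T) 0 r.
  rewrite !mxE; case: eqP => [->|/eqP/negPf rr0]; apply: eq_bigr => c _.
    by rewrite mxE eqxx.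
  by rewrite mxE rr0.
pose R := r0 |: ~: [set r : 'I_(d * n) | (r < j * n)%N].
have cR : (d * n < j * n + #|R|)%N.
  rewrite cardsU1 !inE r0j /= addnA addn1 addSn ltnS.
  have := cardsC [set r : 'I_(d * n) | (r < j * n)%N]; rewrite card_ord => kE.
  rewrite -{1}kE. by rewrite leq_add2r card_ord_lt.
have Cu (u : scext A phi) r : u \in C a -> r \in R -> ((u : 'rV_m) *m T') 0 r = 0.
  move=> uC rR; have smu : (sm u : 'rV_m) = (u : 'rV_m) by apply/rowP => i; rewrite mxE.
  have smC : sm u \in C' a by apply: mem_scspan.
  rewrite -smu TE; case: eqP => [_|/eqP rr0].
    by rewrite T0U ?mxE // (subvP (addvSl _ _)).
  apply: TC => //; move: rR; rewrite !inE (negPf rr0) /= -leqNgt => h; exact: h.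
have SIg : SI (linform (detform T')).
  move=> L tau1 J1 [SBJ1 cJ1].
  apply: (detform_vanishes (phi := phi) (R := R) (U := C a)) => //.
  apply: leq_trans cR _; rewrite leq_add2r.
  by have := cJ1 _ jd; rewrite -sE /rrank leq_divRL.
have := q _ SIg _ _ _ sJ _ bJ.
rewrite map_polar (meval_eq _ (pluecker_rowsmx b)) meval_polar.
rewrite (map_linform tau (detform T')).
rewrite (map_linform (@polyC K) (fun y => tau (detform T' y))) meval_linform.
pose M0 := rowsmx b *m T'; pose M1 := rowsmx b *m lmx (sm x) *m T'.
have -> : \sum_y polyC (tau (detform T' y)) * plmx (flow (rowsmx b) (map_mx tau (lmx x))) y
    = \det (map_mx polyC M0 + 'X *: map_mx polyC M1).
  rewrite /M0 /M1 [map_mx polyC (rowsmx b *m T')]map_mxM.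
  rewrite [map_mx polyC (_ *m _ *m T')]map_mxM scalemxAl -mulmxDl.
  rewrite (lmx_scmap _ psiE) -[_ + _]/(flow _ _) -detformE.
  apply: eq_bigr => y _; congr (_ * _); rewrite rmorph_prod.
  apply: eq_bigr => c _. by rewrite [RHS]mxE.
have rowE (u : scext A psi) i (B : 'M_(d * n, m)) (S : 'M_(m, d * n)) r :
    row i B = (u : 'rV_m) -> (B *m S) i r = ((u : 'rV_m) *m S) 0 r.
  by move=> <-; rewrite -row_mul [RHS]mxE.
have rowb i : row i (rowsmx b) = (tnth b i : 'rV_m) by apply/rowP => c; rewrite !mxE.
(* Along [1 + t x] the coefficient of [t] in the determinant is [M1 r0 r0], the value of the new
   functional at the moved vector, which is not 0. *)
rewrite (@coef1_det K _ M0 M1 r0) => [||i].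
- rewrite (rowE (sm x * tnth b r0)) ?TE ?eqxx; first exact/eqP.
  by rewrite row_mul rowb mulmx_lmx.
- move=> i r rr0; rewrite (rowE _ _ _ _ _ (rowb i)) TE (negPf rr0) -(rowE _ _ _ _ _ (rowb i)).
  by rewrite bT mxE.
rewrite (rowE _ _ _ _ _ (rowb i)) TE eqxx T0U ?mxE // (subvP (addvSr _ _)) //.
by apply: (basis_mem bJ); apply: mem_tnth.
Qed.

End Stabilizer.

(** * Descent of the flag *)

Section Rationality.
Variables (F : fieldType) (A : falgType F) (K : fieldType) (phi : {rmorphism F -> K}).
Local Notation B := (scext A phi).

(** For a subspace: to be spanned by elements of [A]. It is stated on predicates, through components
    over [F], because [tangent] and [conductor] are given by conditions. *)
Definition rational (S : B -> Prop) := forall cs, indep_over phi cs ->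
  forall a : nat -> A, S (\sum_(i < size cs) cs`_i *: scemb phi (a i)) ->
  forall i, (i < size cs)%N -> S (scemb phi (a i)).

Lemma scext_decomp (v : B) : exists2 cs, indep_over phi cs &
  exists a : nat -> A, v = \sum_(i < size cs) cs`_i *: scemb phi (a i).
Proof.
have [cs csi csP] := Fspan_decomp phi [seq (v : 'rV_(\dim {:A})) 0 j | j <- enum 'I_(\dim {:A})].
exists cs => //.
have /fin_all_exists[f fE] (j : 'I_(\dim {:A})) : exists f : nat -> F,
    (v : 'rV_(\dim {:A})) 0 j = \sum_(i < size cs) cs`_i * phi (f i).
  by apply: csP; apply: map_f; rewrite mem_enum.
exists (fun i => \sum_j f j i *: tnth (vbasis {:A}) j).
rewrite [LHS]scextE (eq_bigr _ (fun j _ => congr1 (fun c => c *: _) (fE j))).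
under eq_bigr do rewrite scaler_suml.
rewrite exchange_big /=; apply: eq_bigr => i _.
rewrite scemb_sumZ scaler_sumr; apply: eq_bigr => j _.
by rewrite scalerA.
Qed.

Lemma scemb_indep (cs : seq K) (a : nat -> A) : indep_over phi cs ->
    \sum_(i < size cs) cs`_i *: scemb phi (a i) = 0 ->
  forall i, (i < size cs)%N -> a i = 0.
Proof.
move=> csi s0 i ic; rewrite (coord_vbasis (memvf (a i))) big1 // => j _.
rewrite [X in X *: _](csi (fun l => coord (vbasis {:A}) j (a l)) _ i ic) ?scale0r //.
move/rowP/(_ j): s0; rewrite summxE mxE => s0; rewrite -[RHS]s0.
by apply: eq_bigr => l _; rewrite !mxE.
Qed.

(** [I] is a subspace of [A] of largest dimension with extension in [S]. The components of an
    element of [S] are in [S], hence in [I] by maximality. *)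
Lemma rational_extend (S : {vspace B}) : rational (fun v => v \in S) ->
  exists I, S = extend_vs phi I.
Proof.
move=> ratS; pose P k := exists2 I : {vspace A}, (extend_vs phi I <= S)%VS &
  (\dim {:A} - \dim I)%N = k.
have [|k [I IS dI] kmin] := @exists_minimal P (\dim {:A}).
  exists 0%VS; rewrite ?dimv0 ?subn0 // (_ : extend_vs phi 0 = 0%VS) ?sub0v //.
  by apply/eqP; rewrite -dimv_eq0 dim_extend_vs dimv0.
exists I; apply: subv_anti; rewrite IS andbT; apply/subvP => v vS.
have [cs csi [a vE]] := scext_decomp v; rewrite vE in vS *.
apply: rpred_sum => i _; apply: rpredZ; rewrite mem_extend_vsE.
have aS := ratS _ csi a vS i (ltn_ord i).
have IaS : (extend_vs phi (I + <[a i]>) <= S)%VS.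
  rewrite [extend_vs _ _](semispanD (scembD phi) (scembZ phi)) subv_add IS /=.
  by rewrite -span_seq1 (semispan_span (scembD phi) (scembZ phi)) /= span_seq1 -memvE.
have := kmin _ (ex_intro2 _ _ (I + <[a i]>)%VS IaS erefl); rewrite -dI.
have le1 : (\dim (I + <[a i]>) <= \dim {:A})%N by apply/dimvS/subvf.
have le2 : (\dim I <= \dim {:A})%N by apply/dimvS/subvf.
move=> le3; have le4 : (\dim (I + <[a i]>) <= \dim I)%N.
  move: le1 le2 le3; move: (\dim _) (\dim _) (\dim _) => p q r; clear; lia.
have /eqP -> : I == (I + <[a i]>)%VS by rewrite eqEdim addvSl.
by rewrite memvE addvSr.
Qed.

End Rationality.

Section FlagDescent.
Variables (F : fieldType) (A : falgType F) (n : nat).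
Local Notation m := (\dim {:A}).
Hypothesis degA : m = (n ^ 2)%N.
Variables (K : fieldType) (phi : {rmorphism F -> K}).
Hypothesis K_splits : splits A n phi.
Variable d : nat.
Hypothesis d_bounds : (1 <= d <= n)%N.
Variable lam : d.-tuple nat.
Hypotheses (lam_sorted : sorted geq lam).
Hypothesis lam_bound : all (fun x => (x <= n - d)%N) lam.
Variable C : nat -> {vspace scext A phi}.
Hypothesis C_full : full_chain n C.
Variable P : closed_subvariety A n d.
Hypothesis PC : forall g, ext_ideal P phi g <-> schubert_ideal lam C g.

Local Notation B := (scext A phi).
Local Notation E := (essential_set n d lam).
Local Notation SI := (schubert_ideal (n := n) (d := d) lam C).

Let n_gt0 : (0 < n)%N. Proof. by case/andP: d_bounds => d0; apply: leq_trans. Qed.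

Let SIE g : SI g <-> in_ext phi P g.
Proof. by rewrite -PC ext_ideal_in_ext. Qed.

Let SI_sum k (c : 'I_k -> K) f : (forall i, SI (f i)) -> SI (\sum_(i < k) c i *: f i).
Proof.
move=> If; apply/SIE/in_ext_sum => [|i _]; first exact: csv_ideal0.
exact/in_extZ/SIE.
Qed.

(* the Lie algebra of the stabilizer of [P_K] in the unit group of [A_K] *)
Definition tangent (x : B) := forall f, P f -> SI (polar (lmx x) (map_mpoly phi f)).

Lemma tangent_stable (x : B) : tangent x <->
  forall p, p \in E -> (<[x]> * C p.2 <= C p.2)%VS.
Proof.
split=> [tx p pE|x_st f Pf]; last first.
  apply: (stable_polar degA K_splits d_bounds lam_sorted lam_bound C_full x_st).
  exact/SIE/in_ext_map.
apply: (polar_stable degA K_splits d_bounds lam_sorted lam_bound C_full _ pE).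
move=> f /SIE[r [c [g [Pg ->]]]]; rewrite polar_sum; apply: SI_sum => i.
exact: tx.
Qed.

Lemma tangent_sum k (c : 'I_k -> K) (x : 'I_k -> B) :
  (forall i, tangent (x i)) -> tangent (\sum_(i < k) c i *: x i).
Proof.
move=> tx f Pf; rewrite lmx_sum polar_suml; apply: SI_sum => i; exact: tx.
Qed.

(** For [f] over [F], [polar (lmx x) f] is linear in [x], and is a polynomial over [F] when [x]
    comes from [A]; so its components on an independent list lie in the ideal of [P], by
    [in_ext_coords]. *)
Lemma tangent_rational : rational tangent.
Proof.
move=> cs csi a ta i ic f Pf.
pose D j := polar (lmx (scemb (idfun : {rmorphism F -> F}) (a j))) f.
have DE j : polar (lmx (scemb phi (a j))) (map_mpoly phi f) = map_mpoly phi (D j).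
  by rewrite map_polar -lmx_scemb.
rewrite DE; apply/SIE/in_ext_map; move: i ic.
apply: (in_ext_coords (tau := phi) (cs := cs)) => //.
- exact: csv_ideal0.
- exact: csv_idealD.
- by move=> b g Pg; rewrite -mul_mpolyC; apply: csv_idealM.
have := ta f Pf; rewrite lmx_sum polar_suml => /SIE.
by under eq_bigr do rewrite DE.
Qed.

Section Conductor.
Variable p : nat * nat.
Hypothesis pE : p \in E.
Hypothesis I_prev : forall q, q \in E -> (q.2 < p.2)%N ->
  exists I, C q.2 = extend_vs phi I.

Definition annihilates (z : B) := forall q, q \in E -> (q.2 < p.2)%N ->
  forall c, c \in C q.2 -> z * c = 0.

Lemma annihilates_rational : rational annihilates.
Proof.
move=> cs csi a az i ic q qE qp; have [I CI] := I_prev qE qp.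
suff sub : (C q.2 <= lker (amull (scemb phi (a i))))%VS.
  by move=> c /(subvP sub); rewrite memv_ker amullE => /eqP.
rewrite CI; apply/span_subvP => _ /mapP[w wI ->]; rewrite memv_ker amullE.
have wC : scemb phi w \in C q.2 by rewrite CI mem_extend_vsE vbasis_mem.
have := az q qE qp _ wC; rewrite [_ * _]mulr_suml => s0.
have aw0 : a i * w = 0.
  apply: (scemb_indep (a := fun l => a l * w) csi _ ic); rewrite -[RHS]s0.
  by apply: eq_bigr => l _; rewrite scembM -[_ *: _ * _]scalerAl.
by rewrite -[_ * _]scembM aw0; apply/eqP/rowP => l; rewrite !mxE linear0 rmorph0.
Qed.

(** [tangent] is the parabolic subalgebra of the flag. Its quotient by the left annihilator of the
    smaller members leaves the [y] whose image lies in the next member. *)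
Definition conductor (y : B) := forall z, annihilates z -> tangent (y * z).

(** Both factors are decomposed: the components of [z] still annihilate, so only products of
    elements of [A] are left, to which [tangent_rational] applies. *)
Lemma conductor_rational : rational conductor.
Proof.
move=> cs csi a ca i ic z; have [ds dsi [b ->]] := scext_decomp z => az.
rewrite [_ * _]mulr_sumr.
under eq_bigr do rewrite -[_ * (_ *: _)]scalerAr.
apply: tangent_sum => l; have := ca _ (annihilates_rational dsi az (ltn_ord l)).
rewrite [_ * _]mulr_suml => h; rewrite -[_ * _]scembM.
apply: (tangent_rational (a := fun k => a k * b l) csi _ ic).
have -> : \sum_(k < size cs) cs`_k *: scemb phi (a k * b l) =
    \sum_(k < size cs) cs`_k *: scemb phi (a k) * scemb phi (b l).
  by apply: eq_bigr => k _; rewrite scembM -[_ *: _ * _]scalerAl.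
exact: h.
Qed.

Let an : (1 <= p.2 <= n)%N.
Proof.
by have /andP[-> /ltnW] := essential_lt d_bounds lam_sorted lam_bound pE.
Qed.

(* [tangent] is the stabilizer of the ideals of the flag, by [tangent_stable], so
   that each of them is determined by [tangent] and the smaller ones. *)
Lemma chain_conductor y : y \in C p.2 <-> conductor y.
Proof.
have [e [x' [y' sd]]] := splits_data n_gt0 degA K_splits.
have rCp := full_chain_ideal C_full an.
split=> [yC z az|cy].
  (* [y * z] kills the members smaller than [C p.2] and sends everything into [C p.2], which is
     contained in the others. *)
  apply/tangent_stable => q qE; apply/subvP => _ /memv_linel[u uC ->].
  have [qp|pq] := ltnP q.2 p.2; first by rewrite -mulrA (az q) // mulr0 mem0v.
  have /andP[_ qn] := essential_lt d_bounds lam_sorted lam_bound qE.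
  apply: (subvP (full_chain_mono C_full _ _ : (C p.2 <= C q.2)%VS)).
  - by case/andP: an.
  - by rewrite pq ltnW.
  by rewrite -mulrA; apply: (proj1 (right_idealP _)).
pose T := (\sum_(q <- E | (q.2 < p.2)%N) C q.2)%VS.
have [rT TC] : right_ideal T /\ (T <= C p.2)%VS /\ (T != C p.2).
  have p1 : (1 <= p.2)%N by case/andP: an.
  have [p1'|p1'] := eqVneq p.2 1%N.
    have T0 : T = 0%VS.
      rewrite /T big_seq_cond big_pred0 // => q; apply/negP => /andP[qE].
      rewrite p1' ltnS leqn0 => /eqP q0.
      by have := essential_lt d_bounds lam_sorted lam_bound qE; rewrite q0.
    rewrite T0 sub0v eq_sym -dimv_eq0 (full_chain_dim degA K_splits d_bounds C_full an).
    by rewrite p1' mul1n -lt0n; split; [exact: right_ideal0|].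
  have p'n : (1 <= p.2.-1 <= n)%N by move: an p1'; clear; lia.
  have pp : (p.2.-1 < p.2)%N by rewrite ltn_predL.
  have Cpp : (C p.2.-1 <= C p.2)%VS.
    by apply: (full_chain_mono C_full); case/andP: p'n => // _ _; rewrite leq_pred; case/andP: an.
  have TC : (T <= C p.2.-1)%VS.
    rewrite /T big_seq_cond; elim/big_ind: _ => [|U V US VS|q /andP[qE qp]].
    - exact: sub0v.
    - by rewrite subv_add US.
    apply: (full_chain_mono C_full).
      by case/andP: (essential_lt d_bounds lam_sorted lam_bound qE).
    by rewrite -ltnS prednK // qp; case/andP: p'n.
  split; last split.
  - rewrite /T big_seq_cond; elim/big_ind: _ => [|U V|q /andP[qE _]].
    + exact: right_ideal0.
    + exact: right_idealD.
    apply: (full_chain_ideal C_full).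
    by have /andP[-> /ltnW] := essential_lt d_bounds lam_sorted lam_bound qE.
  - exact: subv_trans TC Cpp.
  apply/eqP => TE; move/dimvS: TC; rewrite TE.
  rewrite !(full_chain_dim degA K_splits d_bounds C_full) // leq_pmul2r //.
  by rewrite leqNgt pp.
(* [z] is the component of 1 in a complement of [T]. It kills [T] but not [C p.2]: from
   [t = f t + z t] with [f t] in [T], otherwise [C p.2] would be [T]. *)
have [W rW [TW capTW]] := right_ideal_compl (wd_idem sd.1) (wd_neq0 sd.1)
  (split_minimal n_gt0 sd) (wd_gen sd.1) rT.
have : (1 : B) \in (T + W)%VS by rewrite TW memvf.
case/memv_addP => f fT [z zW fz].
have zT c : c \in T -> z * c = 0.
  move=> cT; apply/eqP; rewrite -memv0 -capTW memv_cap; apply/andP; split.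
    have -> : z * c = c - f * c by rewrite -[X in X - _]mul1r fz mulrDl addrC addKr.
    by rewrite rpredB // (proj1 (right_idealP T)).
  exact: (proj1 (right_idealP W)).
have az r : annihilates (r * z).
  move=> q qE qp c cC; rewrite -mulrA zT ?mulr0 //.
  by apply: subvP cC; rewrite /T (big_rem q) //= qp addvSl.
have [t tC tz] : exists2 t, t \in C p.2 & z * t != 0.
  apply: NNPP => none; case/eqP: (proj2 TC).
  apply: subv_anti; rewrite (proj1 TC); apply/subvP => t tC.
  have zt : z * t = 0 by apply/eqP/negPn/negP => h; apply: none; exists t.
  by rewrite -[t]mul1r fz mulrDl zt addr0 (proj1 (right_idealP _)).
(* [r * z] annihilates for every [r], so [y B (z t)] is in [C p.2]. As [z t] generates [B] as a
   two-sided ideal, multiplying by [B] on the right reaches [y]. *)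
have yrt r : y * r * (z * t) \in C p.2.
  have /tangent_stable/(_ p pE) := cy _ (az r).
  move/subvP; apply; have -> : y * r * (z * t) = y * (r * z) * t by rewrite !mulrA.
  by rewrite memv_mul ?memv_line.
have Bt := simple_gen (split_simple n_gt0 sd) tz.
have : y * 1 \in (<[y]> * (fullv * <[z * t]> * fullv))%VS.
  by rewrite memv_mul ?memv_line // Bt memvf.
rewrite mulr1; apply: subvP; apply: subv_trans rCp; rewrite !prodvA.
apply: prodvSl; apply/prodvP => u v /memv_linel[r _ ->] /vlineP[c ->].
by rewrite -[_ * (c *: _)]scalerAr rpredZ.
Qed.

End Conductor.

Lemma essential_ideal_descends p : p \in E -> exists I, C p.2 = extend_vs phi I.
Proof.
have [k] := ubnP p.2; elim: k => // k IH in p *; rewrite ltnS => pk pE.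
apply: rational_extend => cs csi a aC i ic.
have I_prev q : q \in E -> (q.2 < p.2)%N -> exists I, C q.2 = extend_vs phi I.
  by move=> qE qp; apply: IH qE; apply: leq_trans qp pk.
apply/(chain_conductor pE)/(conductor_rational I_prev csi _ ic).
exact/(chain_conductor pE).
Qed.

Lemma flag_descends : exists I : nat -> {vspace A},
  forall p, p \in E -> C p.2 = extend_vs phi (I p.2).
Proof.
pose ok a I := C a = extend_vs phi I.
exists (fun a => epsilon (inhabits 0%VS) (ok a)) => p pE.
exact: (epsilon_spec (inhabits 0%VS) (ok p.2) (essential_ideal_descends pE)).
Qed.

End FlagDescent.

Section FlagPoints.
Variables (F : fieldType) (A : falgType F) (n : nat).
Hypothesis degA : \dim {:A} = (n ^ 2)%N.
Variables (K : fieldType) (phi : {rmorphism F -> K}).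
Hypothesis K_splits : splits A n phi.
Variable d : nat.
Hypothesis d_bounds : (1 <= d <= n)%N.
Variable lam : d.-tuple nat.
Hypotheses (lam_sorted : sorted geq lam).
Hypothesis lam_bound : all (fun x => (x <= n - d)%N) lam.

Local Notation E := (essential_set n d lam).

Let n_gt0 : (0 < n)%N. Proof. by case/andP: d_bounds => d0; apply: leq_trans. Qed.

Variable I : nat -> {vspace A}.
Hypothesis I_ideal : forall p, p \in E -> right_ideal (I p.2).
Hypothesis I_mono : forall p q, p \in E -> q \in E ->
  (p.2 <= q.2)%N -> (I p.2 <= I q.2)%VS.

Local Notation VI := (vanish_ideal (n := n) (d := d)
  (fun L (psi : {rmorphism F -> L}) => @flag_variety F A n d E I L psi)).

(** If the condition [p] fails at [J], [adapted_functionals] gives a determinant over [L] that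
    vanishes on the variety and is 1 at [J]. Since the ideal over [L] is spanned by the one over
    [F], some equation over [F] is then nonzero at [J]. *)
Lemma vanish_flag_points (L : fieldType) (psi : {rmorphism F -> L})
    (J : {vspace scext A psi}) :
  (SB n d J /\ forall f, VI (idfun : {rmorphism F -> F}) f ->
     vanishes_at (map_mpoly psi f) J) <-> flag_variety n d E I J.
Proof.
split=> [[SBJ vJ]|XJ]; last by split=> [|f vf]; [case: XJ | apply: vf XJ].
split=> // p pE; rewrite leqNgt /rrank ltn_divLR //; apply/negP => lt.
have [_ dJ] := proj1 (SB_dim d n_gt0 degA K_splits J) SBJ.
set U := extend_vs psi (I p.2) in lt.
have [b [T [bJ bT _ _ TU]]] := adapted_functionals U dJ.
pose g : pcoord[L, A, n, d] := linform (detform T).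
have vg : VI psi g.
  move=> M tau rho rhoE J1 [SB1 cJ1].
  pose R := ~: [set r : 'I_(d * n) | (r < \dim (J :&: U))%N].
  rewrite /g; apply: (detform_vanishes (R := R) (U := U)) => [u r uU|].
    by rewrite !inE -leqNgt; apply: TU.
  rewrite (scspan_extend_vs rhoE).
  have := cJ1 p pE; rewrite /rrank leq_divRL // => le1.
  have := cardsC [set r : 'I_(d * n) | (r < \dim (J :&: U))%N].
  rewrite card_ord => kE; rewrite -{1}kE.
  apply: leq_ltn_trans (_ : \dim (J :&: U) + #|R| < _)%N.
    by rewrite leq_add2r card_ord_lt.
  by rewrite ltn_add2r (leq_trans lt).
have [r [c [f [vf gE]]]] := vanish_flag_descends degA K_splits d_bounds
  lam_sorted lam_bound I_ideal I_mono vg.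
have g0 : g.@[pluecker b] = 0.
  rewrite gE meval_sum big1 // => i _; rewrite mevalZ (vJ _ (vf i) b bJ).
  by rewrite mulr0.
have /eqP : g.@[pluecker b] = 1.
  rewrite (meval_eq _ (pluecker_rowsmx b)) meval_linform detformE bT.
  exact: det1.
by rewrite g0 eq_sym oner_eq0.
Qed.

End FlagPoints.

Lemma extend_vs_right_ideal_inv (F : fieldType) (A : falgType F) (L : fieldType)
    (phi : {rmorphism F -> L}) (U : {vspace A}) :
  right_ideal (extend_vs phi U) -> right_ideal U.
Proof.
by rewrite /right_ideal -(extend_vs_full A phi) -extend_vs_prod extend_vsSE.
Qed.

Theorem theorem3p7 (F : fieldType) (A : falgType F) (n : nat)
    (A_central : central_algebra A) (A_simple : simple_algebra A)
    (degA : \dim {:A} = (n ^ 2)%N)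
    (K : fieldType) (phi : {rmorphism F -> K}) (K_splits : splits A n phi)
    (d : nat) (d_bounds : (1 <= d <= n)%N)
    (lam : d.-tuple nat) (lam_sorted : sorted geq lam)
    (lam_bound : all (fun x => (x <= n - d)%N) lam) :
  ((exists P : closed_subvariety A n d, extends_to_schubert lam phi P) <->
   (ind A %| \big[gcdn/0%N]_(a <- essential_proj n d lam) a)%N) /\
  (forall P : closed_subvariety A n d, extends_to_schubert lam phi P ->
   exists I : nat -> {vspace A},
     [/\ forall a, a \in essential_proj n d lam ->
           right_ideal (I a) /\ rrank n (I a) = a,
         forall a b, a \in essential_proj n d lam ->
           b \in essential_proj n d lam -> (a < b)%N -> (I a <= I b)%VS
       & forall (L : fieldExtType F) (J : {vspace scext A (in_alg L)}),
           points P J <->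
           SB n d J /\
           forall j a, (j, a) \in essential_set n d lam ->
             (j <= rrank n (J :&: extend_vs (in_alg L) (I a)))%N]).
Proof.
have n_gt0 : (0 < n)%N by case/andP: d_bounds => d0; apply: leq_trans.
have flag (P : closed_subvariety A n d) (C : nat -> {vspace scext A phi}) :
    full_chain n C -> (forall g, ext_ideal P phi g <-> schubert_ideal lam C g) ->
  exists I : nat -> {vspace A},
    (forall p, p \in essential_set n d lam -> C p.2 = extend_vs phi (I p.2)) /\
    (forall p, p \in essential_set n d lam -> right_ideal (I p.2) /\ \dim (I p.2) = (p.2 * n)%N).
  move=> C_full PC.
  have [I CI] := flag_descends degA K_splits d_bounds lam_sorted lam_bound C_full PC.
  exists I; split=> // p pE.
  have /andP[p1 /ltnW pn] := essential_lt d_bounds lam_sorted lam_bound pE.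
  have pn' : (1 <= p.2 <= n)%N by rewrite p1.
  split; last first.
    by rewrite -(dim_extend_vs phi) -CI // (full_chain_dim degA K_splits d_bounds C_full).
  apply: (@extend_vs_right_ideal_inv _ _ _ phi); rewrite -CI //.
  exact: (full_chain_ideal C_full).
split.
  split=> [[P [C [C_full PC]]]|/essential_dvd dv]; last first.
    exact: (exists_subvariety A_central A_simple degA K_splits).
  have [I [_ rI]] := flag P C C_full PC.
  apply/essential_dvd => p /rI[rIp dIp].
  by have := ind_dvd degA A_central A_simple rIp; rewrite dIp mulnC dvdn_pmul2r.
move=> P [C [C_full PC]]; have [I [CI rI]] := flag P C C_full PC.
have I_ideal p : p \in essential_set n d lam -> right_ideal (I p.2) by move=> /rI[].
have I_mono p q : p \in essential_set n d lam -> q \in essential_set n d lam ->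
    (p.2 <= q.2)%N -> (I p.2 <= I q.2)%VS.
  move=> pE qE pq; rewrite -(extend_vsSE phi) -!CI //.
  have /andP[p1 _] := essential_lt d_bounds lam_sorted lam_bound pE.
  have /andP[_ /ltnW qn] := essential_lt d_bounds lam_sorted lam_bound qE.
  by apply: (full_chain_mono C_full); rewrite // pq.
exists I; split.
- by move=> _ /mapP[p pE ->]; have [rp dp] := rI p pE; rewrite /rrank dp mulnK.
- by move=> _ _ /mapP[p pE ->] /mapP[q qE ->] /ltnW; apply: I_mono.
move=> L J; split=> [[SBJ vJ]|[SBJ cJ]].
  have /(vanish_flag_points degA K_splits d_bounds lam_sorted lam_bound I_ideal I_mono)[_ cJ] :
      SB n d J /\ forall f, vanish_ideal (n := n) (d := d)
        (fun L (psi : {rmorphism F -> L}) =>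
           @flag_variety F A n d (essential_set n d lam) I L psi)
        (idfun : {rmorphism F -> F}) f -> vanishes_at (map_mpoly (in_alg L) f) J.
    split=> // f vf; apply: vJ.
    exact/(schubert_ideal_flag degA K_splits d_bounds lam_sorted lam_bound
      I_ideal I_mono _ C_full CI PC).
  by split=> // j a jE; apply: (cJ (j, a)).
have XJ : flag_variety n d (essential_set n d lam) I J.
  by split=> // -[j a] jE; apply: cJ.
have [_ vJ] := (vanish_flag_points degA K_splits d_bounds lam_sorted lam_bound
  I_ideal I_mono J).2 XJ.
split=> // f /(schubert_ideal_flag degA K_splits d_bounds lam_sorted lam_bound
  I_ideal I_mono _ C_full CI PC); exact: vJ.
Qed.
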